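(* Under the standing assumptions of the context, as $l\to\infty$, $$|\Delta^2_{\widehat{\psi_l^{\bot}}}-\Delta^2_{\widehat{\psi^M}}|=O\Big(\max\big\{\mu(l),\,l\,C_0^{-l+2\log_2\frac{1+\varepsilon(l)}{c}}\big\}\Big),\qquad |\Delta^2_{\psi_l^{\bot}}-\Delta^2_{\psi^M}|=O\Big(\max\big\{\mu(l),\,(4e^{2\omega_0})^{-l+2\log_2\frac{1+\varepsilon(l)}{c}}\big\}\Big),$$ where $C_0:=\frac{32\pi^2e^{2\omega_0}}{27}$.
   Context: Fourier transform: $\widehat f(\omega)=\int_{\mathbb{R}}f(t)e^{-it\omega}\,dt$. Let $\theta$ be odd, non-decreasing, $C^2$, with $\theta(\omega)=\pi/4$ for $\omega>\pi/3$; fix $\pi/3\le\omega_0<\pi/2$. Meyer scaling function: $\widehat{\varphi^M}(\omega)=1$ for $|\omega|\le2\omega_0$, $=\cos(\frac\pi4+\theta(\frac{\pi}{3(\pi-2\omega_0)}(|\omega|-\pi)))$ for $2\omega_0<|\omega|\le2\pi-2\omega_0$, $=0$ otherwise. Meyer mask: $2\pi$-periodic $m^M$ with $m^M(\omega)=\widehat{\varphi^M}(2\omega)$ on $[-\pi,\pi]$. Meyer wavelet: $\widehat{\psi^M}(\omega)=e^{-i\omega/2}\overline{m^M(\omega/2+\pi)}\widehat{\varphi^M}(\omega/2)$. $\|\cdot\|_C$: sup norm on $[-\pi,\pi]$. A linear method of summation $(\lambda_{n,k})$ maps $f$ with Fourier coefficients $a_k,b_k$ to $u_n(f,\omega)=\frac{a_0}2+\sum_{k=1}^n\lambda_{n,k}(a_k\cos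 k\omega+b_k\sin k\omega)$. $m^M_l:=m^M/(\cos\frac\omega2)^{2l}$. Standing assumptions: a method and a sequence $n(l)$ are fixed with $u_l:=u_{n(l)}(m^M_l,\cdot)$, $u_{1,l}:=u_{n(l)}((m^M_l)',\cdot)$ satisfying $\alpha(l):=\|u_l-m^M_l\|_C=o(l^{-1})$, $\gamma(l):=\|u_{1,l}-(m^M_l)'\|_C=o(1)$, $u_l(\pi)\ne0$; $l_0$ is fixed with $c:=\inf_{l\ge l_0}|u_l(0)|>0$ and $l\ge l_0$. $\varepsilon(l):=\alpha(l)/\|m^M_l\|_C$, $\mu(l):=l\alpha(l)+\gamma(l)$. $m_l(\omega):=(\cos\frac\omega2)^{2l}u_l(\omega)/u_l(0)$, $\widehat{\varphi_l}(\omega):=\prod_{j\ge1}m_l(\omega2^{-j})$, $\Phi_l(\omega):=\sum_{k}|\widehat{\varphi_l}(\omega+2\pi k)|^2$, $\widehat{\varphi_l^{\bot}}:=\widehat{\varphi_l}\Phi_l^{-1/2}$, $m_l^\bot(\omega):=m_l(\omega)\Phi_l(\omega)^{1/2}\Phi_l(2\omega)^{-1/2}$, $\widehat{\psi_l^\bot}(\omega):=e^{-i\omega/2}\overline{m_l^\bot(\omega/2+\pi)}\widehat{\varphi_l^\bot}(\omega/2)$. Time and frequency radii: $\Delta_f^2=\|f\|_{L^2}^{-2}\int(t-t_{0f})^2|f(t)|^2dt$, $t_{0f}=\|f\|_{L^2}^{-2}\int t|f(t)|^2dt$; $\Delta^2_{\widehat f}=\|\widehat f\|_{L^2}^{-2}\int(\omega-\omega_{0\widehat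 f})^2|\widehat f(\omega)|^2d\omega$, $\omega_{0\widehat f}=\|\widehat f\|_{L^2}^{-2}\int\omega|\widehat f(\omega)|^2d\omega$. *)

(* Defs.v *)
From Stdlib Require Import Reals.
From Coquelicot Require Export Coquelicot.
Open Scope R_scope.

Definition cexpi (x : R) : C := (cos x, sin x).

Definition RIntR (f : R -> R) : R :=
  RInt_gen f (Rbar_locally m_infty) (Rbar_locally p_infty).

Definition CIntR (f : R -> C) : C :=
  (RIntR (fun t => Re (f t)), RIntR (fun t => Im (f t))).

(** Inverse Fourier transform for the convention
    \hat f(w) = \int f(t) e^{-itw} dt :  f(t) = (1/2pi) \int \hat f(w) e^{itw} dw *)
Definition inv_fourier (g : R -> C) (t : R) : C :=
  Cmult (RtoC (/ (2 * PI))) (CIntR (fun w => Cmult (g w) (cexpi (t * w)))).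

Definition L2sq (f : R -> C) : R := RIntR (fun t => (Cmod (f t)) ^ 2).
Definition center (f : R -> C) : R := RIntR (fun t => t * (Cmod (f t)) ^ 2) / L2sq f.
Definition radius2 (f : R -> C) : R :=
  RIntR (fun t => (t - center f) ^ 2 * (Cmod (f t)) ^ 2) / L2sq f.

Definition supnorm (g : R -> R) : R :=
  real (Lub_Rbar (fun y => exists x, -PI <= x <= PI /\ y = Rabs (g x))).

Definition log2 (x : R) : R := ln x / ln 2.

Section Meyer.
Variables (theta : R -> R) (w0 : R).

Definition phiM_hat (w : R) : R :=
  if Rle_dec (Rabs w) (2 * w0) then 1
  else if Rle_dec (Rabs w) (2 * PI - 2 * w0) then
    cos (PI / 4 + theta (PI / (3 * (PI - 2 * w0)) * (Rabs w - PI)))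
  else 0.

(** 2pi-periodic mask, equal to phiM_hat(2w) on [-pi,pi) (and at pi both
    sides give 0). *)
Definition mM (w : R) : R :=
  phiM_hat (2 * (w - 2 * PI * IZR (Int_part ((w + PI) / (2 * PI))))).

Definition psiM_hat (w : R) : C :=
  Cmult (cexpi (- w / 2)) (Cmult (Cconj (RtoC (mM (w / 2 + PI)))) (RtoC (phiM_hat (w / 2)))).

Definition mMl (l : nat) (w : R) : R := mM w / (cos (w / 2)) ^ (2 * l).

End Meyer.

Definition fa (f : R -> R) (k : nat) : R := / PI * RInt (fun t => f t * cos (INR k * t)) (- PI) PI.
Definition fb (f : R -> R) (k : nat) : R := / PI * RInt (fun t => f t * sin (INR k * t)) (- PI) PI.

Definition usum (lam : nat -> nat -> R) (n : nat) (f : R -> R) (w : R) : R :=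
  fa f 0 / 2 +
  sum_n_m (fun k => lam n k * (fa f k * cos (INR k * w) + fb f k * sin (INR k * w))) 1 n.

Fixpoint partprod (f : nat -> R) (N : nat) : R :=
  match N with O => 1 | S N' => partprod f N' * f (S N') end.

Section Construction.
Variables (theta : R -> R) (w0 : R) (lam : nat -> nat -> R) (n : nat -> nat) (l0 : nat).

Definition u_l (l : nat) : R -> R := usum lam (n l) (mMl theta w0 l).
Definition u1_l (l : nat) : R -> R := usum lam (n l) (Derive (mMl theta w0 l)).

Definition alpha (l : nat) : R := supnorm (fun w => u_l l w - mMl theta w0 l w).
Definition gamma (l : nat) : R := supnorm (fun w => u1_l l w - Derive (mMl theta w0 l) w).
Definition eps (l : nat) : R := alpha l / supnorm (mMl theta w0 l).
Definition mu (l : nat) : R := INR l * alpha l + gamma l.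

Definition cconst : R :=
  real (Glb_Rbar (fun y => exists l, (l0 <= l)%nat /\ y = Rabs (u_l l 0))).

Definition m_l (l : nat) (w : R) : R := (cos (w / 2)) ^ (2 * l) * u_l l w / u_l l 0.

Definition phi_l_hat (l : nat) (w : R) : R :=
  real (Lim_seq (fun N => partprod (fun j => m_l l (w / 2 ^ j)) N)).

Definition Phi_l (l : nat) (w : R) : R :=
  Series (fun k => (Rabs (phi_l_hat l (w + 2 * PI * INR k))) ^ 2)
  + Series (fun k => (Rabs (phi_l_hat l (w - 2 * PI * INR (S k)))) ^ 2).

Definition phi_perp_hat (l : nat) (w : R) : R := phi_l_hat l w / sqrt (Phi_l l w).

Definition m_perp (l : nat) (w : R) : R :=
  m_l l w * sqrt (Phi_l l w) / sqrt (Phi_l l (2 * w)).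

Definition psi_perp_hat (l : nat) (w : R) : C :=
  Cmult (cexpi (- w / 2))
        (Cmult (Cconj (RtoC (m_perp l (w / 2 + PI)))) (RtoC (phi_perp_hat l (w / 2)))).

End Construction.

Definition C0 (w0 : R) : R := 32 * PI ^ 2 * exp (2 * w0) / 27.

(* Main.v *)
(* The second term of the maximum is not needed: both radii differ by O(mu(l)).

   Multiplication by [cos(w/2)^(2l)] turns the bounds [alpha], [gamma] on [u_l - m_l^M] and its
   derivative (a multiplier method commutes with differentiation) into: [m_l] is [O(mu)]-close in C^1 to
   the Meyer mask [m^M], and on the zone [sin^2(w/2) >= 3/4], where [m^M] vanishes, [m_l] and [m_l'] are
   even [O(mu cos^6(w/2))].
   Near the origin [m^M = 1], so the infinite product is [1 + O(mu)] in C^1. An orbit of [x -> 2x] that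
   leaves a neighbourhood of [2 pi Z] hits that zone, and if it then returns close to [2 pi Z], the
   factor [cos^6] pays for the number of steps it stays there; hence the product and its derivative are
   [O(mu |w|^-4)] outside the support of the Meyer scaling function. So the periodized square [Phi_l] is
   [1 + O(mu)] in C^1, and the wavelets are [e^(-iw/2)] times even real functions [G_l], [G^M] with
   [G_l - G^M] and its derivative [O(mu (1+w^2)^-2)].
   The frequency radii are then compared pointwise. In time the centre is 1/2, [s g(s)] is the sine
   transform of [G'], and a Bessel inequality for the transforms suffices. *)
Require Import Defs.
From Stdlib Require Import Reals Lra Lia Psatz.
From Coquelicot Require Import Coquelicot.
Open Scope R_scope.

(** * Improper integrals over the real line *)

(** The obstacle is uniformity in [l]: the [u_l] are known only through their C^1 distance to the
    divided mask, and the power of the cosine changes with [l]. So the key estimates fix their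
    constants from [theta] and [w0] before the mask is quantified, and [l] enters through one small
    number [e], a multiple of [mu]. The record [near] expresses this: limit and error, with first
    derivatives, are bounded by the same weight, the error with an extra factor [e]. It is stable
    under products, affine substitutions of slope at most 1, square roots and inverses near 1, and
    periodization: the operations that build the wavelet from the mask. With one controlled
    derivative the transforms have no pointwise decay that would make second moments converge, so
    the time side is estimated in mean square only. Any absolute constant is enough there, so
    Plancherel's identity gives way to a kernel bound with factor [10 * PI] in place of [2 * PI]. As
    both radii are quotients, the limiting norms must also be nonzero; in time this follows from the
    nonnegativity of the limiting symbol, whose transform at 0 is its integral. *)

Definition cont (f : R -> R) : Prop := forall x, continuous f x.

Lemma cont_const c : cont (fun _ => c).
Proof. intros x. apply continuous_const. Qed.
Lemma cont_id : cont (fun x => x).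
Proof. intros x. apply continuous_id. Qed.
Lemma cont_plus f g : cont f -> cont g -> cont (fun x => f x + g x).
Proof. intros Hf Hg x. exact (continuous_plus f g x (Hf x) (Hg x)). Qed.
Lemma cont_opp f : cont f -> cont (fun x => - f x).
Proof. intros Hf x. exact (continuous_opp f x (Hf x)). Qed.
Lemma cont_minus f g : cont f -> cont g -> cont (fun x => f x - g x).
Proof. intros Hf Hg x. exact (continuous_minus f g x (Hf x) (Hg x)). Qed.
Lemma cont_mult f g : cont f -> cont g -> cont (fun x => f x * g x).
Proof. intros Hf Hg x. exact (continuous_mult f g x (Hf x) (Hg x)). Qed.
Lemma cont_comp f g : cont f -> cont g -> cont (fun x => f (g x)).
Proof. intros Hf Hg x. exact (continuous_comp g f x (Hg x) (Hf (g x))). Qed.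
Lemma cont_derivable (f f' : R -> R) : (forall x, is_derive f x (f' x)) -> cont f.
Proof. intros H x. apply (@ex_derive_continuous R_AbsRing R_NormedModule). exists (f' x). exact (H x). Qed.
Lemma cont_abs f : cont f -> cont (fun x => Rabs (f x)).
Proof. apply (cont_comp Rabs). exact continuous_Rabs. Qed.
Lemma cont_cos f : cont f -> cont (fun x => cos (f x)).
Proof. apply (cont_comp cos). exact continuous_cos. Qed.
Lemma cont_sin f : cont f -> cont (fun x => sin (f x)).
Proof. apply (cont_comp sin). exact continuous_sin. Qed.
Lemma cont_pow f n : cont f -> cont (fun x => f x ^ n).
Proof.
  intros Hf. induction n as [|n IH]; simpl; [apply cont_const|].
  exact (cont_mult _ _ Hf IH).
Qed.
Lemma cont_inv f : cont f -> (forall x, f x <> 0) -> cont (fun x => / f x).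
Proof. intros Hf H0 x. apply continuous_Rinv_comp; auto. Qed.
Lemma cont_div f g : cont f -> cont g -> (forall x, g x <> 0) -> cont (fun x => f x / g x).
Proof. intros Hf Hg H0. apply cont_mult; [exact Hf|]. now apply cont_inv. Qed.
Lemma cont_sqrt f : cont f -> cont (fun x => sqrt (f x)).
Proof. apply (cont_comp sqrt). exact continuous_sqrt. Qed.
Lemma cont_ext f g : (forall x, f x = g x) -> cont f -> cont g.
Proof.
  intros E H x. apply (continuous_ext f); [exact E|]. apply H.
Qed.

Lemma Rabs_near x y a b : Rabs y <= a -> Rabs (x - y) <= b -> Rabs x <= a + b.
Proof. intros Hy H. revert Hy H. unfold Rabs. repeat destruct Rcase_abs; lra. Qed.
Lemma derive_const c x : is_derive (fun _ : R => c) x 0.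
Proof. apply (is_derive_const (K := R_AbsRing) (V := R_NormedModule)). Qed.
Lemma Rabs_half x : Rabs (x / 2) = Rabs x / 2.
Proof. unfold Rdiv. rewrite Rabs_mult, (Rabs_pos_eq (/ 2)); lra. Qed.
(** [27 / 8] is the value that gives [8 * PI / 3 < 9] and [4 * PI / 3 < 9 / 2]: bounds for the first
    dyadic shell outside the Meyer support and for the support itself. *)
Lemma PI_bounds : 3 < PI < 27 / 8.
Proof.
  assert (H3 := PI2_3_2). destruct (PI_ineq 3) as [_ H]. unfold PI_tg, tg_alt in H. simpl in H. lra.
Qed.

Ltac cont_step :=
  first [ assumption
  | lazymatch goal with
    | |- cont (fun _ => ?c) => apply (cont_const c)
    | |- cont (fun x => x) => apply cont_id
    | |- cont (fun x => @?f x + @?g x) => apply (cont_plus f g)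
    | |- cont (fun x => @?f x - @?g x) => apply (cont_minus f g)
    | |- cont (fun x => - @?f x) => apply (cont_opp f)
    | |- cont (fun x => @?f x * @?g x) => apply (cont_mult f g)
    | |- cont (fun x => @?f x / @?g x) => apply (cont_div f g)
    | |- cont (fun x => / @?f x) => apply (cont_inv f)
    | |- cont (fun x => Rabs (@?f x)) => apply (cont_abs f)
    | |- cont (fun x => cos (@?f x)) => apply (cont_cos f)
    | |- cont (fun x => sin (@?f x)) => apply (cont_sin f)
    | |- cont (fun x => sqrt (@?f x)) => apply (cont_sqrt f)
    | |- cont (fun x => @?f x ^ ?n) => apply (cont_pow f n)
    | H : cont ?h |- cont (fun x => ?h (@?g x)) => apply (cont_comp h g H)
    end ].
Ltac cont_tac := repeat cont_step.

Lemma ex_RI f a b : cont f -> ex_RInt f a b.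
Proof. intros H. apply (@ex_RInt_continuous R_CompleteNormedModule). intros; apply H. Qed.

Lemma RI_plus f g a b : cont f -> cont g ->
  RInt (fun x => f x + g x) a b = RInt f a b + RInt g a b.
Proof. intros; apply (@RInt_plus R_CompleteNormedModule); now apply ex_RI. Qed.
Lemma RI_minus f g a b : cont f -> cont g ->
  RInt (fun x => f x - g x) a b = RInt f a b - RInt g a b.
Proof. intros; apply (@RInt_minus R_CompleteNormedModule); now apply ex_RI. Qed.
Lemma RI_scal k f a b : cont f -> RInt (fun x => k * f x) a b = k * RInt f a b.
Proof. intros; apply (@RInt_scal R_CompleteNormedModule); now apply ex_RI. Qed.
Lemma RI_le f g a b : a <= b -> cont f -> cont g ->
  (forall x, f x <= g x) -> RInt f a b <= RInt g a b.
Proof. intros; apply RInt_le; auto; now apply ex_RI. Qed.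
Lemma RI_Chasles f a b c : cont f -> RInt f a b + RInt f b c = RInt f a c.
Proof. intros; apply (@RInt_Chasles R_CompleteNormedModule); now apply ex_RI. Qed.
Lemma RI_pos f a b : a <= b -> cont f -> (forall x, 0 <= f x) -> 0 <= RInt f a b.
Proof. intros; apply RInt_ge_0; auto; now apply ex_RI. Qed.
Lemma RI_abs f a b : a <= b -> cont f ->
  Rabs (RInt f a b) <= RInt (fun x => Rabs (f x)) a b.
Proof. intros; apply abs_RInt_le; auto; now apply ex_RI. Qed.
Lemma RI_ext (f g : R -> R) a b : (forall x, f x = g x) -> RInt f a b = RInt g a b.
Proof. intros; apply RInt_ext; auto. Qed.
Lemma RI_FTC (F f : R -> R) a b : (forall x, is_derive F x (f x)) -> cont f ->
  RInt f a b = F b - F a.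
Proof.
  intros HF Hf. apply is_RInt_unique. apply (is_RInt_derive F f); intros; auto.
Qed.
Lemma RI_incl f a b c d : c <= a -> a <= b -> b <= d -> cont f -> (forall x, 0 <= f x) ->
  RInt f a b <= RInt f c d.
Proof.
  intros. rewrite <- (RI_Chasles f c a d), <- (RI_Chasles f a b d); auto.
  assert (0 <= RInt f c a) by (apply RI_pos; auto).
  assert (0 <= RInt f b d) by (apply RI_pos; auto). lra.
Qed.

Definition is_intR (f : R -> R) (l : R) : Prop :=
  is_RInt_gen f (Rbar_locally m_infty) (Rbar_locally p_infty) l.

Lemma is_intR_RIntR f l : is_intR f l -> RIntR f = l.
Proof. intros H. unfold RIntR. now apply is_RInt_gen_unique. Qed.

Lemma is_intR_intro f l : cont f ->
  (forall eps, 0 < eps -> exists T, forall a b, a < - T -> T < b ->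
     Rabs (RInt f a b - l) < eps) -> is_intR f l.
Proof.
  intros Hf H P [eps HP].
  destruct (H eps (cond_pos eps)) as [T HT].
  apply (Filter_prod _ _ _ (fun a => a < - T) (fun b => T < b)).
  - exists (- T). auto.
  - exists T. auto.
  - intros a b Ha Hb. exists (RInt f a b). split.
    + apply (@RInt_correct R_CompleteNormedModule). now apply ex_RI.
    + apply HP. apply HT; auto.
Qed.

Lemma is_intR_elim f l : is_intR f l ->
  forall eps, 0 < eps -> exists T, forall a b, a < - T -> T < b ->
     Rabs (RInt f a b - l) < eps.
Proof.
  intros H eps Heps.
  specialize (H (fun y => Rabs (y - l) < eps)).
  destruct H as [P Q [M1 HP] [M2 HQ] HPQ].
  { exists (mkposreal eps Heps). intros y Hy. exact Hy. }
  exists (Rmax (- M1) M2). intros a b Ha Hb.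
  assert (- M1 <= Rmax (- M1) M2) by apply Rmax_l.
  assert (M2 <= Rmax (- M1) M2) by apply Rmax_r.
  destruct (HPQ a b) as [y [Hy Hy']].
  - apply HP. lra.
  - apply HQ. lra.
  - simpl in Hy. now rewrite (is_RInt_unique _ _ _ _ Hy).
Qed.

Lemma is_intR_plus f g lf lg : is_intR f lf -> is_intR g lg -> is_intR (fun x => f x + g x) (lf + lg).
Proof. intros Hf Hg. exact (is_RInt_gen_plus f g lf lg Hf Hg). Qed.
Lemma is_intR_minus f g lf lg : is_intR f lf -> is_intR g lg -> is_intR (fun x => f x - g x) (lf - lg).
Proof. intros Hf Hg. exact (is_RInt_gen_minus f g lf lg Hf Hg). Qed.
Lemma is_intR_scal k f l : is_intR f l -> is_intR (fun x => k * f x) (k * l).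
Proof. intros Hf. exact (is_RInt_gen_scal f k l Hf). Qed.
Lemma is_intR_ext (f g : R -> R) l : (forall x, f x = g x) -> is_intR f l -> is_intR g l.
Proof.
  intros E H. refine (is_RInt_gen_ext f g l _ H).
  apply (Filter_prod _ _ _ (fun _ => True) (fun _ => True)); [now exists 0 | now exists 0 | ].
  intros; apply E.
Qed.

Lemma RIntR_ext (f g : R -> R) l : (forall x, f x = g x) -> is_intR g l -> RIntR f = l.
Proof. intros E H. apply is_intR_RIntR. now apply (is_intR_ext g f). Qed.

Lemma RI_opp_arg f a b : cont f -> RInt (fun x => f (- x)) a b = RInt f (- b) (- a).
Proof.
  intros Hf. apply is_RInt_unique.
  apply (is_RInt_ext (fun x => scal (-1) (scal (-1) (f (-1 * x + 0))))).
  { intros x _. unfold scal; simpl; unfold mult; simpl.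
    replace (-1 * x + 0) with (- x) by ring. ring. }
  replace (RInt f (- b) (- a)) with (scal (-1) (RInt f (- a) (- b))).
  - apply (is_RInt_scal (V := R_NormedModule)). apply (is_RInt_comp_lin f).
    replace (-1 * a + 0) with (- a) by ring. replace (-1 * b + 0) with (- b) by ring.
    apply (@RInt_correct R_CompleteNormedModule). now apply ex_RI.
  - rewrite <- (opp_RInt_swap f) by now apply ex_RI.
    unfold scal, opp; simpl; unfold mult; simpl; ring.
Qed.

Lemma is_intR_opp_arg f l : cont f -> is_intR f l -> is_intR (fun x => f (- x)) l.
Proof.
  intros Hf H. apply is_intR_intro; [cont_tac|].
  intros eps Heps. destruct (is_intR_elim f l H eps Heps) as [T HT]. exists T. intros a b Ha Hb.
  rewrite RI_opp_arg by exact Hf. apply HT; lra.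
Qed.

Lemma is_intR_shift f l c : cont f -> is_intR f l -> is_intR (fun x => f (x - c)) l.
Proof.
  intros Hf H. apply is_intR_intro; [cont_tac|].
  intros eps Heps. destruct (is_intR_elim f l H eps Heps) as [T HT].
  exists (T + Rabs c). intros a b Ha Hb.
  assert (E : RInt (fun x => f (x - c)) a b = RInt f (a - c) (b - c)).
  { assert (E2 := RInt_comp_lin f 1 (- c) a b).
    replace (a - c) with (1 * a + - c) by ring. replace (b - c) with (1 * b + - c) by ring.
    rewrite <- E2; [|now apply ex_RI].
    apply RInt_ext. intros x _. unfold scal; simpl; unfold mult; simpl.
    rewrite Rmult_1_l. f_equal. ring. }
  rewrite E. assert (Hc := Rle_abs c). assert (Hc' := Rle_abs (- c)). rewrite Rabs_Ropp in Hc'.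
  apply HT; lra.
Qed.

(** Reflection preserves the integral and oddness reverses its sign, so [l = - l]. *)
Lemma is_intR_odd f l : cont f -> (forall x, f (- x) = - f x) -> is_intR f l -> l = 0.
Proof.
  intros Hf Ho H.
  assert (H1 := is_intR_RIntR _ _ (is_intR_opp_arg f l Hf H)).
  assert (H2 : RIntR (fun x => f (- x)) = -1 * l).
  { apply (RIntR_ext _ (fun x => -1 * f x)); [intros; rewrite Ho; ring | now apply is_intR_scal]. }
  lra.
Qed.

Lemma is_intR_primitive (F f : R -> R) : (forall x, is_derive F x (f x)) -> cont f ->
  is_lim F p_infty 0 -> is_lim F m_infty 0 -> is_intR f 0.
Proof.
  intros HF Hf Hp Hm. apply is_intR_intro; [exact Hf|]. intros eps Heps.
  assert (He : 0 < eps / 2) by lra.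
  apply is_lim_spec in Hp; apply is_lim_spec in Hm.
  destruct (Hp (mkposreal _ He)) as [T1 HT1], (Hm (mkposreal _ He)) as [T2 HT2]. simpl in *.
  exists (Rmax T1 (- T2)). intros a b Ha Hb.
  assert (T1 <= Rmax T1 (- T2)) by apply Rmax_l.
  assert (- T2 <= Rmax T1 (- T2)) by apply Rmax_r.
  rewrite (RI_FTC F f) by auto.
  specialize (HT1 b ltac:(lra)); specialize (HT2 a ltac:(lra)).
  revert HT1 HT2; unfold Rabs; repeat destruct Rcase_abs; lra.
Qed.

(** Absolute integrability with a constant: one bound for all segments yields both the existence of
    the improper integral and an estimate of its value. *)
Definition absint (f : R -> R) (B : R) : Prop :=
  cont f /\ forall a b, a <= b -> RInt (fun x => Rabs (f x)) a b <= B.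

(** Segment integrals of a nonnegative function grow with the segment, so their supremum over
    symmetric segments is the improper integral. *)
Lemma absint_nonneg f B : cont f -> (forall x, 0 <= f x) ->
  (forall a b, a <= b -> RInt f a b <= B) -> exists l, is_intR f l.
Proof.
  intros Hf Hp HB.
  destruct (completeness (fun y => exists T, 0 <= T /\ y = RInt f (- T) T)) as [l [Hl1 Hl2]].
  - exists B. intros y [T [HT ->]]. apply HB; lra.
  - exists (RInt f (- 0) 0), 0. split; [lra|reflexivity].
  - exists l. apply is_intR_intro; [exact Hf|]. intros eps Heps.
    assert (H : exists T, 0 <= T /\ l - eps < RInt f (- T) T).
    { apply Classical_Prop.NNPP; intros Hn.
      assert (l <= l - eps); [|lra]. apply Hl2. intros y [T [HT ->]].
      apply Rnot_lt_le. intros Hlt. apply Hn. exists T. auto. }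
    destruct H as [T [HT HlT]]. exists T. intros a b Ha Hb.
    assert (RInt f (- T) T <= RInt f a b) by (apply RI_incl; auto; lra).
    assert (RInt f a b <= l).
    { apply Rle_trans with (RInt f (- Rmax (- a) b) (Rmax (- a) b)).
      - assert (- a <= Rmax (- a) b) by apply Rmax_l.
        assert (b <= Rmax (- a) b) by apply Rmax_r.
        apply RI_incl; auto; lra.
      - apply Hl1. exists (Rmax (- a) b). split; [|reflexivity].
        apply Rle_trans with b; [lra|apply Rmax_r]. }
    unfold Rabs; destruct Rcase_abs; lra.
Qed.

(** [f] is the difference of the nonnegative functions [|f| + f] and [|f|], whose segment integrals
    are bounded by [2 * B] and [B]. *)
Lemma absint_ex f B : absint f B -> is_intR f (RIntR f).
Proof.
  intros [Hf HB].
  destruct (absint_nonneg (fun x => Rabs (f x)) B) as [l1 H1];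
    [cont_tac | intros; apply Rabs_pos | exact HB |].
  destruct (absint_nonneg (fun x => Rabs (f x) + f x) (2 * B)) as [l2 H2].
  - cont_tac.
  - intros x. unfold Rabs; destruct Rcase_abs; lra.
  - intros a b Hab. rewrite RI_plus by cont_tac.
    specialize (HB a b Hab). assert (H := RI_abs f a b Hab Hf).
    assert (H' := Rle_abs (RInt f a b)). lra.
  - assert (H : is_intR f (l2 - l1)).
    { apply (is_intR_ext (fun x => (Rabs (f x) + f x) - Rabs (f x))); [intros; ring|].
      now apply is_intR_minus. }
    now rewrite (is_intR_RIntR _ _ H).
Qed.

Lemma is_intR_abs_le f B l : absint f B -> is_intR f l -> Rabs l <= B.
Proof.
  intros [Hf HB] H. apply Rnot_lt_le. intros Hlt.
  destruct (is_intR_elim f l H (Rabs l - B)) as [T HT]; [lra|].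
  assert (HT0 : T <= Rabs T) by apply Rle_abs. assert (HT1 := Rabs_pos T).
  specialize (HT (- (Rabs T + 1)) (Rabs T + 1) ltac:(lra) ltac:(lra)).
  assert (H1 := RI_abs f (- (Rabs T + 1)) (Rabs T + 1) ltac:(lra) Hf).
  specialize (HB (- (Rabs T + 1)) (Rabs T + 1) ltac:(lra)).
  set (r := RInt f _ _) in *.
  assert (Rabs l <= Rabs r + Rabs (r - l)).
  { replace l with (r - (r - l)) at 1 by ring. unfold Rminus at 1.
    eapply Rle_trans; [apply Rabs_triang|]. rewrite Rabs_Ropp. lra. }
  lra.
Qed.

Lemma absint_bound f B : absint f B -> Rabs (RIntR f) <= B.
Proof. intros H. apply (is_intR_abs_le f B); [exact H|]. now apply absint_ex with B. Qed.

Lemma absint_dom f g B : cont f -> absint g B -> (forall x, Rabs (f x) <= g x) -> absint f B.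
Proof.
  intros Hf [Hg HB] H. split; [exact Hf|]. intros a b Hab.
  eapply Rle_trans; [|apply (HB a b Hab)].
  apply RI_le; auto; cont_tac. intros x. eapply Rle_trans; [apply H|]. apply Rle_abs.
Qed.

Lemma absint_scal k f B : absint f B -> absint (fun x => k * f x) (Rabs k * B).
Proof.
  intros [Hf HB]. split; [cont_tac|]. intros a b Hab.
  rewrite (RI_ext _ (fun x => Rabs k * Rabs (f x))) by (intros; apply Rabs_mult).
  rewrite RI_scal by cont_tac. apply Rmult_le_compat_l; [apply Rabs_pos|]. auto.
Qed.

Lemma absint_plus f g B C : absint f B -> absint g C -> absint (fun x => f x + g x) (B + C).
Proof.
  intros [Hf HB] [Hg HC]. split; [cont_tac|]. intros a b Hab.
  apply Rle_trans with (RInt (fun x => Rabs (f x) + Rabs (g x)) a b).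
  - apply RI_le; auto; cont_tac. intros; apply Rabs_triang.
  - rewrite RI_plus by cont_tac. specialize (HB a b Hab); specialize (HC a b Hab). lra.
Qed.

Lemma is_intR_ge_RInt f l a b : cont f -> (forall x, 0 <= f x) -> is_intR f l -> a <= b ->
  RInt f a b <= l.
Proof.
  intros Hf Hp H Hab. apply Rnot_lt_le. intros Hlt.
  destruct (is_intR_elim f l H (RInt f a b - l)) as [T HT]; [lra|].
  set (c := Rabs T + Rabs a + Rabs b + 1).
  assert (H1 := Rle_abs T). assert (H2 := Rle_abs b). assert (H5 := Rle_abs (- a)).
  rewrite Rabs_Ropp in H5.
  assert (H3 := Rabs_pos T). assert (H4 := Rabs_pos a). assert (H6 := Rabs_pos b).
  specialize (HT (- c) c ltac:(unfold c; lra) ltac:(unfold c; lra)).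
  assert (H7 : RInt f a b <= RInt f (- c) c) by (apply RI_incl; auto; unfold c; lra).
  revert HT; unfold Rabs; destruct Rcase_abs; lra.
Qed.

Lemma is_intR_pos f l x0 : cont f -> (forall x, 0 <= f x) -> 0 < f x0 -> is_intR f l -> 0 < l.
Proof.
  intros Hf Hp H0 H.
  apply Rlt_le_trans with (RInt f (x0 - 1) (x0 + 1)); [|apply is_intR_ge_RInt; auto; lra].
  assert (Hd : locally x0 (fun x => f x0 / 2 < f x)).
  { apply (Hf x0 (fun y => f x0 / 2 < y)). apply (open_gt (f x0 / 2)). lra. }
  destruct Hd as [d Hd].
  assert (Hd0 := cond_pos d).
  set (e := Rmin (d / 2) 1).
  assert (He : 0 < e) by (apply Rmin_pos; lra).
  assert (He1 : e <= 1) by apply Rmin_r. assert (He2 : e <= d / 2) by apply Rmin_l.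
  apply Rlt_le_trans with (RInt f x0 (x0 + e)); [|apply RI_incl; auto; lra].
  apply Rlt_le_trans with (RInt (fun _ => f x0 / 2) x0 (x0 + e)).
  - rewrite RInt_const. unfold scal; simpl; unfold mult; simpl. nra.
  - apply RInt_le; [lra | apply ex_RI; cont_tac | now apply ex_RI |].
    intros x Hx. left. apply Hd. unfold ball; simpl; unfold AbsRing_ball, abs, minus, plus, opp; simpl.
    apply Rabs_def1; lra.
Qed.

Lemma cauchy_weight_pos x : 0 < 1 + x ^ 2.
Proof. nra. Qed.

Lemma RInt_cauchy_weight a b : RInt (fun x => / (1 + x ^ 2)) a b = atan b - atan a.
Proof.
  apply RI_FTC.
  - intros x. apply is_derive_Reals, derivable_pt_lim_atan.
  - cont_tac. intros x. assert (H := cauchy_weight_pos x). lra.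
Qed.

(** The weight has the primitive [atan], whose total variation is [PI]. *)
Lemma absint_decay f K : cont f -> (forall x, Rabs (f x) <= K / (1 + x ^ 2)) ->
  absint f (K * PI).
Proof.
  intros Hf H.
  assert (HK : 0 <= K).
  { specialize (H 0). assert (H1 := Rabs_pos (f 0)). replace (K / (1 + 0 ^ 2)) with K in H by field. lra. }
  assert (Hc : cont (fun x => / (1 + x ^ 2))).
  { cont_tac. intros x. assert (H1 := cauchy_weight_pos x). lra. }
  split; [exact Hf|]. intros a b Hab.
  apply Rle_trans with (RInt (fun x => K * / (1 + x ^ 2)) a b).
  - apply RI_le; auto; cont_tac.
  - rewrite RI_scal by exact Hc. apply Rmult_le_compat_l; [exact HK|].
    rewrite RInt_cauchy_weight. assert (Ha := atan_bound a). assert (Hb := atan_bound b). lra.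
Qed.

(** * Bessel's inequality for cosine and sine transforms *)

Definition cont2 (F : R -> R -> R) : Prop := forall x y, continuity_2d_pt F x y.

Lemma cont2_1 f : cont f -> cont2 (fun x _ => f x).
Proof.
  intros Hf x y. apply (continuity_1d_2d_pt_comp f (fun x _ => x)).
  - apply continuity_pt_filterlim. apply Hf.
  - apply continuity_2d_pt_id1.
Qed.
Lemma cont2_2 f : cont f -> cont2 (fun _ y => f y).
Proof.
  intros Hf x y. apply (continuity_1d_2d_pt_comp f (fun _ y => y)).
  - apply continuity_pt_filterlim. apply Hf.
  - apply continuity_2d_pt_id2.
Qed.
Lemma cont2_comp f G : cont f -> cont2 G -> cont2 (fun x y => f (G x y)).
Proof.
  intros Hf HG x y. apply (continuity_1d_2d_pt_comp f G); [|apply HG].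
  apply continuity_pt_filterlim. apply Hf.
Qed.
Lemma cont2_plus F G : cont2 F -> cont2 G -> cont2 (fun x y => F x y + G x y).
Proof. intros HF HG x y. now apply continuity_2d_pt_plus. Qed.
Lemma cont2_minus F G : cont2 F -> cont2 G -> cont2 (fun x y => F x y - G x y).
Proof. intros HF HG x y. now apply continuity_2d_pt_minus. Qed.
Lemma cont2_mult F G : cont2 F -> cont2 G -> cont2 (fun x y => F x y * G x y).
Proof. intros HF HG x y. now apply continuity_2d_pt_mult. Qed.
Lemma cont2_swap F : cont2 F -> cont2 (fun x y => F y x).
Proof.
  intros H x y eps. destruct (H y x eps) as [d Hd]. exists d. intros u v Hu Hv. now apply Hd.
Qed.

Ltac cont2_step :=
  lazymatch goal with
  | H : cont2 ?F |- cont2 ?F => exact H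
  | |- cont2 (fun x y => @?f x) => apply (cont2_1 f)
  | |- cont2 (fun x y => @?f y) => apply (cont2_2 f)
  | |- cont2 (fun x y => @?F x y + @?G x y) => apply (cont2_plus F G)
  | |- cont2 (fun x y => @?F x y - @?G x y) => apply (cont2_minus F G)
  | |- cont2 (fun x y => @?F x y * @?G x y) => apply (cont2_mult F G)
  | |- cont2 (fun x y => ?f (@?G x y)) => apply (cont2_comp f G)
  end.
Ltac cont2_tac := repeat cont2_step.

Lemma cont2_slice F x : cont2 F -> cont (F x).
Proof.
  intros H y. apply continuity_pt_filterlim. intros eps Heps.
  destruct (H x y (mkposreal eps Heps)) as [d Hd]. exists d. split; [apply cond_pos|].
  intros z [_ Hz]. simpl in *. unfold R_dist in *. apply Hd; auto.
  rewrite Rminus_diag, Rabs_R0. apply cond_pos.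
Qed.

(** On a compact rectangle [F] is uniformly continuous, so nearby slices are close on the whole
    segment of integration. *)
Lemma cont2_RInt F c d : cont2 F -> cont (fun x => RInt (F x) c d).
Proof.
  assert (Main : forall c d, c <= d -> cont2 F -> cont (fun x => RInt (F x) c d)).
  { clear c d. intros c d Hcd H x. apply continuity_pt_filterlim. intros eps Heps.
    assert (He : 0 < eps / (2 * (d - c + 1))) by (apply Rdiv_lt_0_compat; lra).
    destruct (uniform_continuity_2d F (x - 1) (x + 1) c d (fun u v _ _ => H u v)
      (mkposreal _ He)) as [del Hdel].
    assert (Hd0 := cond_pos del).
    exists (Rmin del 1). split; [apply Rmin_pos; lra|].
    intros z [_ Hz]. simpl in *. unfold R_dist in *.
    assert (Hz1 := Rlt_le_trans _ _ _ Hz (Rmin_l _ _)).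
    assert (Hz2 := Rlt_le_trans _ _ _ Hz (Rmin_r _ _)).
    assert (Hz3 := Rabs_def2 _ _ Hz2).
    assert (C1 := cont2_slice F z H). assert (C2 := cont2_slice F x H).
    rewrite <- RI_minus by auto.
    eapply Rle_lt_trans; [apply RI_abs; auto; cont_tac|].
    apply Rle_lt_trans with (RInt (fun _ => eps / (2 * (d - c + 1))) c d).
    - apply RInt_le; auto; try (apply ex_RI; cont_tac).
      intros y Hy. left. apply Hdel; try lra. rewrite Rminus_diag, Rabs_R0. lra.
    - rewrite RInt_const. unfold scal; simpl; unfold mult; simpl.
      apply Rlt_le_trans with (2 * (d - c + 1) * (eps / (2 * (d - c + 1)))); [nra|].
      right. field. lra. }
  intros H. destruct (Rle_dec c d) as [Hcd|Hcd]; [now apply Main|].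
  apply (cont_ext (fun x => - RInt (F x) d c)).
  - intros x. apply (opp_RInt_swap (F x)). apply ex_RI. now apply cont2_slice.
  - apply cont_opp. apply Main; [lra|exact H].
Qed.

Lemma is_derive_RI f a x : cont f -> is_derive (fun t => RInt f a t) x (f x).
Proof.
  intros Hf. apply (is_derive_RInt f (fun t => RInt f a t) a).
  - apply filter_forall. intros y. apply (@RInt_correct R_CompleteNormedModule). now apply ex_RI.
  - apply Hf.
Qed.

(** As functions of the upper limit [t] in place of [b], both sides have the derivative
    [RInt (F t) c d] and vanish at [t = a]; the right side is differentiated under the integral
    sign. *)
Lemma Fubini F a b c d : cont2 F ->
  RInt (fun x => RInt (fun y => F x y) c d) a b = RInt (fun y => RInt (fun x => F x y) a b) c d.
Proof.
  intros H.
  assert (Hs := cont2_swap F H).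
  set (f1 := fun t => RInt (fun x => RInt (F x) c d) a t).
  set (f2 := fun t => RInt (fun y => RInt (fun x => F x y) a t) c d).
  assert (D1 : forall t, is_derive f1 t (RInt (F t) c d)).
  { intros t. apply (is_derive_RI (fun x => RInt (F x) c d)). now apply cont2_RInt. }
  assert (Dy : forall t y, is_derive (fun u => RInt (fun x => F x y) a u) t (F t y)).
  { intros t y. apply (is_derive_RI (fun x => F x y)). apply (cont2_slice (fun y x => F x y) y Hs). }
  assert (D2 : forall t, is_derive f2 t (RInt (F t) c d)).
  { intros t.
    replace (RInt (F t) c d) with
      (RInt (fun y => Derive (fun u => RInt (fun x => F x y) a u) t) c d).
    - apply is_derive_RInt_param.
      + apply filter_forall. intros u y _. eexists. apply Dy.
      + intros y _. apply (continuity_2d_pt_ext F); [|apply H].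
        intros u v. symmetry. apply is_derive_unique. apply Dy.
      + apply filter_forall. intros u. apply ex_RI.
        apply (cont2_RInt (fun y x => F x y)). exact Hs.
    - apply RInt_ext. intros y _. apply is_derive_unique. apply Dy. }
  assert (D0 : forall t, is_derive (fun t => f1 t - f2 t) t 0).
  { intros t. replace 0 with (RInt (F t) c d - RInt (F t) c d) by ring.
    apply (is_derive_minus f1 f2); auto. }
  assert (E : RInt (fun _ => 0) a b = (f1 b - f2 b) - (f1 a - f2 a)).
  { apply (RI_FTC (fun t => f1 t - f2 t)); [exact D0|cont_tac]. }
  rewrite RInt_const in E. unfold scal in E; simpl in E; unfold mult in E; simpl in E.
  assert (E1 : f1 a = 0) by apply (@RInt_point R_CompleteNormedModule).
  assert (E2 : f2 a = 0).
  { unfold f2. rewrite (RI_ext _ (fun _ => 0)).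
    - rewrite RInt_const. apply (Rmult_0_r (d - c)).
    - intros y. apply (@RInt_point R_CompleteNormedModule). }
  change (f1 b = f2 b). lra.
Qed.

Lemma one_minus_cos_le y : 0 <= 1 - cos y <= y ^ 2 / 2.
Proof.
  replace y with (2 * (y / 2)) at 1 2 by field. rewrite cos_2a_sin.
  assert (H : (sin (y / 2)) ^ 2 <= (y / 2) ^ 2).
  { rewrite <- (pow2_abs (sin _)), <- (pow2_abs (y / 2)). apply pow_incr. split; [apply Rabs_pos|].
    assert (HR : forall x, 0 <= x -> Rabs (sin x) <= x).
    { intros x Hx. destruct (MVT_gen sin 0 x cos) as [z [_ Hz]].
      - intros; apply is_derive_sin.
      - intros; apply continuity_sin.
      - rewrite sin_0, !Rminus_0_r in Hz. rewrite Hz, Rabs_mult, (Rabs_pos_eq x) by auto.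
        assert (Hb := COS_bound z). assert (Rabs (cos z) <= 1) by (apply Rabs_le; lra). nra. }
    destruct (Rle_dec 0 (y / 2)) as [Hy|Hy].
    - rewrite (Rabs_pos_eq (y / 2)); auto.
    - rewrite <- (Rabs_Ropp (y / 2)), <- (Rabs_Ropp (sin _)), <- sin_neg.
      rewrite (Rabs_pos_eq (- (y / 2))) by lra. apply HR. lra. }
  nra.
Qed.

(** Cosine transform of the triangular weight on [[0, T]]. For [x <> 0] it equals
    [(1 - cos (T x)) / (T x^2)], the Fejer kernel up to normalization. *)
Definition fejer (T x : R) : R := RInt (fun s => (1 - s / T) * cos (s * x)) 0 T.

(** With [y = T x], the bounds [y^2 / 2] and 2 for [1 - cos y] give
    [(1 - cos y) (1 + y^2) <= 5 / 2 * y^2]. At [x = 0] the value is [T / 2]. *)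
Lemma fejer_bound T x : 0 < T -> Rabs (fejer T x) <= 5 / 2 * T / (1 + (T * x) ^ 2).
Proof.
  intros HT. unfold fejer.
  assert (Hc := one_minus_cos_le (T * x)). assert (Hb := COS_bound (T * x)).
  assert (Hw := cauchy_weight_pos (T * x)).
  destruct (Req_dec x 0) as [->|Hx].
  - rewrite (RI_FTC (fun s => s - s ^ 2 / (2 * T))).
    + rewrite Rabs_pos_eq; [|replace (_ - _) with (T / 2) by (field; lra); lra].
      replace (T * 0) with 0 by ring. replace (5 / 2 * T / (1 + 0 ^ 2)) with (5 / 2 * T) by field.
      replace (_ - _) with (T / 2) by (field; lra). lra.
    + intros s. auto_derive; [lra|]. rewrite Rmult_0_r, cos_0. field. lra.
    + unfold Rdiv. cont_tac.
  - rewrite (RI_FTC (fun s => (1 - s / T) * sin (s * x) / x - cos (s * x) / (T * x ^ 2))).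
    + replace (0 * x) with 0 by ring. rewrite sin_0, cos_0.
      replace (_ - _) with ((1 - cos (T * x)) / (T * x ^ 2)) by (field; lra).
      assert (H1 : 0 < T * x ^ 2) by (apply Rmult_lt_0_compat; [lra|]; apply pow2_gt_0; auto).
      rewrite Rabs_pos_eq by (apply Rdiv_le_0_compat; lra).
      apply Rmult_le_reg_r with (T * x ^ 2 * (1 + (T * x) ^ 2)); [now apply Rmult_lt_0_compat|].
      replace ((1 - cos (T * x)) / (T * x ^ 2) * (T * x ^ 2 * (1 + (T * x) ^ 2)))
        with ((1 - cos (T * x)) * (1 + (T * x) ^ 2)) by (field; lra).
      replace (5 / 2 * T / (1 + (T * x) ^ 2) * (T * x ^ 2 * (1 + (T * x) ^ 2)))
        with (5 / 2 * (T * x) ^ 2) by (field; lra).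
      nra.
    + intros s. auto_derive; [lra|]. field. lra.
    + unfold Rdiv. cont_tac.
Qed.

(** Rescaling turns the majorant into [5 / 2] times the Cauchy weight, of total mass [PI], so the
    bound is free of [T]. *)
Lemma RInt_fejer_majorant T w a b : 0 < T -> a <= b ->
  RInt (fun v => 5 / 2 * T / (1 + (T * (w - v)) ^ 2)) a b <= 5 / 2 * PI.
Proof.
  intros HT Hab.
  rewrite (RI_FTC (fun v => - (5 / 2) * atan (T * (w - v)))).
  - assert (H1 := atan_bound (T * (w - a))). assert (H2 := atan_bound (T * (w - b))). lra.
  - intros v. auto_derive; [auto|].
    assert (Hw := cauchy_weight_pos (T * (w - v))). unfold Rsqr. field. nra.
  - unfold Rdiv. cont_tac. intros v. assert (Hw := cauchy_weight_pos (T * (w - v))). lra.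
Qed.

Definition ccos (H : R -> R) (r s : R) : R := RInt (fun w => H w * cos (s * w)) (- r) r.
Definition csin (H : R -> R) (r s : R) : R := RInt (fun w => H w * sin (s * w)) (- r) r.

Lemma cont_ccos H r : cont H -> cont (ccos H r).
Proof.
  intros C. apply (cont2_RInt (fun s w => H w * cos (s * w))). cont2_tac; auto.
  - exact continuous_cos.
  - apply cont_id.
  - apply cont_id.
Qed.
Lemma cont_csin H r : cont H -> cont (csin H r).
Proof.
  intros C. apply (cont2_RInt (fun s w => H w * sin (s * w))). cont2_tac; auto.
  - exact continuous_sin.
  - apply cont_id.
  - apply cont_id.
Qed.

(* Schur's test for the positive kernel [fejer]; the weight [1 - s / T] replaces the sharp cut-off. *)
Lemma bessel_fejer H r T : cont H -> 0 <= r -> 0 < T ->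
  RInt (fun s => (1 - s / T) * (ccos H r s ^ 2 + csin H r s ^ 2)) 0 T
  <= 5 / 2 * PI * RInt (fun w => H w ^ 2) (- r) r.
Proof.
  intros C Hr HT.
  assert (CA := cont_ccos H r C). assert (CB := cont_csin H r C).
  assert (Ccos : cont cos) by exact continuous_cos.
  assert (Csin : cont sin) by exact continuous_sin.
  set (A := ccos H r) in *. set (B := csin H r) in *.
  (* One factor of each square is written as an integral in [w], the other is kept for the
     moment. *)
  assert (E1 : RInt (fun s => (1 - s / T) * (A s ^ 2 + B s ^ 2)) 0 T =
    RInt (fun w => RInt (fun s => (1 - s / T) * (H w * (cos (s * w) * A s + sin (s * w) * B s))) 0 T)
      (- r) r).
  { rewrite <- (Fubini (fun s w => (1 - s / T) * (H w * (cos (s * w) * A s + sin (s * w) * B s)))).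
    - apply RI_ext. intros s.
      rewrite RI_scal by cont_tac. f_equal.
      rewrite (RI_ext _ (fun w => A s * (H w * cos (s * w)) + B s * (H w * sin (s * w))))
        by (intros; ring).
      rewrite RI_plus, !RI_scal by cont_tac. fold (ccos H r s) (csin H r s) A B.
      change (ccos H r s) with (A s). change (csin H r s) with (B s). ring.
    - unfold Rdiv. cont2_tac; auto; cont_tac. }
  (* The remaining [A s] and [B s] are expanded in [v]; the addition formula for [cos (s * (w - v))]
     makes the integral over [s] the kernel. *)
  assert (E2 : forall w,
    RInt (fun s => (1 - s / T) * (H w * (cos (s * w) * A s + sin (s * w) * B s))) 0 T =
    RInt (fun v => H w * H v * fejer T (w - v)) (- r) r).
  { intros w.
    transitivity (RInt (fun s => RInt (fun v => H w * H v * ((1 - s / T) * cos (s * (w - v)))) (- r) r) 0 T).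
    - apply RI_ext. intros s.
      rewrite (RI_ext (fun v => H w * H v * ((1 - s / T) * cos (s * (w - v))))
        (fun v => ((1 - s / T) * H w * cos (s * w)) * (H v * cos (s * v)) +
                  ((1 - s / T) * H w * sin (s * w)) * (H v * sin (s * v)))).
      + rewrite RI_plus, !RI_scal by cont_tac.
        change (RInt (fun v => H v * cos (s * v)) (- r) r) with (A s).
        change (RInt (fun v => H v * sin (s * v)) (- r) r) with (B s). ring.
      + intros v. replace (s * (w - v)) with (s * w - s * v) by ring. rewrite cos_minus. ring.
    - rewrite (Fubini (fun s v => H w * H v * ((1 - s / T) * cos (s * (w - v))))).
      + apply RI_ext. intros v. rewrite RI_scal; [reflexivity|]. unfold Rdiv. cont_tac.
      + unfold Rdiv. cont2_tac; auto; cont_tac. }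
  rewrite E1, (RI_ext _ _ _ _ E2). clear E1 E2.
  set (k := fun x => 5 / 2 * T / (1 + (T * x) ^ 2)).
  assert (Ck : cont k).
  { unfold k. cont_tac. intros x. assert (Hw := cauchy_weight_pos (T * x)). lra. }
  assert (Cf : cont (fejer T)).
  { apply (cont2_RInt (fun x s => (1 - s / T) * cos (s * x))). unfold Rdiv. cont2_tac; auto; cont_tac. }
  assert (Cf2 : cont2 (fun w v => H w * H v * fejer T (w - v))) by (cont2_tac; auto; cont_tac).
  assert (Ck1 : cont2 (fun w v => H w ^ 2 * k (w - v))) by (cont2_tac; auto; cont_tac).
  assert (Ck2 : cont2 (fun w v => H v ^ 2 * k (w - v))) by (cont2_tac; auto; cont_tac).
  (* [|H w H v|] is at most the mean of the two squares; each square is then integrated against the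
     kernel in the variable that it does not contain. *)
  apply Rle_trans with (RInt (fun w => RInt (fun v => / 2 * (H w ^ 2 * k (w - v)) + / 2 * (H v ^ 2 * k (w - v))) (- r) r) (- r) r).
  { apply RI_le; [lra | now apply (cont2_RInt (fun w v => H w * H v * fejer T (w - v))) | |].
    - apply (cont2_RInt (fun w v => / 2 * (H w ^ 2 * k (w - v)) + / 2 * (H v ^ 2 * k (w - v)))).
      cont2_tac; auto; cont_tac.
    - intros w. apply RI_le; [lra | cont_tac | cont_tac |].
      intros v. assert (Hb := fejer_bound T (w - v) HT). fold (k (w - v)) in Hb.
      apply Rle_trans with (Rabs (H w * H v) * k (w - v)).
      + apply Rle_trans with (Rabs (H w * H v * fejer T (w - v))); [apply Rle_abs|].
        rewrite Rabs_mult. apply Rmult_le_compat_l; [apply Rabs_pos|exact Hb].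
      + rewrite <- Rmult_plus_distr_l, <- Rmult_plus_distr_r, <- Rmult_assoc.
        apply Rmult_le_compat_r; [eapply Rle_trans; [apply Rabs_pos|exact Hb]|].
        rewrite <- (pow2_abs (H w)), <- (pow2_abs (H v)), Rabs_mult.
        assert (0 <= (Rabs (H w) - Rabs (H v)) ^ 2) by apply pow2_ge_0. nra. }
  rewrite (RI_ext _ (fun w => / 2 * RInt (fun v => H w ^ 2 * k (w - v)) (- r) r
                             + / 2 * RInt (fun v => H v ^ 2 * k (w - v)) (- r) r)).
  2: { intros w. rewrite RI_plus, !RI_scal by cont_tac. reflexivity. }
  assert (CR1 := cont2_RInt _ (- r) r Ck1). assert (CR2 := cont2_RInt _ (- r) r Ck2). cbv beta in CR1, CR2.
  rewrite RI_plus, !RI_scal by cont_tac.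
  rewrite (Fubini (fun w v => H v ^ 2 * k (w - v))) by exact Ck2.
  assert (M1 : RInt (fun w => RInt (fun v => H w ^ 2 * k (w - v)) (- r) r) (- r) r
    <= RInt (fun w => 5 / 2 * PI * H w ^ 2) (- r) r).
  { apply RI_le; [lra | exact CR1 | cont_tac |]. intros w. rewrite RI_scal by cont_tac.
    rewrite Rmult_comm. apply Rmult_le_compat_r; [apply pow2_ge_0|].
    apply RInt_fejer_majorant; lra. }
  assert (M2 : RInt (fun v => RInt (fun w => H v ^ 2 * k (w - v)) (- r) r) (- r) r
    <= RInt (fun w => 5 / 2 * PI * H w ^ 2) (- r) r).
  { apply RI_le; [lra | | cont_tac |].
    - apply (cont2_RInt (fun v w => H v ^ 2 * k (w - v))). apply (cont2_swap _ Ck2).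
    - intros v. rewrite RI_scal by cont_tac.
      rewrite Rmult_comm. apply Rmult_le_compat_r; [apply pow2_ge_0|].
      rewrite (RI_ext _ (fun w => k (v - w))).
      + apply RInt_fejer_majorant; lra.
      + intros w. unfold k. f_equal. f_equal. ring. }
  rewrite RI_scal in M1, M2 by cont_tac. lra.
Qed.

Lemma RInt_even f a : cont f -> (forall x, f (- x) = f x) ->
  RInt f (- a) a = 2 * RInt f 0 a.
Proof.
  intros Hf He. rewrite <- (RI_Chasles f (- a) 0 a) by exact Hf.
  assert (E := RI_opp_arg f (- a) 0 Hf). rewrite Ropp_involutive, Ropp_0 in E.
  rewrite (RI_ext _ f) in E by exact He. lra.
Qed.

(** On [[0, T]] the triangular weight of width [2 * T] is at least [1 / 2]. Removing it and
    reflecting the even integrand each cost a factor 2, whence [4 * (5 / 2) * PI]. *)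
Lemma bessel_truncated H r T : cont H -> 0 <= r -> 0 < T ->
  RInt (fun s => ccos H r s ^ 2 + csin H r s ^ 2) (- T) T
  <= 10 * PI * RInt (fun w => H w ^ 2) (- r) r.
Proof.
  intros C Hr HT.
  assert (CA := cont_ccos H r C). assert (CB := cont_csin H r C).
  rewrite RInt_even; [|cont_tac|].
  - assert (B := bessel_fejer H r (2 * T) C Hr ltac:(lra)).
    set (P := fun s => ccos H r s ^ 2 + csin H r s ^ 2).
    assert (CP : cont P) by (unfold P; cont_tac).
    assert (PP : forall s, 0 <= P s).
    { intros s. unfold P. assert (H1 := pow2_ge_0 (ccos H r s)). assert (H2 := pow2_ge_0 (csin H r s)). lra. }
    change (RInt (fun s => (1 - s / (2 * T)) * P s) 0 (2 * T) <= 5 / 2 * PI * RInt (fun w => H w ^ 2) (- r) r) in B.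
    change (2 * RInt P 0 T <= 10 * PI * RInt (fun w => H w ^ 2) (- r) r).
    assert (CW : cont (fun s => (1 - s / (2 * T)) * P s)) by (unfold Rdiv; cont_tac).
    assert (W : forall s, s <= 2 * T -> 0 <= 1 - s / (2 * T)).
    { intros s Hs. assert (s / (2 * T) <= 1); [|lra].
      apply Rmult_le_reg_r with (2 * T); [lra|]. unfold Rdiv. rewrite Rmult_assoc, Rinv_l; lra. }
    assert (L1 : RInt (fun s => / 2 * P s) 0 T <= RInt (fun s => (1 - s / (2 * T)) * P s) 0 T).
    { apply RInt_le; [lra | apply ex_RI; cont_tac | now apply ex_RI |].
      intros s Hs. apply Rmult_le_compat_r; [apply PP|].
      assert (s / (2 * T) <= / 2); [|lra].
      apply Rmult_le_reg_r with (2 * T); [lra|]. unfold Rdiv. rewrite Rmult_assoc, Rinv_l; lra. }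
    assert (L2 : 0 <= RInt (fun s => (1 - s / (2 * T)) * P s) T (2 * T)).
    { apply RInt_ge_0; [lra | now apply ex_RI |].
      intros s Hs. apply Rmult_le_pos; [apply W; lra | apply PP]. }
    rewrite <- (RI_Chasles _ 0 T (2 * T)) in B by exact CW.
    rewrite RI_scal in L1 by exact CP. lra.
  - intros s.
    assert (E1 : ccos H r (- s) = ccos H r s).
    { apply RI_ext. intros w. replace (- s * w) with (- (s * w)) by ring. now rewrite cos_neg. }
    assert (E2 : csin H r (- s) = -1 * csin H r s).
    { unfold csin. rewrite <- RI_scal by cont_tac. apply RI_ext. intros w.
      replace (- s * w) with (- (s * w)) by ring. rewrite sin_neg. ring. }
    rewrite E1, E2. ring.
Qed.

(** [c] stands for [cos] or [sin], so that one proof serves both transforms. *)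
Definition trig_int (c H : R -> R) (s : R) : R := RIntR (fun w => H w * c (s * w)).

Lemma is_intR_tail f g lf lg r : cont f -> cont g -> (forall x, Rabs (f x) <= g x) ->
  is_intR f lf -> is_intR g lg -> 0 <= r ->
  Rabs (lf - RInt f (- r) r) <= lg - RInt g (- r) r.
Proof.
  intros Cf Cg Hfg If Ig Hr. apply Rnot_lt_le. intros Hlt.
  set (e := Rabs (lf - RInt f (- r) r) - (lg - RInt g (- r) r)) in *.
  assert (Gp : forall x, 0 <= g x) by (intros x; eapply Rle_trans; [apply Rabs_pos|apply Hfg]).
  destruct (is_intR_elim f lf If e) as [T HT]; [unfold e; lra|].
  set (b := Rabs T + r + 1).
  assert (HT1 := Rle_abs T). assert (HT2 := Rabs_pos T).
  specialize (HT (- b) b ltac:(unfold b; lra) ltac:(unfold b; lra)).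
  assert (Hb := is_intR_ge_RInt g lg (- b) b Cg Gp Ig ltac:(unfold b; lra)).
  rewrite <- (RI_Chasles f (- b) (- r) b), <- (RI_Chasles f (- r) r b) in HT by auto.
  rewrite <- (RI_Chasles g (- b) (- r) b), <- (RI_Chasles g (- r) r b) in Hb by auto.
  assert (D : forall x y, x <= y -> Rabs (RInt f x y) <= RInt g x y).
  { intros x y Hxy. eapply Rle_trans; [apply RI_abs; auto|]. apply RI_le; auto; cont_tac. }
  assert (D1 := D (- b) (- r) ltac:(unfold b; lra)).
  assert (D2 := D r b ltac:(unfold b; lra)).
  unfold e in HT. revert HT D1 D2. unfold Rabs; repeat destruct Rcase_abs; lra.
Qed.

Lemma absint_sq_decay H K : 0 <= K -> cont H -> (forall x, Rabs (H x) <= K / (1 + x ^ 2)) ->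
  absint (fun x => H x ^ 2) (K ^ 2 * PI).
Proof.
  intros HK C B. apply absint_decay; [cont_tac|]. intros x.
  assert (Hw := cauchy_weight_pos x). specialize (B x).
  rewrite <- RPow_abs. apply Rle_trans with ((K / (1 + x ^ 2)) ^ 2).
  - apply pow_incr. split; [apply Rabs_pos|exact B].
  - unfold Rdiv. rewrite Rpow_mult_distr. apply Rmult_le_compat_l; [apply pow2_ge_0|].
    assert (0 < / (1 + x ^ 2) <= 1); [|nra].
    split; [now apply Rinv_0_lt_compat|]. rewrite <- Rinv_1. apply Rinv_le_contravar; nra.
Qed.

Lemma decay4_decay2 K x : 0 <= K -> K / (1 + x ^ 2) ^ 2 <= K / (1 + x ^ 2).
Proof.
  intros HK. apply Rmult_le_compat_l; [exact HK|].
  apply Rinv_le_contravar; nra.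
Qed.

Lemma lip_cos x y : Rabs (cos x - cos y) <= Rabs (x - y).
Proof.
  rewrite <- (Rmult_1_l (Rabs (x - y))). apply (bounded_variation cos (fun t => - sin t)).
  intros t _. split; [apply is_derive_cos|]. rewrite Rabs_Ropp.
  assert (Hb := SIN_bound t). apply Rabs_le. lra.
Qed.
Lemma lip_sin x y : Rabs (sin x - sin y) <= Rabs (x - y).
Proof.
  rewrite <- (Rmult_1_l (Rabs (x - y))). apply (bounded_variation sin cos).
  intros t _. split; [apply is_derive_sin|].
  assert (Hb := COS_bound t). apply Rabs_le. lra.
Qed.

Lemma cont_lip f L : (forall x y, Rabs (f x - f y) <= L * Rabs (x - y)) -> cont f.
Proof.
  intros HL x. apply continuity_pt_filterlim. intros eps Heps.
  assert (HL0 := Rabs_pos L). assert (HL1 := Rle_abs L).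
  exists (eps / (Rabs L + 1)). split; [apply Rdiv_lt_0_compat; lra|].
  intros z [_ Hz]. simpl in *. unfold R_dist in *.
  apply Rle_lt_trans with ((Rabs L + 1) * Rabs (z - x)).
  - eapply Rle_trans; [apply HL|]. apply Rmult_le_compat_r; [apply Rabs_pos|lra].
  - apply Rlt_le_trans with ((Rabs L + 1) * (eps / (Rabs L + 1))).
    + apply Rmult_lt_compat_l; lra.
    + right. field. lra.
Qed.

Lemma trig_absint H K (c : R -> R) s : 0 <= K -> cont H -> cont c -> (forall x, Rabs (c x) <= 1) ->
  (forall x, Rabs (H x) <= K / (1 + x ^ 2)) -> absint (fun w => H w * c (s * w)) (K * PI).
Proof.
  intros HK C Cc Bc B. apply absint_decay; [cont_tac|]. intros x. rewrite Rabs_mult.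
  rewrite <- (Rmult_1_r (K / _)). apply Rmult_le_compat; auto using Rabs_pos.
Qed.

Lemma Rabs_cos_le x : Rabs (cos x) <= 1.
Proof. apply Rabs_le. apply COS_bound. Qed.
Lemma Rabs_sin_le x : Rabs (sin x) <= 1.
Proof. apply Rabs_le. apply SIN_bound. Qed.

Lemma trig_facts c : c = cos \/ c = sin ->
  cont c /\ (forall x, Rabs (c x) <= 1) /\ (forall x y, Rabs (c x - c y) <= Rabs (x - y)).
Proof.
  intros [-> | ->]; (split; [|split]).
  - exact continuous_cos.
  - exact Rabs_cos_le.
  - exact lip_cos.
  - exact continuous_sin.
  - exact Rabs_sin_le.
  - exact lip_sin.
Qed.

(** The transform is Lipschitz in [s]: a difference costs the factor [|s - t| |x|], and the
    fourth-power decay leaves [|x| (1 + x^2)^-2 <= (1 + x^2)^-1], which is still integrable. *)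
Lemma cont_trig_int c H K : c = cos \/ c = sin -> 0 <= K -> cont H ->
  (forall x, Rabs (H x) <= K / (1 + x ^ 2) ^ 2) -> cont (trig_int c H).
Proof.
  intros Hc HK C B. destruct (trig_facts c Hc) as [Cc [Bc Lc]].
  apply (cont_lip _ (K * PI)). intros s t. unfold trig_int.
  assert (B2 : forall x, Rabs (H x) <= K / (1 + x ^ 2)).
  { intros x. eapply Rle_trans; [apply B|now apply decay4_decay2]. }
  assert (I1 := absint_ex _ _ (trig_absint H K c s HK C Cc Bc B2)).
  assert (I2 := absint_ex _ _ (trig_absint H K c t HK C Cc Bc B2)).
  assert (I3 := is_intR_minus _ _ _ _ I1 I2).
  replace (K * PI * Rabs (s - t)) with (K * Rabs (s - t) * PI) by ring.
  apply (is_intR_abs_le _ _ _) with (2 := I3). apply absint_decay; [cont_tac|].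
  intros x. rewrite <- Rmult_minus_distr_l, Rabs_mult.
  assert (Hw := cauchy_weight_pos x).
  apply Rle_trans with (K / (1 + x ^ 2) ^ 2 * (Rabs (s - t) * Rabs x)).
  - apply Rmult_le_compat; auto using Rabs_pos.
    eapply Rle_trans; [apply Lc|]. rewrite <- Rabs_mult. right. f_equal. ring.
  - unfold Rdiv. replace (/ (1 + x ^ 2) ^ 2) with (/ (1 + x ^ 2) * / (1 + x ^ 2)) by (field; lra).
    assert (0 <= Rabs (s - t)) by apply Rabs_pos.
    assert (0 < / (1 + x ^ 2)) by now apply Rinv_0_lt_compat.
    assert (Rabs x <= 1 + x ^ 2).
    { rewrite <- (pow2_abs x). assert (0 <= Rabs x) by apply Rabs_pos. nra. }
    assert (/ (1 + x ^ 2) * Rabs x <= 1).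
    { apply Rmult_le_reg_l with (1 + x ^ 2); [lra|]. rewrite <- Rmult_assoc, Rinv_r; lra. }
    replace (K * (/ (1 + x ^ 2) * / (1 + x ^ 2)) * (Rabs (s - t) * Rabs x))
      with (K * Rabs (s - t) * / (1 + x ^ 2) * (/ (1 + x ^ 2) * Rabs x)) by ring.
    rewrite <- (Rmult_1_r (K * Rabs (s - t) * / (1 + x ^ 2))) at 2.
    apply Rmult_le_compat_l; [|assumption].
    apply Rmult_le_pos; [apply Rmult_le_pos; lra|lra].
Qed.

Lemma Rsq_perturb a b M : Rabs a <= M -> Rabs b <= M -> a ^ 2 <= b ^ 2 + 2 * M * Rabs (a - b).
Proof.
  intros Ha Hb. assert (E : a ^ 2 - b ^ 2 = (a + b) * (a - b)) by ring.
  assert (Rabs (a ^ 2 - b ^ 2) <= 2 * M * Rabs (a - b)).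
  { rewrite E, Rabs_mult. apply Rmult_le_compat_r; [apply Rabs_pos|].
    eapply Rle_trans; [apply Rabs_triang|]. lra. }
  assert (H1 := Rle_abs (a ^ 2 - b ^ 2)). lra.
Qed.

(** On a fixed segment [[-T, T]] the transforms are uniform limits of their truncations, for which
    the inequality is known. An excess [e] over the bound is refuted by a cut-off [r] with small
    tails. *)
Lemma bessel H K : 0 <= K -> cont H -> (forall x, Rabs (H x) <= K / (1 + x ^ 2) ^ 2) ->
  absint (fun s => trig_int cos H s ^ 2 + trig_int sin H s ^ 2) (10 * PI * (K ^ 2 * PI)).
Proof.
  intros HK C B.
  assert (CA := cont_trig_int cos H K (or_introl eq_refl) HK C B).
  assert (CB := cont_trig_int sin H K (or_intror eq_refl) HK C B).
  split; [cont_tac|]. intros a b Hab.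
  assert (HPI := PI_RGT_0).
  assert (B2 : forall x, Rabs (H x) <= K / (1 + x ^ 2)).
  { intros x. eapply Rle_trans; [apply B|now apply decay4_decay2]. }
  set (P := fun s => trig_int cos H s ^ 2 + trig_int sin H s ^ 2).
  assert (PP : forall s, 0 <= P s).
  { intros s. unfold P. assert (H1 := pow2_ge_0 (trig_int cos H s)). assert (H2 := pow2_ge_0 (trig_int sin H s)). lra. }
  rewrite (RI_ext _ P) by (intros; apply Rabs_pos_eq; apply PP).
  assert (CP : cont P) by (unfold P; cont_tac).
  set (T := Rabs a + Rabs b + 1).
  assert (HT : 0 < T) by (assert (H1 := Rabs_pos a); assert (H2 := Rabs_pos b); unfold T; lra).
  apply Rle_trans with (RInt P (- T) T).
  { assert (H1 := Rle_abs (- a)). rewrite Rabs_Ropp in H1. assert (H2 := Rle_abs b).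
    assert (H3 := Rabs_pos a). assert (H4 := Rabs_pos b).
    apply RI_incl; auto; unfold T; lra. }
  assert (Aabs : absint (fun w => Rabs (H w)) (K * PI)).
  { apply absint_decay; [cont_tac|]. intros x. rewrite Rabs_Rabsolu. auto. }
  assert (Iabs := absint_ex _ _ Aabs).
  assert (Asq := absint_sq_decay H K HK C B2).
  assert (Isq := absint_ex _ _ Asq).
  assert (Bsq : RIntR (fun x => H x ^ 2) <= K ^ 2 * PI).
  { eapply Rle_trans; [apply Rle_abs|]. now apply absint_bound. }
  set (M := K * PI).
  assert (HM : 0 <= M) by (unfold M; nra).
  apply Rnot_lt_le. intros Hlt.
  set (e := RInt P (- T) T - 10 * PI * (K ^ 2 * PI)) in *.
  assert (He : 0 < e) by (unfold e; lra).
  (* Each of the two squares changes by at most [2 * M] times the tail, over a length [2 * T], so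
     the total is [8 * M * T] times the tail; the added 1 makes this strictly less than [e]. *)
  assert (Hq : 0 < e / (8 * M * T + 1)) by (apply Rdiv_lt_0_compat; nra).
  destruct (is_intR_elim _ _ Iabs _ Hq) as [r0 Hr0].
  set (r := Rabs r0 + 1). assert (Hr1 := Rle_abs r0). assert (Hr2 := Rabs_pos r0).
  specialize (Hr0 (- r) r ltac:(unfold r; lra) ltac:(unfold r; lra)).
  assert (Hr : 0 <= r) by (unfold r; lra).
  assert (Tail : forall c, cont c -> (forall x, Rabs (c x) <= 1) -> forall s,
     Rabs (RIntR (fun w => H w * c (s * w)) - RInt (fun w => H w * c (s * w)) (- r) r)
       <= e / (8 * M * T + 1) /\
     Rabs (RIntR (fun w => H w * c (s * w))) <= M /\
     Rabs (RInt (fun w => H w * c (s * w)) (- r) r) <= M).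
  { intros c Cc Bc s. assert (A1 := trig_absint H K c s HK C Cc Bc B2). repeat split.
    - eapply Rle_trans.
      + apply (is_intR_tail _ (fun w => Rabs (H w)) _ (RIntR (fun w => Rabs (H w)))); auto; try cont_tac.
        * intros x. rewrite Rabs_mult. rewrite <- (Rmult_1_r (Rabs (H x))) at 2.
          apply Rmult_le_compat_l; [apply Rabs_pos|apply Bc].
        * now apply absint_ex with (K * PI).
      + left. rewrite Rabs_minus_sym in Hr0. eapply Rle_lt_trans; [apply Rle_abs|exact Hr0].
    - now apply absint_bound.
    - eapply Rle_trans; [apply RI_abs; [lra|cont_tac]|]. apply A1. lra. }
  assert (CA' := cont_ccos H r C). assert (CB' := cont_csin H r C).
  assert (Bt := bessel_truncated H r T C Hr HT).
  assert (Hle : RInt P (- T) T <= RInt (fun s => (ccos H r s ^ 2 + csin H r s ^ 2) + 4 * M * (e / (8 * M * T + 1))) (- T) T).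
  { apply RI_le; [lra | exact CP | cont_tac |]. intros s.
    destruct (Tail cos continuous_cos Rabs_cos_le s) as [A1 [A2 A3]].
    destruct (Tail sin continuous_sin Rabs_sin_le s) as [B1 [B2' B3]].
    assert (S1 := Rsq_perturb _ _ M A2 A3). assert (S2 := Rsq_perturb _ _ M B2' B3).
    fold (trig_int cos H s) in *. fold (trig_int sin H s) in *. fold (ccos H r s) in *. fold (csin H r s) in *.
    unfold P. nra. }
  rewrite RI_plus in Hle by cont_tac. rewrite RInt_const in Hle.
  unfold scal in Hle; simpl in Hle; unfold mult in Hle; simpl in Hle.
  assert (Hsq := is_intR_ge_RInt _ _ (- r) r (proj1 Asq) (fun x => pow2_ge_0 (H x)) Isq ltac:(lra)).
  cbv beta in Hsq.
  assert (E : (T - - T) * (4 * M * (e / (8 * M * T + 1))) < e).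
  { replace ((T - - T) * (4 * M * (e / (8 * M * T + 1)))) with (e - e / (8 * M * T + 1)).
    - lra.
    - field. nra. }
  assert (10 * PI * RInt (fun w => H w ^ 2) (- r) r <= 10 * PI * (K ^ 2 * PI)).
  { apply Rmult_le_compat_l; lra. }
  assert (Ee : RInt P (- T) T = e + 10 * PI * (K ^ 2 * PI)) by (unfold e; lra).
  change (RInt P (- T) T <= RInt (fun s => ccos H r s ^ 2 + csin H r s ^ 2) (- T) T + (T - - T) * (4 * M * (e / (8 * M * T + 1)))) in Hle.
  lra.
Qed.

(** * Limits and periodizations of continuously differentiable functions *)

(** The Weierstrass test, stated for the increments of a sequence instead of the terms of a
    series. *)
Lemma increments_cauchy (fn : nat -> R -> R) (D : R -> Prop) (beta : nat -> R) :
  ex_series beta -> (forall n, 0 <= beta n) ->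
  (forall n x, D x -> Rabs (fn (S n) x - fn n x) <= beta n) -> CVU_dom fn D.
Proof.
  intros Hs Hb H. apply CVU_dom_cauchy. intros eps.
  destruct (Cauchy_ex_series beta Hs eps) as [N HN]. exists N.
  (* The telescoped difference involves [beta n] up to [beta (n + p - 1)], whereas [sum_n_m]
     includes its upper index; hence the subtracted last term. *)
  assert (Main : forall p n x, D x -> Rabs (fn (n + p)%nat x - fn n x) <= sum_n_m beta n (n + p) - beta (n + p)%nat).
  { intros p n x Hx. induction p as [|p IH].
    - rewrite Nat.add_0_r, sum_n_n, Rminus_diag, Rabs_R0. lra.
    - rewrite Nat.add_succ_r, sum_n_Sm by lia. unfold plus; simpl.
      specialize (H (n + p)%nat x Hx).
      replace (fn (S (n + p)) x - fn n x) with ((fn (S (n + p)) x - fn (n + p)%nat x) + (fn (n + p)%nat x - fn n x)) by ring.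
      eapply Rle_trans; [apply Rabs_triang|]. lra. }
  assert (Main2 : forall n m x, D x -> (N <= n)%nat -> (n <= m)%nat -> Rabs (fn m x - fn n x) < eps).
  { intros n m x Hx Hn Hm. replace m with (n + (m - n))%nat by lia.
    eapply Rle_lt_trans; [now apply Main|].
    specialize (HN n (n + (m - n))%nat ltac:(lia) ltac:(lia)).
    assert (H1 := Hb (n + (m - n))%nat).
    unfold norm in HN; simpl in HN; unfold abs in HN; simpl in HN.
    assert (G : forall s b e : R, 0 <= b -> s < e -> s - b < e) by (intros; lra).
    apply G; [exact H1|]. exact (proj1 (Rabs_def2 _ _ HN)). }
  intros n m x Hx Hn Hm. destruct (Nat.le_ge_cases n m).
  - rewrite Rabs_minus_sym. now apply Main2.
  - now apply Main2.
Qed.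

(** Serves infinite products and periodizations alike: summable increments of values and derivatives
    on each bounded set give locally uniform convergence of both. *)
Lemma limit_C1 (fn fn' : nat -> R -> R) :
  (forall n x, is_derive (fn n) x (fn' n x)) -> (forall n, cont (fn' n)) ->
  (forall r, 0 < r -> exists beta, ex_series beta /\ forall n x, Rabs x < r ->
     Rabs (fn (S n) x - fn n x) <= beta n /\ Rabs (fn' (S n) x - fn' n x) <= beta n) ->
  (forall x, is_lim_seq (fun n => fn n x) (real (Lim_seq (fun n => fn n x)))) /\
  (forall x, is_lim_seq (fun n => fn' n x) (real (Lim_seq (fun n => fn' n x)))) /\
  (forall x, is_derive (fun y => real (Lim_seq (fun n => fn n y))) x (real (Lim_seq (fun n => fn' n x)))) /\
  cont (fun x => real (Lim_seq (fun n => fn' n x))).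
Proof.
  intros Hd Hc Hb.
  assert (Main : forall x0,
    is_lim_seq (fun n => fn n x0) (real (Lim_seq (fun n => fn n x0))) /\
    is_lim_seq (fun n => fn' n x0) (real (Lim_seq (fun n => fn' n x0))) /\
    is_derive (fun y => real (Lim_seq (fun n => fn n y))) x0 (real (Lim_seq (fun n => fn' n x0))) /\
    continuous (fun x => real (Lim_seq (fun n => fn' n x))) x0).
  2: { split; [|split; [|split]]; intros x; apply (Main x). }
  intros x0.
  assert (Hr : 0 < Rabs x0 + 1) by (assert (H := Rabs_pos x0); lra).
  destruct (Hb _ Hr) as [beta [Hs HB]].
  set (D := fun x => - (Rabs x0 + 1) < x /\ x < Rabs x0 + 1).
  assert (HD : forall x, D x -> Rabs x < Rabs x0 + 1) by (intros x [H1 H2]; apply Rabs_def1; lra).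
  assert (Hx0 : D x0) by (unfold D; split; unfold Rabs; destruct Rcase_abs; lra).
  assert (Hpos : forall n, 0 <= beta n).
  { intros n. eapply Rle_trans; [apply Rabs_pos|]. apply (HB n x0). now apply HD. }
  assert (U : CVU_dom fn D).
  { apply (increments_cauchy _ _ beta); auto. intros n x Hx. apply (HB n x). now apply HD. }
  assert (U' : CVU_dom fn' D).
  { apply (increments_cauchy _ _ beta); auto. intros n x Hx. apply (HB n x). now apply HD. }
  assert (OD : open D) by (apply open_and; [apply open_gt|apply open_lt]).
  assert (E : forall n x, Derive (fn n) x = fn' n x) by (intros; apply is_derive_unique; auto).
  split; [|split; [|split]].
  - apply Lim_seq_correct'. exact (CVU_CVS_dom _ _ U x0 Hx0).
  - apply Lim_seq_correct'. exact (CVU_CVS_dom _ _ U' x0 Hx0).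
  - rewrite <- (Lim_seq_ext (fun n => Derive (fn n) x0)) by auto.
    apply (CVU_Derive fn D); auto.
    + intros a b x [] [] []. split; lra.
    + intros n x _. eexists. apply Hd.
    + intros n x _. apply continuity_pt_filterlim.
      apply (continuous_ext (fn' n)); [intros; symmetry; apply E|]. apply Hc.
    + intros eps. destruct (U' eps) as [N HN]. exists N. intros n Hn x Hx.
      rewrite E, (Lim_seq_ext _ (fun n => fn' n x)) by auto. now apply HN.
  - apply continuity_pt_filterlim. apply (CVU_cont_open fn' D); auto.
    intros n x _. apply continuity_pt_filterlim. apply Hc.
Qed.

(** Comparison with the telescoping series of [6 / ((k + 1) (k + 2))], whose sum is 6. *)
Lemma ex_series_inv_sq : ex_series (fun k => / (1 + INR k ^ 2)).
Proof.
  apply (ex_series_le (K := R_AbsRing) (V := R_CompleteNormedModule) _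
    (fun k => 6 * (/ (INR k + 1) - / (INR k + 2)))).
  - intros k. assert (Hk := pos_INR k). unfold norm; simpl; unfold abs; simpl.
    assert (Hw := cauchy_weight_pos (INR k)).
    rewrite Rabs_pos_eq by (left; now apply Rinv_0_lt_compat).
    replace (6 * (/ (INR k + 1) - / (INR k + 2))) with (/ ((INR k + 1) * (INR k + 2) / 6)) by (field; lra).
    destruct k as [|k].
    + simpl. apply Rinv_le_contravar; lra.
    + apply Rinv_le_contravar; nra.
  - exists (6 * 1). refine (is_series_scal_l (K := R_AbsRing) (V := R_NormedModule) 6
      (fun k => / (INR k + 1) - / (INR k + 2)) 1 _).
    assert (P : forall n, sum_n (fun k => / (INR k + 1) - / (INR k + 2)) n = 1 - / (INR n + 2)).
    { induction n as [|n IH].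
      - rewrite sum_O. simpl. field.
      - rewrite sum_Sn, IH, S_INR. unfold plus; simpl. assert (Hn := pos_INR n). field. lra. }
    change (is_lim_seq (sum_n (fun k => / (INR k + 1) - / (INR k + 2))) 1).
    apply (is_lim_seq_ext (fun n => 1 - / (INR n + 2))); [intros; symmetry; apply P|].
    replace (Finite 1) with (Finite (1 - 0)) by (f_equal; ring).
    apply is_lim_seq_minus'; [apply is_lim_seq_const|].
    apply (is_lim_seq_inv _ p_infty); [|discriminate].
    apply (is_lim_seq_plus _ _ p_infty 2); [apply is_lim_seq_INR|apply is_lim_seq_const|reflexivity].
Qed.

Lemma ex_series_scal_inv_sq K : ex_series (fun k => K * / (1 + INR k ^ 2)).
Proof.
  apply (ex_series_scal_l (K := R_AbsRing) (V := R_NormedModule)). apply ex_series_inv_sq.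
Qed.

(** Peetre's inequality: shifting a point of [[-r, r]] leads to some [y] with [k <= |y| + r], and
    then [1 + k^2 <= 2 (1 + r^2) (1 + y^2)]. Shifted terms are thus dominated by a series
    independent of [x]. *)
Lemma peetre k x r : 0 <= r -> Rabs x <= r ->
  / (1 + (x + 2 * PI * INR k) ^ 2) <= 2 * (1 + r ^ 2) * / (1 + INR k ^ 2) /\
  / (1 + (x - 2 * PI * INR (S k)) ^ 2) <= 2 * (1 + r ^ 2) * / (1 + INR k ^ 2).
Proof.
  intros Hr Hx.
  assert (Main : forall y, INR k <= Rabs y + r -> / (1 + y ^ 2) <= 2 * (1 + r ^ 2) * / (1 + INR k ^ 2)).
  { intros y Hy. assert (Hw := cauchy_weight_pos y). assert (Hk := cauchy_weight_pos (INR k)).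
    assert (Hk0 := pos_INR k).
    apply Rmult_le_reg_r with ((1 + y ^ 2) * (1 + INR k ^ 2)); [now apply Rmult_lt_0_compat|].
    replace (/ (1 + y ^ 2) * ((1 + y ^ 2) * (1 + INR k ^ 2))) with (1 + INR k ^ 2) by (field; lra).
    replace (2 * (1 + r ^ 2) * / (1 + INR k ^ 2) * ((1 + y ^ 2) * (1 + INR k ^ 2)))
      with (2 * (1 + r ^ 2) * (1 + y ^ 2)) by (field; lra).
    rewrite <- (pow2_abs y).
    assert (INR k ^ 2 <= (Rabs y + r) ^ 2) by (apply pow_incr; lra).
    assert (0 <= (Rabs y - r) ^ 2) by apply pow2_ge_0.
    assert (0 <= r ^ 2 * Rabs y ^ 2) by (apply Rmult_le_pos; apply pow2_ge_0). nra. }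
  assert (HPI := PI2_3_2). assert (Hk0 := pos_INR k).
  assert (Hx' : - r <= x <= r) by (apply Rabs_le_between; exact Hx).
  split; apply Main.
  - assert (H1 := Rle_abs (x + 2 * PI * INR k)). nra.
  - rewrite <- Rabs_Ropp. assert (H1 := Rle_abs (- (x - 2 * PI * INR (S k)))). rewrite S_INR in *. nra.
Qed.

(** The two one-sided series are those of [Phi_l], which is therefore [per] of a square by
    computation; starting the second at [S k] counts the zero shift once. *)
Definition per (f : R -> R) (w : R) : R :=
  Series (fun k => f (w + 2 * PI * INR k)) + Series (fun k => f (w - 2 * PI * INR (S k))).

Lemma shifted_series_C1 (f f' : R -> R) (sh : nat -> R) (b : R -> nat -> R) :
  (forall x, is_derive f x (f' x)) -> cont f' ->
  (forall r, 0 < r -> ex_series (b r)) ->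
  (forall r x k, 0 < r -> Rabs x <= r -> Rabs (f (x + sh k)) <= b r k /\ Rabs (f' (x + sh k)) <= b r k) ->
  (forall x, is_derive (fun y => Series (fun k => f (y + sh k))) x (Series (fun k => f' (x + sh k)))) /\
  cont (fun x => Series (fun k => f' (x + sh k))).
Proof.
  intros Hd Hc Hb HB.
  destruct (limit_C1 (fun n x => sum_n (fun k => f (x + sh k)) n) (fun n x => sum_n (fun k => f' (x + sh k)) n))
    as [_ [_ H]].
  - intros n x. apply (is_derive_sum_n (fun k x => f (x + sh k))). intros k _.
    replace (f' (x + sh k)) with (1 * f' (x + sh k)) by ring.
    apply (is_derive_comp f (fun x => x + sh k)); [apply Hd|]. auto_derive; auto.
  - induction n as [|n IH].
    + apply (cont_ext (fun x => f' (x + sh 0%nat))); [intros; now rewrite sum_O|]. cont_tac.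
    + apply (cont_ext (fun x => sum_n (fun k => f' (x + sh k)) n + f' (x + sh (S n)))).
      * intros; now rewrite sum_Sn.
      * apply cont_plus; [exact IH|cont_tac].
  - intros r Hr. exists (fun n => b r (S n)). split.
    + apply (ex_series_incr_1 (b r)). now apply Hb.
    + intros n x Hx. rewrite !sum_Sn. unfold plus; simpl.
      destruct (HB r x (S n) Hr ltac:(lra)) as [H1 H2].
      split; match goal with |- Rabs (?u + ?v - ?u) <= _ => replace (u + v - u) with v by ring end; assumption.
  - exact H.
Qed.

Lemma ex_series_dom (a b : nat -> R) : (forall n, Rabs (a n) <= b n) -> ex_series b -> ex_series a.
Proof. intros H. apply (ex_series_le (K := R_AbsRing) (V := R_CompleteNormedModule)). exact H. Qed.

Lemma Series_dom (a b : nat -> R) : (forall n, Rabs (a n) <= b n) -> ex_series b ->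
  Rabs (Series a) <= Series b.
Proof.
  intros H Hb. eapply Rle_trans.
  - apply Series_Rabs. apply (ex_series_dom _ b); auto. intros; rewrite Rabs_Rabsolu; auto.
  - apply Series_le; auto. intros; split; auto using Rabs_pos.
Qed.

Definition sum_inv_sq : R := Series (fun k => / (1 + INR k ^ 2)).

Lemma per_shift_bound (f : R -> R) K r x k : 0 <= r -> Rabs x <= r -> 0 <= K ->
  (forall x, Rabs (f x) <= K / (1 + x ^ 2)) ->
  Rabs (f (x + 2 * PI * INR k)) <= K * (2 * (1 + r ^ 2)) * / (1 + INR k ^ 2) /\
  Rabs (f (x - 2 * PI * INR (S k))) <= K * (2 * (1 + r ^ 2)) * / (1 + INR k ^ 2).
Proof.
  intros Hr Hx HK B. destruct (peetre k x r Hr Hx) as [P1 P2].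
  split; (eapply Rle_trans; [apply B|]; rewrite (Rmult_assoc K); apply Rmult_le_compat_l; assumption).
Qed.

Lemma ex_series_shift (f : R -> R) K w : 0 <= K -> (forall x, Rabs (f x) <= K / (1 + x ^ 2)) ->
  ex_series (fun k => f (w + 2 * PI * INR k)) /\ ex_series (fun k => f (w - 2 * PI * INR (S k))).
Proof.
  intros HK B.
  split; apply (ex_series_dom _ (fun k => K * (2 * (1 + Rabs w ^ 2)) * / (1 + INR k ^ 2)));
    try (intros k; apply per_shift_bound; auto using Rabs_pos, Rle_refl);
    apply ex_series_scal_inv_sq.
Qed.

(** Advancing by a period moves a single term from the head of one series to the head of the
    other. *)
Lemma per_periodic (f : R -> R) K w : 0 <= K -> (forall x, Rabs (f x) <= K / (1 + x ^ 2)) ->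
  per f (w + 2 * PI) = per f w.
Proof.
  intros HK B. unfold per.
  destruct (ex_series_shift f K w HK B) as [E1 _].
  destruct (ex_series_shift f K (w + 2 * PI) HK B) as [_ E2].
  rewrite (Series_incr_1 (fun k => f (w + 2 * PI * INR k))) by exact E1.
  rewrite (Series_incr_1 (fun k => f (w + 2 * PI - 2 * PI * INR (S k)))) by exact E2.
  rewrite (Series_ext (fun k => f (w + 2 * PI + 2 * PI * INR k)) (fun k => f (w + 2 * PI * INR (S k))))
    by (intros k; f_equal; rewrite S_INR; ring).
  rewrite (Series_ext (fun k => f (w + 2 * PI - 2 * PI * INR (S (S k)))) (fun k => f (w - 2 * PI * INR (S k))))
    by (intros k; f_equal; rewrite !S_INR; ring).
  replace (w + 2 * PI - 2 * PI * INR 1) with (w + 2 * PI * INR 0) by (simpl; ring). ring.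
Qed.

Lemma periodic_IZR (f : R -> R) : (forall x, f (x + 2 * PI) = f x) ->
  forall z x, f (x + 2 * PI * IZR z) = f x.
Proof.
  intros H.
  assert (N : forall n x, f (x + 2 * PI * INR n) = f x).
  { induction n as [|n IH]; intros x; [f_equal; simpl; ring|].
    rewrite <- (IH x), <- (H (x + 2 * PI * INR n)), S_INR. f_equal. ring. }
  intros z x. destruct z as [|p|p].
  - f_equal. ring.
  - rewrite <- (N (Pos.to_nat p) x), INR_IZR_INZ, Znat.positive_nat_Z. reflexivity.
  - rewrite <- (N (Pos.to_nat p) (x + 2 * PI * IZR (Z.neg p))), INR_IZR_INZ, Znat.positive_nat_Z.
    f_equal. change (Z.neg p) with (- Z.pos p)%Z. rewrite opp_IZR. ring.
Qed.

(** The integer in the definition of [mM]: subtracting that many periods brings [x] into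
    [[-PI, PI)]. *)
Definition turns (x : R) : Z := Int_part ((x + PI) / (2 * PI)).

Lemma turns_spec x : - PI <= x - 2 * PI * IZR (turns x) < PI.
Proof.
  assert (HPI := PI_RGT_0).
  destruct (base_Int_part ((x + PI) / (2 * PI))) as [H1 H2]. fold (turns x) in *.
  assert (E : x + PI = 2 * PI * ((x + PI) / (2 * PI))) by (field; lra).
  set (q := (x + PI) / (2 * PI)) in *. nra.
Qed.

Lemma periodic_reduce (f : R -> R) : (forall x, f (x + 2 * PI) = f x) ->
  forall x, exists y, - PI <= y < PI /\ f x = f y.
Proof.
  intros H x. exists (x - 2 * PI * IZR (turns x)). split; [apply turns_spec|].
  rewrite <- (periodic_IZR f H (turns x) (x - 2 * PI * IZR (turns x))). f_equal. ring.
Qed.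

(** Two one-sided series, each at most [2 * (1 + 4 ^ 2) = 34] times [sum_inv_sq], because every
    point has a representative with [|y| <= 4] modulo [2 * PI]. *)
Definition Cper : R := 68 * sum_inv_sq.

Lemma per_bound (f : R -> R) K w : 0 <= K -> (forall x, Rabs (f x) <= K / (1 + x ^ 2)) ->
  Rabs (per f w) <= Cper * K.
Proof.
  intros HK B.
  destruct (periodic_reduce (per f) (fun x => per_periodic f K x HK B) w) as [y [Hy ->]].
  assert (Hy4 : Rabs y <= 4) by (apply Rabs_le; assert (H := PI_4); lra).
  assert (G : forall a, (forall k, Rabs (a k) <= K * (2 * (1 + 4 ^ 2)) * / (1 + INR k ^ 2)) ->
    Rabs (Series a) <= K * (2 * (1 + 4 ^ 2)) * sum_inv_sq).
  { intros a Ha. eapply Rle_trans; [apply (Series_dom _ _ Ha)|].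
    - apply ex_series_scal_inv_sq.
    - rewrite Series_scal_l. apply Rle_refl. }
  unfold per, Cper. eapply Rle_trans; [apply Rabs_triang|].
  assert (G1 := G (fun k => f (y + 2 * PI * INR k))). assert (G2 := G (fun k => f (y - 2 * PI * INR (S k)))).
  eapply Rle_trans; [apply Rplus_le_compat; [apply G1|apply G2]|lra].
  - intros k. apply per_shift_bound; auto; lra.
  - intros k. apply per_shift_bound; auto; lra.
Qed.

Lemma per_C1 (f f' : R -> R) K : 0 <= K -> (forall x, is_derive f x (f' x)) -> cont f' ->
  (forall x, Rabs (f x) <= K / (1 + x ^ 2)) -> (forall x, Rabs (f' x) <= K / (1 + x ^ 2)) ->
  (forall x, is_derive (per f) x (per f' x)) /\ cont (per f').
Proof.
  intros HK Hd Hc B B'.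
  set (b := fun r k => K * (2 * (1 + r ^ 2)) * / (1 + INR k ^ 2)).
  assert (Hb : forall r, 0 < r -> ex_series (b r)).
  { intros r _. apply ex_series_scal_inv_sq. }
  destruct (shifted_series_C1 f f' (fun k => 2 * PI * INR k) b Hd Hc Hb) as [D1 C1].
  { intros r x k Hr Hx. split; apply per_shift_bound; auto; lra. }
  destruct (shifted_series_C1 f f' (fun k => - (2 * PI * INR (S k))) b Hd Hc Hb) as [D2 C2].
  { intros r x k Hr Hx.
    replace (x + - (2 * PI * INR (S k))) with (x - 2 * PI * INR (S k)) by ring.
    split; apply per_shift_bound; auto; lra. }
  split.
  - intros x. apply (is_derive_plus (K := R_AbsRing) (V := R_NormedModule)); [apply D1|apply D2].
  - apply cont_plus; [apply C1|apply C2].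
Qed.

Lemma per_plus (f g : R -> R) K w : 0 <= K -> (forall x, Rabs (f x) <= K / (1 + x ^ 2)) ->
  (forall x, Rabs (g x) <= K / (1 + x ^ 2)) -> per (fun x => f x + g x) w = per f w + per g w.
Proof.
  intros HK Bf Bg.
  destruct (ex_series_shift f K w HK Bf) as [E1 E2]. destruct (ex_series_shift g K w HK Bg) as [E3 E4].
  unfold per. rewrite (Series_plus _ _ E1 E3), (Series_plus _ _ E2 E4). ring.
Qed.

(** * Infinite products and their decay *)

(** Of the same shape as [phi_l_hat], which is [infprod] of [m_l] by computation. *)
Definition infprod (m : R -> R) (x : R) : R :=
  real (Lim_seq (fun N => partprod (fun j => m (x / 2 ^ j)) N)).

Fixpoint dpartprod (m m' : R -> R) (N : nat) (x : R) : R :=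
  match N with
  | O => 0
  | S n => dpartprod m m' n x * m (x / 2 ^ S n)
           + partprod (fun j => m (x / 2 ^ j)) n * (m' (x / 2 ^ S n) / 2 ^ S n)
  end.

Lemma pow2_neq0 n : 2 ^ n <> 0.
Proof. apply pow_nonzero. lra. Qed.

Lemma is_derive_partprod (m m' : R -> R) : (forall x, is_derive m x (m' x)) ->
  forall N x, is_derive (fun y => partprod (fun j => m (y / 2 ^ j)) N) x (dpartprod m m' N x).
Proof.
  intros H N. induction N as [|N IH]; intros x.
  - apply (derive_const 1).
  - cbn [partprod dpartprod].
    apply (is_derive_mult (fun y => partprod (fun j => m (y / 2 ^ j)) N) (fun y => m (y / 2 ^ S N))).
    + apply IH.
    + replace (m' (x / 2 ^ S N) / 2 ^ S N) with ((/ 2 ^ S N) * m' (x / 2 ^ S N)) by (unfold Rdiv; ring).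
      apply (is_derive_comp m (fun y => y / 2 ^ S N)); [apply H|].
      auto_derive; [exact I|]. simpl. field. apply pow2_neq0.
    + intros; apply Rmult_comm.
Qed.

Lemma cont_partprod m N : cont m -> cont (fun y => partprod (fun j => m (y / 2 ^ j)) N).
Proof.
  intros Hm. induction N as [|N IH]; cbn [partprod]; [apply cont_const|].
  unfold Rdiv in *. cont_tac.
Qed.

Lemma cont_dpartprod m m' N : cont m -> cont m' -> cont (dpartprod m m' N).
Proof.
  intros Hm Hm'. induction N as [|N IH]; cbn [dpartprod]; [apply cont_const|].
  assert (C := cont_partprod m N Hm). unfold Rdiv in *. cont_tac.
Qed.

Lemma one_sided_lip (m m' : R -> R) k a x : (forall x, is_derive m x (m' x)) ->
  (forall t, Rabs t <= a -> Rabs (m' t) <= k) -> Rabs x <= a -> Rabs (m x - m 0) <= k * Rabs x.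
Proof.
  intros Hd Hk Hx. rewrite <- (Rminus_0_r x) at 2. apply (bounded_variation m m').
  intros t Ht. rewrite !Rminus_0_r in Ht. split; [apply Hd|]. apply Hk. lra.
Qed.

Lemma Rabs_div_pow2 x n : Rabs (x / 2 ^ n) = Rabs x / 2 ^ n.
Proof.
  unfold Rdiv. rewrite Rabs_mult, Rabs_inv, (Rabs_pos_eq (2 ^ n)); [reflexivity|].
  apply pow_le. lra.
Qed.

Lemma div_pow2_le y n : 0 <= y -> y / 2 ^ S n <= y / 2.
Proof.
  intros Hy. apply Rmult_le_compat_l; [exact Hy|]. apply Rinv_le_contravar; [lra|].
  assert (H : 1 <= 2 ^ n) by (apply pow_R1_Rle; lra). simpl. lra.
Qed.

Lemma inv_pow2_bound n : 0 < / 2 ^ n <= 1.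
Proof.
  split; [apply Rinv_0_lt_compat, pow_lt; lra|].
  rewrite <- Rinv_1. apply Rinv_le_contravar; [lra|]. apply pow_R1_Rle; lra.
Qed.

(** The factor at [x / 2^j] is at most [exp (k |x| / 2^j)], and [1 - / 2 ^ N] is the sum of these
    powers of [1 / 2]. For [|x| <= 2 * a] all arguments lie in [[-a, a]], so [m'] has to be bounded
    only near 0. *)
Lemma partprod_bounds (m m' : R -> R) k a : (forall x, is_derive m x (m' x)) -> m 0 = 1 -> 0 <= k ->
  (forall t, Rabs t <= a -> Rabs (m' t) <= k) ->
  forall N x, Rabs x <= 2 * a ->
    Rabs (partprod (fun j => m (x / 2 ^ j)) N) <= exp (k * Rabs x * (1 - / 2 ^ N)) /\
    Rabs (dpartprod m m' N x) <= k * (1 - / 2 ^ N) * exp (k * Rabs x * (1 - / 2 ^ N)).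
Proof.
  intros Hd H0 Hk Hm N x Hx. assert (HX := Rabs_pos x).
  induction N as [|N [IH1 IH2]].
  - cbn [partprod dpartprod]. rewrite Rabs_R0, Rabs_R1. simpl. rewrite Rinv_1, Rminus_diag, !Rmult_0_r, exp_0. lra.
  - cbn [partprod dpartprod].
    set (P := Rabs (partprod _ N)) in *. set (t := x / 2 ^ S N).
    assert (Ht : Rabs t = Rabs x / 2 ^ S N) by apply Rabs_div_pow2.
    assert (Hta : Rabs t <= a).
    { rewrite Ht. assert (H := div_pow2_le (Rabs x) N HX). lra. }
    assert (M1 : Rabs (m t) <= 1 + k * Rabs t).
    { assert (H := one_sided_lip m m' k a t Hd Hm Hta). rewrite H0 in H.
      replace (m t) with ((m t - 1) + 1) by ring.
      eapply Rle_trans; [apply Rabs_triang|]. rewrite Rabs_R1. lra. }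
    assert (M2 := Hm t Hta).
    assert (M3 : 1 + k * Rabs t <= exp (k * Rabs t)) by apply exp_ineq1_le.
    assert (Hu1 := inv_pow2_bound N).
    assert (Hu' : / 2 ^ N = 2 * / 2 ^ S N) by (simpl; field; apply pow2_neq0).
    assert (E : exp (k * Rabs x * (1 - / 2 ^ S N)) = exp (k * Rabs x * (1 - / 2 ^ N)) * exp (k * Rabs t)).
    { rewrite <- exp_plus. f_equal. rewrite Ht, Hu'. unfold Rdiv. ring. }
    set (e1 := exp (k * Rabs x * (1 - / 2 ^ N))) in *. set (e2 := exp (k * Rabs t)) in *.
    assert (He1 : 0 < e1) by apply exp_pos.
    assert (Hkt : 0 <= k * Rabs t) by (apply Rmult_le_pos; [exact Hk|apply Rabs_pos]).
    rewrite E. split.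
    + rewrite Rabs_mult. apply Rmult_le_compat; auto using Rabs_pos. lra.
    + eapply Rle_trans; [apply Rabs_triang|]. rewrite !Rabs_mult.
      assert (T1 : Rabs (dpartprod m m' N x) * Rabs (m t) <= k * (1 - / 2 ^ N) * e1 * e2).
      { apply Rmult_le_compat; auto using Rabs_pos. lra. }
      assert (T2 : P * Rabs (m' t / 2 ^ S N) <= e1 * (k * / 2 ^ S N)).
      { rewrite Rabs_div_pow2. apply Rmult_le_compat; [apply Rabs_pos| |exact IH1|].
        - apply Rmult_le_pos; [apply Rabs_pos|lra].
        - apply Rmult_le_compat_r; [lra|exact M2]. }
      apply Rle_trans with (1 := Rplus_le_compat _ _ _ _ T1 T2).
      assert (e1 * (k * / 2 ^ S N) <= e1 * (k * / 2 ^ S N) * e2).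
      { rewrite <- (Rmult_1_r (e1 * (k * / 2 ^ S N))) at 1. apply Rmult_le_compat_l; [|lra].
        apply Rmult_le_pos; [lra|]. apply Rmult_le_pos; lra. }
      rewrite Hu'. replace (k * (1 - / 2 ^ S N) * (e1 * e2))
        with (k * (1 - 2 * / 2 ^ S N) * e1 * e2 + e1 * (k * / 2 ^ S N) * e2) by ring.
      lra.
Qed.

Lemma exp_mono x y : x <= y -> exp x <= exp y.
Proof.
  intros [H|H]; [left; now apply exp_increasing|now rewrite H; right].
Qed.

Lemma partprod_bounds_crude (m m' : R -> R) k a : (forall x, is_derive m x (m' x)) -> m 0 = 1 -> 0 <= k -> 0 <= a ->
  (forall t, Rabs t <= a -> Rabs (m' t) <= k) ->
  forall N x, Rabs x <= 2 * a ->
    Rabs (partprod (fun j => m (x / 2 ^ j)) N) <= exp (k * (2 * a)) /\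
    Rabs (dpartprod m m' N x) <= k * exp (k * (2 * a)).
Proof.
  intros Hd H0 Hk Ha Hm N x Hx.
  destruct (partprod_bounds m m' k a Hd H0 Hk Hm N x Hx) as [B1 B2].
  assert (Hu := inv_pow2_bound N).
  assert (E : exp (k * Rabs x * (1 - / 2 ^ N)) <= exp (k * (2 * a))).
  { apply exp_mono. rewrite Rmult_assoc. apply Rmult_le_compat_l; [exact Hk|]. nra. }
  split; [lra|]. eapply Rle_trans; [exact B2|].
  apply Rmult_le_compat; [apply Rmult_le_pos; lra|left; apply exp_pos|nra|exact E].
Qed.

Lemma partprod_refine (m : R -> R) N x :
  partprod (fun j => m (x / 2 ^ j)) (S N) = m (x / 2) * partprod (fun j => m (x / 2 / 2 ^ j)) N.
Proof.
  induction N as [|N IH].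
  - simpl. replace (x / (2 * 1)) with (x / 2) by field. ring.
  - change (partprod (fun j => m (x / 2 ^ j)) (S N) * m (x / 2 ^ S (S N)) =
      m (x / 2) * (partprod (fun j => m (x / 2 / 2 ^ j)) N * m (x / 2 / 2 ^ S N))).
    rewrite IH. replace (x / 2 / 2 ^ S N) with (x / 2 ^ S (S N)); [ring|].
    simpl. field. apply pow2_neq0.
Qed.

(** An increment carries either [m - 1] at a point of size [2^-N] or the chain-rule factor [2^-N],
    so it is [O(2^-N)] on bounded sets. The last clause keeps [k] local: where [m'] is small near 0,
    so is [phi'], whatever the global bound [B]. *)
Lemma infprod_C1 (m m' : R -> R) B : (forall x, is_derive m x (m' x)) -> cont m' -> m 0 = 1 ->
  (forall x, Rabs (m' x) <= B) ->
  exists phi' : R -> R, (forall x, is_derive (infprod m) x (phi' x)) /\ cont phi' /\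
    (forall x, infprod m x = m (x / 2) * infprod m (x / 2)) /\ infprod m 0 = 1 /\
    (forall k a, 0 <= k -> 0 <= a -> (forall t, Rabs t <= a -> Rabs (m' t) <= k) ->
       forall x, Rabs x <= 2 * a -> Rabs (phi' x) <= k * exp (k * (2 * a))).
Proof.
  intros Hd Hc H0 HB.
  assert (Cm : cont m) by exact (cont_derivable m m' Hd).
  assert (HB0 : 0 <= B) by (eapply Rle_trans; [apply Rabs_pos|apply (HB 0)]).
  set (fn := fun N x => partprod (fun j => m (x / 2 ^ j)) N).
  destruct (limit_C1 fn (dpartprod m m')) as [L [L' [D C]]].
  - intros N x. apply is_derive_partprod; auto.
  - intros N. apply cont_dpartprod; auto.
  - intros r Hr. set (e := exp (B * r)). assert (He : 0 < e) by apply exp_pos.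
    (* The first summand serves the increments of the derivatives, the second those of the values,
       so that one sequence bounds both. *)
    set (K := e * B * (B * r + 1) + e * B * r).
    exists (fun n => K * (/ 2) ^ S n). split.
    + apply (ex_series_scal_l (K := R_AbsRing) (V := R_NormedModule)).
      apply (ex_series_incr_1 (fun n => (/ 2) ^ n)). apply ex_series_geom. rewrite Rabs_pos_eq; lra.
    + intros N x Hx.
      destruct (partprod_bounds_crude m m' B (r / 2) Hd H0 HB0 ltac:(lra) (fun t _ => HB t) N x ltac:(lra)) as [B1 B2].
      replace (B * (2 * (r / 2))) with (B * r) in B1, B2 by field.
      rewrite pow_inv.
      assert (Hu := inv_pow2_bound (S N)).
      assert (M1 : Rabs (m (x / 2 ^ S N) - 1) <= B * (r * / 2 ^ S N)).
      { rewrite <- H0. eapply Rle_trans; [apply (one_sided_lip m m' B (Rabs (x / 2 ^ S N)) _ Hd); auto; lra|].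
        rewrite Rabs_div_pow2. apply Rmult_le_compat_l; [exact HB0|]. apply Rmult_le_compat_r; lra. }
      assert (M2 := HB (x / 2 ^ S N)).
      assert (HBr : 0 <= B * r) by (apply Rmult_le_pos; lra).
      assert (HeB : 0 <= e * B) by (apply Rmult_le_pos; lra).
      assert (T1 : Rabs (fn N x) * Rabs (m (x / 2 ^ S N) - 1) <= e * (B * (r * / 2 ^ S N))).
      { apply Rmult_le_compat; auto using Rabs_pos. }
      split.
      * unfold fn in *. cbn [partprod].
        match goal with |- Rabs (?u * ?v - ?u) <= _ => replace (u * v - u) with (u * (v - 1)) by ring end.
        rewrite Rabs_mult. eapply Rle_trans; [exact T1|].
        replace (e * (B * (r * / 2 ^ S N))) with ((e * B * r) * / 2 ^ S N) by ring.
        apply Rmult_le_compat_r; [lra|]. unfold K. nra.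
      * cbn [dpartprod]. fold (fn N x).
        replace (dpartprod m m' N x * m (x / 2 ^ S N) + fn N x * (m' (x / 2 ^ S N) / 2 ^ S N) - dpartprod m m' N x)
          with (dpartprod m m' N x * (m (x / 2 ^ S N) - 1) + fn N x * (m' (x / 2 ^ S N) / 2 ^ S N)) by ring.
        eapply Rle_trans; [apply Rabs_triang|]. rewrite !Rabs_mult, Rabs_div_pow2.
        assert (T2 : Rabs (dpartprod m m' N x) * Rabs (m (x / 2 ^ S N) - 1) <= B * e * (B * (r * / 2 ^ S N))).
        { apply Rmult_le_compat; auto using Rabs_pos. }
        assert (T3 : Rabs (fn N x) * (Rabs (m' (x / 2 ^ S N)) / 2 ^ S N) <= e * (B * / 2 ^ S N)).
        { apply Rmult_le_compat; auto using Rabs_pos.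
          - apply Rmult_le_pos; [apply Rabs_pos|lra].
          - apply Rmult_le_compat_r; lra. }
        eapply Rle_trans; [apply (Rplus_le_compat _ _ _ _ T2 T3)|].
        replace (B * e * (B * (r * / 2 ^ S N)) + e * (B * / 2 ^ S N))
          with ((e * B * (B * r + 1)) * / 2 ^ S N) by ring.
        apply Rmult_le_compat_r; [lra|]. unfold K.
        assert (0 <= e * B * r) by (apply Rmult_le_pos; lra). lra.
  - exists (fun x => real (Lim_seq (fun n => dpartprod m m' n x))).
    split; [exact D|]. split; [exact C|]. split; [|split].
    + intros x.
      (* Both sides of the refinement equation are limits of the same sequence, up to a shift of the
         index. *)
      assert (L1 := is_lim_seq_scal_l _ (m (x / 2)) _ (L (x / 2))).
      assert (L2 := proj1 (is_lim_seq_incr_1 _ _) (L x)).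
      apply (is_lim_seq_ext _ (fun n => fn (S n) x)) in L1.
      * apply is_lim_seq_unique in L1. apply is_lim_seq_unique in L2. rewrite L1 in L2.
        now injection L2.
      * intros n. symmetry. apply partprod_refine.
    + change (real (Lim_seq (fun n => fn n 0)) = 1).
      rewrite (Lim_seq_ext _ (fun _ => 1)), Lim_seq_const; [reflexivity|].
      intros n. unfold fn. induction n as [|n IH]; [reflexivity|]. cbn [partprod].
      rewrite IH. unfold Rdiv. rewrite Rmult_0_l, H0. ring.
    + intros k a Hk Ha Hm x Hx.
      assert (La := is_lim_seq_abs _ _ (L' x)). simpl in La.
      apply (is_lim_seq_le (fun n => Rabs (dpartprod m m' n x)) (fun _ => k * exp (k * (2 * a)))
        (Rabs (real (Lim_seq (fun n => dpartprod m m' n x)))) (k * exp (k * (2 * a)))).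
      * intros n. now apply partprod_bounds_crude.
      * exact La.
      * apply is_lim_seq_const.
Qed.

(* [hsin2 x = sin (x / 2) ^ 2]; the Meyer mask vanishes where it is at least [3/4]. *)
Definition hsin2 (x : R) : R := (1 - cos x) / 2.

Lemma hsin2_double x : hsin2 x = 4 * hsin2 (x / 2) * (1 - hsin2 (x / 2)).
Proof.
  unfold hsin2. replace x with (2 * (x / 2)) at 1 by field. rewrite cos_2a_cos. field.
Qed.
Lemma hsin2_bound x : 0 <= hsin2 x <= 1.
Proof. unfold hsin2. assert (H := COS_bound x). lra. Qed.

(* Weight [wt] with [16 |m(x)| wt(x) <= wt(2x)] for a mask small where [hsin2 >= 3/4]:
   it turns one step of the refinement equation into a gain of [2^-4]. *)
Definition wt (x : R) : R := if Rle_dec (3 / 4) (hsin2 x) then 1 else hsin2 x ^ 3 / 16.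

Lemma wt_bound x : 0 <= wt x <= 1.
Proof.
  unfold wt. assert (H := hsin2_bound x).
  destruct Rle_dec; [lra|]. assert (H1 : 0 <= hsin2 x ^ 3 <= 1 ^ 3) by (split; [apply pow_le|apply pow_incr]; lra).
  lra.
Qed.

(** With [|m| <= 3 / 2] the weight must grow by [3 / 2 * 16 = 24] in one doubling. If [hsin2 x] is
    still below [3 / 4], then [hsin2 (x / 2) < 1 / 4] and doubling multiplies it by at least 3; the
    cube is the least power [p] with [3 ^ p >= 24]. Otherwise the weight jumps to 1. *)
Lemma wt_double_small x : hsin2 (x / 2) < 3 / 4 -> 3 * (16 * wt (x / 2)) <= 2 * wt x.
Proof.
  intros H. unfold wt. destruct (Rle_dec (3 / 4) (hsin2 (x / 2))); [lra|].
  assert (Hb := hsin2_bound (x / 2)). set (s := hsin2 (x / 2)) in *.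
  destruct Rle_dec as [H1|H1].
  - assert (s ^ 3 <= (3 / 4) ^ 3) by (apply pow_incr; lra). lra.
  - rewrite hsin2_double in *. fold s in H1 |- *.
    assert ((3 * s) ^ 3 <= (4 * s * (1 - s)) ^ 3) by (apply pow_incr; nra).
    assert (0 <= s ^ 3) by (apply pow_le; lra). lra.
Qed.

(** Writing [s] for [hsin2 (x / 2)], one has [hsin2 x = 4 s (1 - s) >= 3 (1 - s)]: from the zone,
    [x] comes close to [2 pi Z] only if [s] is close to 1, where the mask supplies [(1 - s)^3]. *)
Lemma wt_double_large x : 3 / 4 <= hsin2 (x / 2) -> (1 - hsin2 (x / 2)) ^ 3 <= wt x.
Proof.
  intros H. unfold wt. assert (Hb := hsin2_bound (x / 2)). rewrite (hsin2_double x).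
  set (s := hsin2 (x / 2)) in *.
  destruct Rle_dec as [H1|H1].
  - rewrite <- (pow1 3). apply pow_incr. lra.
  - assert ((3 * (1 - s)) ^ 3 <= (4 * s * (1 - s)) ^ 3) by (apply pow_incr; nra).
    assert (0 <= (1 - s) ^ 3) by (apply pow_le; lra). lra.
Qed.

Lemma cos_le_mhalf x : 2 * PI / 3 <= Rabs x <= 4 * PI / 3 -> cos x <= - (1 / 2).
Proof.
  intros H. assert (E : cos x = cos (Rabs x)).
  { unfold Rabs; destruct Rcase_abs; [now rewrite cos_neg|reflexivity]. }
  rewrite E. set (y := Rabs x) in *.
  assert (C1 : cos (2 * (PI / 3)) = - (1 / 2)) by (rewrite cos_2a_cos, cos_PI3; field).
  rewrite <- C1.
  destruct (Rle_dec y PI) as [Hy|Hy].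
  - apply cos_decr_1; lra.
  - replace (cos y) with (cos (2 * PI - y)).
    + apply cos_decr_1; lra.
    + rewrite cos_minus, cos_2PI, sin_2PI. ring.
Qed.

Lemma hsin2_zone x : 2 * PI / 3 <= Rabs x <= 4 * PI / 3 -> 3 / 4 <= hsin2 x.
Proof. intros H. apply cos_le_mhalf in H. unfold hsin2. lra. Qed.

Lemma pow4_pos x : 0 < Rabs x -> 0 < x ^ 4.
Proof.
  intros H. replace (x ^ 4) with ((x ^ 2) ^ 2) by ring. rewrite <- (pow2_abs x).
  now apply pow_lt, pow_lt.
Qed.

(** Induction over dyadic shells with the sharper bound [K d wt x / x^4]: halving costs 16 in
    [x^-4], and [wt] gives it back. On the first shell, [|x|] between [4 PI / 3] and [8 PI / 3], the
    point [x / 2] lies in the zone, whence the factor [d]; there [|x| < 9], and 6561 is [9^4]. *)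
Lemma tail_decay (m m' phi phi' : R -> R) B L d :
  0 <= d <= 1 / 16 -> 0 <= L -> (forall x, Rabs (m x) <= 3 / 2) -> (forall x, Rabs (m' x) <= B) ->
  (forall x, 3 / 4 <= hsin2 x -> Rabs (m x) <= d * (1 - hsin2 x) ^ 3 /\ Rabs (m' x) <= d * (1 - hsin2 x) ^ 3) ->
  (forall x, phi x = m (x / 2) * phi (x / 2)) ->
  (forall x, phi' x = / 2 * m' (x / 2) * phi (x / 2) + / 2 * m (x / 2) * phi' (x / 2)) ->
  (forall x, 2 * PI / 3 <= Rabs x <= 4 * PI / 3 -> Rabs (phi x) <= L /\ Rabs (phi' x) <= L) ->
  forall x, 4 * PI / 3 <= Rabs x ->
    Rabs (phi x) <= 6561 * L * d / x ^ 4 /\ Rabs (phi' x) <= (B + 1) * (6561 * L) * d / x ^ 4.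
Proof.
  intros Hd HL Hm Hm' Hz Hp Hp' Hbase.
  assert (HB : 0 <= B) by (eapply Rle_trans; [apply Rabs_pos|apply (Hm' 0)]).
  assert (HPI' := PI_bounds).
  set (K := 6561 * L). assert (HK : 0 <= K) by (unfold K; lra).
  (* In the zone [d <= 1 / 16] cancels the 16; outside it the growth of the weight is enough. *)
  assert (V1 : forall x, Rabs (m (x / 2)) * (16 * wt (x / 2)) <= wt x).
  { intros x. assert (HV := wt_bound (x / 2)). assert (Hb := hsin2_bound (x / 2)).
    destruct (Rlt_le_dec (hsin2 (x / 2)) (3 / 4)) as [H|H].
    - assert (H1 := wt_double_small x H). specialize (Hm (x / 2)).
      apply Rle_trans with (3 / 2 * (16 * wt (x / 2))); [apply Rmult_le_compat_r; lra|lra].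
    - assert (H1 := wt_double_large x H). destruct (Hz _ H) as [H2 _].
      assert (0 <= (1 - hsin2 (x / 2)) ^ 3) by (apply pow_le; lra).
      assert (0 <= Rabs (m (x / 2))) by apply Rabs_pos. nra. }
  assert (V2 : forall x, Rabs (m' (x / 2)) * (16 * wt (x / 2)) <= (B + 1) * wt x).
  { intros x. assert (HV := wt_bound (x / 2)). assert (Hb := hsin2_bound (x / 2)).
    destruct (Rlt_le_dec (hsin2 (x / 2)) (3 / 4)) as [H|H].
    - assert (H1 := wt_double_small x H). specialize (Hm' (x / 2)).
      assert (0 <= Rabs (m' (x / 2))) by apply Rabs_pos. nra.
    - assert (H1 := wt_double_large x H). destruct (Hz _ H) as [_ H2].
      assert (0 <= (1 - hsin2 (x / 2)) ^ 3) by (apply pow_le; lra).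
      assert (0 <= Rabs (m' (x / 2))) by apply Rabs_pos. nra. }
  assert (Main : forall n x, 4 * PI / 3 <= Rabs x <= 4 * PI / 3 * 2 ^ n ->
    Rabs (phi x) <= K * d * wt x / x ^ 4 /\ Rabs (phi' x) <= (B + 1) * K * d * wt x / x ^ 4).
  { assert (Pos4 : forall x, 4 * PI / 3 <= Rabs x -> 0 < x ^ 4).
    { intros x Hx. apply pow4_pos. lra. }
    assert (Nz : forall x, 4 * PI / 3 <= Rabs x -> x <> 0).
    { intros x Hx ->. rewrite Rabs_R0 in Hx. lra. }
    assert (Base : forall x, 4 * PI / 3 <= Rabs x <= 8 * PI / 3 ->
      Rabs (phi x) <= K * d * wt x / x ^ 4 /\ Rabs (phi' x) <= (B + 1) * K * d * wt x / x ^ 4).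
    { intros x Hx.
      assert (Hx2 : 2 * PI / 3 <= Rabs (x / 2) <= 4 * PI / 3) by (rewrite Rabs_half; lra).
      destruct (Hbase _ Hx2) as [L1 L2]. assert (Z := hsin2_zone _ Hx2).
      destruct (Hz _ Z) as [Z1 Z2]. assert (H1 := wt_double_large x Z).
      assert (Hb := hsin2_bound (x / 2)).
      assert (0 <= (1 - hsin2 (x / 2)) ^ 3) by (apply pow_le; lra).
      assert (P4 := Pos4 x (proj1 Hx)). assert (X0 := Nz x (proj1 Hx)).
      assert (Q4 : x ^ 4 <= 6561).
      { replace 6561 with (9 ^ 4) by ring.
        replace (x ^ 4) with (Rabs x ^ 4).
        - apply pow_incr. split; [apply Rabs_pos|lra].
        - rewrite RPow_abs. apply Rabs_pos_eq. lra. }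
      assert (HLdV : 0 <= L * d * wt x) by (apply Rmult_le_pos; [apply Rmult_le_pos|]; lra).
      assert (Q : L * d * wt x <= K * d * wt x / x ^ 4).
      { apply Rmult_le_reg_r with (x ^ 4); [exact P4|]. replace (K * d * wt x / x ^ 4 * x ^ 4) with (6561 * (L * d * wt x)) by (unfold K; field; exact X0).
        rewrite (Rmult_comm 6561). now apply Rmult_le_compat_l. }
      assert (Z1' : Rabs (m (x / 2)) <= d * wt x) by nra.
      assert (Z2' : Rabs (m' (x / 2)) <= d * wt x) by nra.
      assert (R1 : Rabs (m (x / 2)) * Rabs (phi (x / 2)) <= d * wt x * L) by (apply Rmult_le_compat; auto using Rabs_pos).
      assert (R2 : Rabs (m (x / 2)) * Rabs (phi' (x / 2)) <= d * wt x * L) by (apply Rmult_le_compat; auto using Rabs_pos).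
      assert (R3 : Rabs (m' (x / 2)) * Rabs (phi (x / 2)) <= d * wt x * L) by (apply Rmult_le_compat; auto using Rabs_pos).
      split.
      - rewrite Hp, Rabs_mult. lra.
      - rewrite Hp'. eapply Rle_trans; [apply Rabs_triang|]. rewrite !Rabs_mult, (Rabs_pos_eq (/ 2)) by lra.
        assert (0 <= K * d * wt x / x ^ 4) by lra.
        replace ((B + 1) * K * d * wt x / x ^ 4) with (B * (K * d * wt x / x ^ 4) + K * d * wt x / x ^ 4)
          by (unfold Rdiv; ring).
        assert (0 <= B * (K * d * wt x / x ^ 4)) by (apply Rmult_le_pos; lra). lra. }
    intros n. induction n as [|n IH]; intros x Hx.
    - apply Base. simpl in Hx. lra.
    - destruct (Rle_dec (Rabs x) (8 * PI / 3)) as [Hx8|Hx8]; [apply Base; lra|].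
      assert (Hx2 : 4 * PI / 3 <= Rabs (x / 2) <= 4 * PI / 3 * 2 ^ n).
      { rewrite Rabs_half. simpl in Hx. lra. }
      destruct (IH _ Hx2) as [I1 I2]. assert (P4 := Pos4 x (proj1 Hx)). assert (X0 := Nz x (proj1 Hx)).
      replace (K * d * wt (x / 2) / (x / 2) ^ 4) with (K * d / x ^ 4 * (16 * wt (x / 2))) in I1
        by (field; exact X0).
      replace ((B + 1) * K * d * wt (x / 2) / (x / 2) ^ 4) with ((B + 1) * (K * d / x ^ 4) * (16 * wt (x / 2))) in I2
        by (field; exact X0).
      replace (K * d * wt x / x ^ 4) with (K * d / x ^ 4 * wt x) by (unfold Rdiv; ring).
      replace ((B + 1) * K * d * wt x / x ^ 4) with ((B + 1) * (K * d / x ^ 4) * wt x) by (unfold Rdiv; ring).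
      assert (Hq : 0 <= K * d / x ^ 4) by (apply Rdiv_le_0_compat; nra).
      set (q := K * d / x ^ 4) in *.
      assert (W1 := V1 x).
      assert (A1 := Rabs_pos (m (x / 2))). assert (A2 := Rabs_pos (m' (x / 2))).
      assert (R1 : Rabs (m (x / 2)) * Rabs (phi (x / 2)) <= q * wt x).
      { apply Rle_trans with (Rabs (m (x / 2)) * (q * (16 * wt (x / 2)))).
        - now apply Rmult_le_compat_l.
        - replace (Rabs (m (x / 2)) * (q * (16 * wt (x / 2)))) with (q * (Rabs (m (x / 2)) * (16 * wt (x / 2)))) by ring.
          now apply Rmult_le_compat_l. }
      assert (R2 : Rabs (m (x / 2)) * Rabs (phi' (x / 2)) <= (B + 1) * q * wt x).
      { apply Rle_trans with (Rabs (m (x / 2)) * ((B + 1) * q * (16 * wt (x / 2)))).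
        - now apply Rmult_le_compat_l.
        - replace (Rabs (m (x / 2)) * ((B + 1) * q * (16 * wt (x / 2)))) with ((B + 1) * q * (Rabs (m (x / 2)) * (16 * wt (x / 2)))) by ring.
          apply Rmult_le_compat_l; [apply Rmult_le_pos; lra|exact W1]. }
      (* Both terms of the differentiated refinement equation carry [1 / 2] and are bounded by
         [(B + 1) q wt x], so the constant [B + 1] reproduces itself. *)
      assert (R3 : Rabs (m' (x / 2)) * Rabs (phi (x / 2)) <= (B + 1) * q * wt x).
      { apply Rle_trans with (Rabs (m' (x / 2)) * (q * (16 * wt (x / 2)))).
        - now apply Rmult_le_compat_l.
        - replace (Rabs (m' (x / 2)) * (q * (16 * wt (x / 2)))) with (q * (Rabs (m' (x / 2)) * (16 * wt (x / 2)))) by ring.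
          replace ((B + 1) * q * wt x) with (q * ((B + 1) * wt x)) by ring.
          now apply Rmult_le_compat_l. }
      split.
      + now rewrite Hp, Rabs_mult.
      + rewrite Hp'. eapply Rle_trans; [apply Rabs_triang|]. rewrite !Rabs_mult, (Rabs_pos_eq (/ 2)) by lra. lra. }
  intros x Hx.
  assert (Hn : exists n, Rabs x <= 4 * PI / 3 * 2 ^ n).
  { destruct (Pow_x_infinity 2 ltac:(rewrite Rabs_pos_eq; lra) (Rabs x)) as [n Hn]. exists n.
    specialize (Hn n (le_n _)). rewrite (Rabs_pos_eq (2 ^ n)) in Hn by (apply pow_le; lra).
    assert (1 * 2 ^ n <= 4 * PI / 3 * 2 ^ n) by (apply Rmult_le_compat_r; lra). lra. }
  destruct Hn as [n Hn]. destruct (Main n x (conj Hx Hn)) as [A1 A2].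
  assert (HV := wt_bound x).
  assert (P4 : 0 < x ^ 4) by (apply pow4_pos; lra).
  assert (Hi : 0 < / x ^ 4) by now apply Rinv_0_lt_compat.
  assert (HKd : 0 <= K * d) by (apply Rmult_le_pos; lra).
  assert (HKV : K * d * wt x <= K * d) by nra.
  split; (eapply Rle_trans; [eassumption|]); apply Rmult_le_compat_r; try lra.
  rewrite !Rmult_assoc. apply Rmult_le_compat_l; lra.
Qed.

(** * Simultaneous approximation of functions and derivatives *)

(** [f] approximates [g]. One [K] governs the size of [g] and the error, relative to the same
    weight, so that products stay of this form with [e] unchanged. The derivatives are parameters
    and can be given by formulas. *)
Record near (rho : R -> R) (K e : R) (f f' g g' : R -> R) : Prop := mk_near {
  near_d : forall x, is_derive f x (f' x);
  near_c : cont f';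
  near_d0 : forall x, is_derive g x (g' x);
  near_c0 : cont g';
  near_b : forall x, Rabs (g x) <= K * rho x;
  near_b' : forall x, Rabs (g' x) <= K * rho x;
  near_e : forall x, Rabs (f x - g x) <= K * e * rho x;
  near_e' : forall x, Rabs (f' x - g' x) <= K * e * rho x }.

Definition dec (x : R) : R := / (1 + x ^ 2) ^ 2.

Lemma dec_pos x : 0 < dec x.
Proof. apply Rinv_0_lt_compat, pow_lt, cauchy_weight_pos. Qed.

(** [9 / 2] exceeds [4 * PI / 3], the radius of the Meyer support, and [(1 + (9 / 2)^2)^2] is about
    452. *)
Lemma dec_compact x : Rabs x <= 9 / 2 -> 1 <= 500 * dec x.
Proof.
  intros H. unfold dec. assert (Hw := cauchy_weight_pos x).
  assert (H1 : (1 + x ^ 2) ^ 2 <= 500).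
  { assert (H2 : Rabs x ^ 2 <= (9 / 2) ^ 2) by (apply pow_incr; split; [apply Rabs_pos|exact H]).
    rewrite pow2_abs in H2. nra. }
  apply Rmult_le_reg_r with ((1 + x ^ 2) ^ 2); [now apply pow_lt|].
  replace (500 * / (1 + x ^ 2) ^ 2 * (1 + x ^ 2) ^ 2) with 500 by (field; lra). lra.
Qed.

Lemma dec_tail x a : 1 <= Rabs x -> 0 <= a -> a / x ^ 4 <= 4 * a * dec x.
Proof.
  intros H Ha. unfold dec. assert (Hw := cauchy_weight_pos x).
  assert (Hx : x <> 0) by (intros ->; rewrite Rabs_R0 in H; lra).
  assert (H1 : 1 <= x ^ 2) by (rewrite <- (pow2_abs x); nra).
  replace (4 * a * / (1 + x ^ 2) ^ 2) with (a * (4 * / (1 + x ^ 2) ^ 2)) by ring.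
  apply Rmult_le_compat_l; [exact Ha|].
  apply Rmult_le_reg_r with (x ^ 4 * (1 + x ^ 2) ^ 2).
  - apply Rmult_lt_0_compat; [|now apply pow_lt]. replace (x ^ 4) with (x ^ 2 * x ^ 2) by ring.
    apply Rmult_lt_0_compat; lra.
  - replace (/ x ^ 4 * (x ^ 4 * (1 + x ^ 2) ^ 2)) with ((1 + x ^ 2) ^ 2) by (field; exact Hx).
    replace (4 * / (1 + x ^ 2) ^ 2 * (x ^ 4 * (1 + x ^ 2) ^ 2)) with (4 * (x ^ 2) ^ 2) by (field; lra).
    nra.
Qed.

Lemma derive_half (f f' : R -> R) x : (forall y, is_derive f y (f' y)) ->
  is_derive (fun y => f (y / 2)) x (/ 2 * f' (x / 2)).
Proof.
  intros H. apply (is_derive_comp f (fun y => y / 2)); [apply H|]. auto_derive; [exact I|]. field.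
Qed.

(** [K] is fixed by [B] before the mask is chosen, so it serves every [l]. Between the plateau
    around 0 and the tail, one refinement step carries the estimate from [|x| <= 2 PI / 3] to
    [|x| <= 4 PI / 3]. *)
Lemma scaling_near (B : R) : exists K, 0 <= K /\
  forall (M M' phi0 phi0' : R -> R),
  (forall x, is_derive M x (M' x)) -> cont M' -> (forall x, Rabs (M x) <= 1) -> (forall x, Rabs (M' x) <= B) ->
  (forall x, is_derive phi0 x (phi0' x)) -> cont phi0' ->
  (forall x, Rabs x <= 2 * PI / 3 -> phi0 x = 1 /\ phi0' x = 0) ->
  (forall x, Rabs x <= 4 * PI / 3 -> phi0 x = M (x / 2) /\ phi0' x = / 2 * M' (x / 2)) ->
  (forall x, 4 * PI / 3 <= Rabs x -> phi0 x = 0 /\ phi0' x = 0) ->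
  forall (m m' : R -> R) (k : R),
  (forall x, is_derive m x (m' x)) -> cont m' -> m 0 = 1 -> 0 <= k <= 1 / 16 ->
  (forall x, Rabs (m x - M x) <= k) -> (forall x, Rabs (m' x - M' x) <= k) ->
  (forall x, 3 / 4 <= hsin2 x -> Rabs (m x) <= k * (1 - hsin2 x) ^ 3 /\ Rabs (m' x) <= k * (1 - hsin2 x) ^ 3) ->
  exists phi', near dec K k (infprod m) phi' phi0 phi0'.
Proof.
  (* [L0 * k] will bound the error on [|x| <= 4 PI / 3], and [L] the product and its derivative at
     the start of the tail. [exp 3] generously covers [exp (k * (2 * (PI / 3)))], as
     [k <= 1 / 16]. *)
  set (L0 := 10 * exp 3 * (Rabs B + 1)). set (L := 2 + Rabs B + L0).
  assert (HAB := Rabs_pos B). assert (He3 : 1 < exp 3) by (rewrite <- exp_0; apply exp_increasing; lra).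
  assert (HL0 : 0 <= L0) by (unfold L0; apply Rmult_le_pos; lra).
  assert (HL : 0 <= L) by (unfold L; lra).
  set (Kt := (Rabs B + 1 + 1) * (6561 * L)). assert (HKt : 0 <= Kt) by (unfold Kt; apply Rmult_le_pos; lra).
  exists (500 * (L0 + 1 + Rabs B) + 4 * Kt). split; [lra|].
  intros M M' phi0 phi0' HdM HcM HM HM' Hdp Hcp H1 H2 H3 m m' k Hd Hc H0 Hk Hm Hm' Hz.
  set (Bb := Rabs B + 1).
  assert (HMB : forall x, Rabs (M' x) <= Rabs B).
  { intros x. eapply Rle_trans; [apply HM'|apply Rle_abs]. }
  assert (HBm' : forall x, Rabs (m' x) <= Bb).
  { intros x. eapply Rle_trans; [apply (Rabs_near _ _ _ _ (HMB x) (Hm' x))|unfold Bb; lra]. }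
  assert (HBm : forall x, Rabs (m x) <= 3 / 2).
  { intros x. eapply Rle_trans; [apply (Rabs_near _ _ _ _ (HM x) (Hm x))|lra]. }
  destruct (infprod_C1 m m' Bb Hd Hc H0 HBm') as [phi' [Dphi [Cphi [Rphi [P0 Bphi]]]]].
  exists phi'. set (phi := infprod m) in *.
  assert (HPI' := PI_bounds).
  (* [phi0 (2 * t) = M t] is flat here, so [M' t = 0] and [m'] itself is at most [k]. *)
  assert (M0 : forall t, Rabs t <= PI / 3 -> Rabs (m' t) <= k).
  { intros t Ht.
    assert (Ht2 : Rabs (2 * t) <= 2 * PI / 3) by (rewrite Rabs_mult, (Rabs_pos_eq 2); lra).
    destruct (H1 _ Ht2) as [_ E1]. destruct (H2 (2 * t) ltac:(lra)) as [_ E2].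
    replace (2 * t / 2) with t in E2 by field. specialize (Hm' t).
    replace (M' t) with 0 in Hm' by lra. now rewrite Rminus_0_r in Hm'. }
  assert (N1' : forall x, Rabs x <= 2 * PI / 3 -> Rabs (phi' x) <= k * exp 3).
  { intros x Hx. eapply Rle_trans; [apply (Bphi k (PI / 3)); try lra; exact M0|].
    apply Rmult_le_compat_l; [lra|]. apply exp_mono. nra. }
  assert (N1 : forall x, Rabs x <= 2 * PI / 3 -> Rabs (phi x - 1) <= k * exp 3 * 3).
  { intros x Hx. rewrite <- P0. eapply Rle_trans; [apply (one_sided_lip phi phi' (k * exp 3) (2 * PI / 3) x Dphi N1' Hx)|].
    apply Rmult_le_compat_l; [nra|lra]. }
  assert (Dref : forall x, phi' x = / 2 * m' (x / 2) * phi (x / 2) + / 2 * m (x / 2) * phi' (x / 2)).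
  { intros x. assert (E : is_derive phi x (/ 2 * m' (x / 2) * phi (x / 2) + m (x / 2) * (/ 2 * phi' (x / 2)))).
    { apply (is_derive_ext (fun y => m (y / 2) * phi (y / 2))); [exact (fun t => eq_sym (Rphi t))|].
      apply (is_derive_mult (fun y => m (y / 2)) (fun y => phi (y / 2))).
      - now apply derive_half.
      - now apply derive_half.
      - intros; apply Rmult_comm. }
    apply is_derive_unique in E. rewrite <- (is_derive_unique _ _ _ (Dphi x)), E. ring. }
  (* The refinement equation is compared with [phi0 x = M (x / 2)]; the point [x / 2] is back in the
     region of [N1] and [N1']. *)
  assert (N2 : forall x, Rabs x <= 4 * PI / 3 -> Rabs (phi x - phi0 x) <= L0 * k /\ Rabs (phi' x - phi0' x) <= L0 * k).
  { intros x Hx. destruct (H2 x Hx) as [-> ->].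
    assert (Hx2 : Rabs (x / 2) <= 2 * PI / 3) by (rewrite Rabs_half; lra).
    assert (Q1 := Hm (x / 2)). assert (Q2 := Hm' (x / 2)). assert (Q4 := HBm' (x / 2)).
    set (E3 := exp 3) in *.
    assert (HkE1 : k <= k * E3) by nra.
    split.
    - rewrite Rphi. replace (m (x / 2) * phi (x / 2) - M (x / 2)) with
        (m (x / 2) * (phi (x / 2) - 1) + (m (x / 2) - M (x / 2))) by ring.
      eapply Rle_trans; [apply Rabs_triang|]. rewrite Rabs_mult.
      assert (Rabs (m (x / 2)) * Rabs (phi (x / 2) - 1) <= 3 / 2 * (k * E3 * 3))
        by (apply Rmult_le_compat; auto using Rabs_pos).
      unfold L0. nra.
    - rewrite Dref.
      replace (/ 2 * m' (x / 2) * phi (x / 2) + / 2 * m (x / 2) * phi' (x / 2) - / 2 * M' (x / 2)) with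
        (/ 2 * (m' (x / 2) * (phi (x / 2) - 1)) + / 2 * (m' (x / 2) - M' (x / 2)) + / 2 * (m (x / 2) * phi' (x / 2))) by ring.
      eapply Rle_trans; [apply Rabs_triang|]. eapply Rle_trans; [apply Rplus_le_compat_r, Rabs_triang|].
      rewrite !(Rabs_mult (/ 2)), (Rabs_pos_eq (/ 2)), !Rabs_mult by lra.
      assert (T1 : Rabs (m' (x / 2)) * Rabs (phi (x / 2) - 1) <= (Rabs B + 1) * (k * E3 * 3))
        by (apply Rmult_le_compat; auto using Rabs_pos).
      assert (T2 : Rabs (m (x / 2)) * Rabs (phi' (x / 2)) <= 3 / 2 * (k * E3))
        by (apply Rmult_le_compat; auto using Rabs_pos).
      unfold L0. assert (0 <= Rabs B * (k * E3)) by (apply Rmult_le_pos; lra). nra. }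
  assert (B0 : forall x, Rabs (phi0 x) <= 1 /\ Rabs (phi0' x) <= Rabs B).
  { intros x. destruct (Rle_dec (Rabs x) (4 * PI / 3)) as [Hx|Hx].
    - destruct (H2 x Hx) as [-> ->]. split; [apply HM|].
      rewrite Rabs_mult, (Rabs_pos_eq (/ 2)) by lra. specialize (HMB (x / 2)). lra.
    - destruct (H3 x ltac:(lra)) as [-> ->]. rewrite Rabs_R0. lra. }
  assert (HL0k : L0 * k <= L0) by nra.
  assert (Bs : forall x, 2 * PI / 3 <= Rabs x <= 4 * PI / 3 -> Rabs (phi x) <= L /\ Rabs (phi' x) <= L).
  { intros x [_ Hx]. destruct (N2 x Hx) as [E1 E2]. destruct (B0 x) as [F1 F2]. unfold L.
    split; (eapply Rle_trans; [|]).
    1: exact (Rabs_near _ _ _ _ F1 E1). 2: exact (Rabs_near _ _ _ _ F2 E2). all: lra. }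
  assert (T := tail_decay m m' phi phi' Bb L k Hk HL HBm HBm' Hz Rphi Dref Bs).
  assert (T4 : forall x, 4 * PI / 3 <= Rabs x -> Rabs (phi x) <= 4 * (Kt * k) * dec x /\ Rabs (phi' x) <= 4 * (Kt * k) * dec x).
  { intros x Hx. destruct (T x Hx) as [T1 T2].
    assert (Q : Kt * k / x ^ 4 <= 4 * (Kt * k) * dec x) by (apply dec_tail; [lra|apply Rmult_le_pos; lra]).
    split; [|unfold Kt in *; unfold Bb in *; lra].
    eapply Rle_trans; [exact T1|]. eapply Rle_trans; [|exact Q].
    assert (P4 : 0 < x ^ 4) by (apply pow4_pos; lra).
    apply Rmult_le_compat_r; [left; now apply Rinv_0_lt_compat|].
    apply Rmult_le_compat_r; [lra|]. unfold Kt. nra. }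
  assert (Near : forall x, Rabs x <= 4 * PI / 3 -> 1 <= 500 * dec x) by (intros x Hx; apply dec_compact; lra).
  assert (D := dec_pos).
  set (K := 500 * (L0 + 1 + Rabs B) + 4 * Kt).
  assert (C0 : forall x a, 0 <= a <= 1 + Rabs B -> (4 * PI / 3 < Rabs x -> a = 0) -> a <= K * dec x).
  { intros x a Ha Ha0. specialize (D x). destruct (Rle_dec (Rabs x) (4 * PI / 3)) as [Hx|Hx].
    - specialize (Near x Hx). apply Rle_trans with (a * (500 * dec x)); [nra|].
      apply Rle_trans with ((500 * (1 + Rabs B)) * dec x); [nra|].
      apply Rmult_le_compat_r; [lra|unfold K; lra].
    - rewrite Ha0 by lra. apply Rmult_le_pos; [unfold K|]; lra. }
  assert (C1 : forall x a, a <= L0 * k -> a <= K * k * dec x \/ 4 * PI / 3 < Rabs x).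
  { intros x a Ha. specialize (D x). destruct (Rle_dec (Rabs x) (4 * PI / 3)) as [Hx|Hx]; [left|right; lra].
    specialize (Near x Hx). apply Rle_trans with (L0 * k * (500 * dec x)).
    - assert (0 <= L0 * k) by (apply Rmult_le_pos; lra). nra.
    - replace (L0 * k * (500 * dec x)) with (500 * L0 * (k * dec x)) by ring.
      rewrite (Rmult_assoc K). apply Rmult_le_compat_r; [nra|unfold K; lra]. }
  assert (C2 : forall x, 4 * (Kt * k) * dec x <= K * k * dec x).
  { intros x. specialize (D x). apply Rmult_le_compat_r; [lra|]. rewrite <- Rmult_assoc.
    apply Rmult_le_compat_r; [lra|unfold K; lra]. }
  split; auto.
  - intros x. destruct (B0 x) as [F1 _]. apply C0; [split; [apply Rabs_pos|lra]|].
    intros Hx. destruct (H3 x ltac:(lra)) as [-> _]. apply Rabs_R0.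
  - intros x. destruct (B0 x) as [_ F1]. apply C0; [split; [apply Rabs_pos|lra]|].
    intros Hx. destruct (H3 x ltac:(lra)) as [_ ->]. apply Rabs_R0.
  - intros x. destruct (Rle_dec (Rabs x) (4 * PI / 3)) as [Hx|Hx].
    + destruct (C1 x _ (proj1 (N2 x Hx))); [assumption|lra].
    + destruct (H3 x ltac:(lra)) as [-> _]. rewrite Rminus_0_r.
      eapply Rle_trans; [apply T4; lra|apply C2].
  - intros x. destruct (Rle_dec (Rabs x) (4 * PI / 3)) as [Hx|Hx].
    + destruct (C1 x _ (proj2 (N2 x Hx))); [assumption|lra].
    + destruct (H3 x ltac:(lra)) as [_ ->]. rewrite Rminus_0_r.
      eapply Rle_trans; [apply T4; lra|apply C2].
Qed.

(** The error of a product splits into three terms of relative size [e], the quadratic one because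
    [e <= 1]. The product rule has two summands, whence 6. *)
Lemma near_mult rho1 rho2 K1 K2 e f f' g g' h h' i i' :
  0 <= e <= 1 -> near rho1 K1 e f f' g g' -> near rho2 K2 e h h' i i' ->
  near (fun x => rho1 x * rho2 x) (6 * K1 * K2) e
    (fun x => f x * h x) (fun x => f' x * h x + f x * h' x)
    (fun x => g x * i x) (fun x => g' x * i x + g x * i' x).
Proof.
  intros He [Df Cf Dg Cg B B' E E'] [Dh Ch Di Ci G G' F F'].
  assert (Cf0 := cont_derivable _ _ Df). assert (Cg0 := cont_derivable _ _ Dg).
  assert (Ch0 := cont_derivable _ _ Dh). assert (Ci0 := cont_derivable _ _ Di).
  assert (Prod : forall (u u0 v v0 : R -> R),
    (forall x, Rabs (u0 x) <= K1 * rho1 x) -> (forall x, Rabs (u x - u0 x) <= K1 * e * rho1 x) ->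
    (forall x, Rabs (v0 x) <= K2 * rho2 x) -> (forall x, Rabs (v x - v0 x) <= K2 * e * rho2 x) ->
    forall x, Rabs (u0 x * v0 x) <= (K1 * rho1 x) * (K2 * rho2 x) /\
      Rabs (u x * v x - u0 x * v0 x) <= 3 * e * ((K1 * rho1 x) * (K2 * rho2 x))).
  { intros u u0 v v0 A1 A2 A3 A4 x. specialize (A1 x). specialize (A2 x). specialize (A3 x). specialize (A4 x).
    assert (P1 := Rabs_pos (u0 x)). assert (P2 := Rabs_pos (v0 x)).
    assert (P3 := Rabs_pos (u x - u0 x)). assert (P4 := Rabs_pos (v x - v0 x)).
    replace (K1 * e * rho1 x) with (e * (K1 * rho1 x)) in A2 by ring.
    replace (K2 * e * rho2 x) with (e * (K2 * rho2 x)) in A4 by ring.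
    set (a := K1 * rho1 x) in *. set (b := K2 * rho2 x) in *.
    split.
    - rewrite Rabs_mult. now apply Rmult_le_compat.
    - replace (u x * v x - u0 x * v0 x) with
        ((u x - u0 x) * (v x - v0 x) + (u x - u0 x) * v0 x + u0 x * (v x - v0 x)) by ring.
      eapply Rle_trans; [apply Rabs_triang|]. eapply Rle_trans; [apply Rplus_le_compat_r, Rabs_triang|].
      rewrite !Rabs_mult.
      assert (Q1 : Rabs (u x - u0 x) * Rabs (v x - v0 x) <= (e * a) * b).
      { apply Rmult_le_compat; auto. eapply Rle_trans; [exact A4|]. nra. }
      assert (Q2 : Rabs (u x - u0 x) * Rabs (v0 x) <= (e * a) * b) by now apply Rmult_le_compat.
      assert (Q3 : Rabs (u0 x) * Rabs (v x - v0 x) <= a * (e * b)) by now apply Rmult_le_compat.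
      lra. }
  assert (P1 := Prod f g h i B E G F). assert (P2 := Prod f' g' h i B' E' G F). assert (P3 := Prod f g h' i' B E G' F').
  assert (Pos : forall x, 0 <= (K1 * rho1 x) * (K2 * rho2 x)).
  { intros x. eapply Rle_trans; [apply Rabs_pos|apply (proj1 (P1 x))]. }
  assert (Pose : forall x, 0 <= e * ((K1 * rho1 x) * (K2 * rho2 x))).
  { intros x. apply Rmult_le_pos; [lra|apply Pos]. }
  split.
  - intros x. apply (is_derive_mult f h); auto. intros; apply Rmult_comm.
  - cont_tac.
  - intros x. apply (is_derive_mult g i); auto. intros; apply Rmult_comm.
  - cont_tac.
  - intros x. destruct (P1 x). specialize (Pos x). lra.
  - intros x. destruct (P2 x), (P3 x). specialize (Pos x).
    eapply Rle_trans; [apply Rabs_triang|]. lra.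
  - intros x. destruct (P1 x). specialize (Pose x). lra.
  - intros x. destruct (P2 x), (P3 x). specialize (Pose x).
    replace (f' x * h x + f x * h' x - (g' x * i x + g x * i' x)) with
      ((f' x * h x - g' x * i x) + (f x * h' x - g x * i' x)) by ring.
    eapply Rle_trans; [apply Rabs_triang|]. lra.
Qed.

Lemma near_weight rho1 rho2 C K e f f' g g' : (forall x, 0 <= rho1 x <= C * rho2 x) -> 0 <= e -> 0 <= K ->
  near rho1 K e f f' g g' -> near rho2 (K * C) e f f' g g'.
Proof.
  intros H He HK [Df Cf Dg Cg B B' E E'].
  assert (A : forall x, K * rho1 x <= K * C * rho2 x).
  { intros x. rewrite Rmult_assoc. apply Rmult_le_compat_l; [exact HK|apply H]. }
  assert (A' : forall x, K * e * rho1 x <= K * C * e * rho2 x).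
  { intros x. replace (K * C * e * rho2 x) with (K * e * (C * rho2 x)) by ring.
    apply Rmult_le_compat_l; [now apply Rmult_le_pos|apply H]. }
  split; auto; intros x.
  - eapply Rle_trans; [apply B|apply A].
  - eapply Rle_trans; [apply B'|apply A].
  - eapply Rle_trans; [apply E|apply A'].
  - eapply Rle_trans; [apply E'|apply A'].
Qed.

Lemma near_affine rho K e f f' g g' a b : near rho K e f f' g g' -> Rabs a <= 1 ->
  near (fun x => rho (a * x + b)) K e
    (fun x => f (a * x + b)) (fun x => a * f' (a * x + b))
    (fun x => g (a * x + b)) (fun x => a * g' (a * x + b)).
Proof.
  intros [Df Cf Dg Cg B B' E E'] Ha.
  assert (Cmp : forall (u u' : R -> R), (forall x, is_derive u x (u' x)) -> forall x,
    is_derive (fun x => u (a * x + b)) x (a * u' (a * x + b))).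
  { intros u u' Hu x. apply (is_derive_comp u (fun x => a * x + b)); [apply Hu|].
    auto_derive; [exact I|ring]. }
  assert (Sm : forall z, Rabs (a * z) <= Rabs z).
  { intros z. rewrite Rabs_mult. rewrite <- (Rmult_1_l (Rabs z)) at 2.
    apply Rmult_le_compat_r; [apply Rabs_pos|exact Ha]. }
  split; auto; try cont_tac; intros x.
  - eapply Rle_trans; [apply Sm|apply B'].
  - rewrite <- Rmult_minus_distr_l. eapply Rle_trans; [apply Sm|apply E'].
Qed.

(** [K * e <= 1 / 2] keeps [f] and its root above [1 / 2], so [sqrt f + 1] and [2 * sqrt f] are at
    least 1 and [K] is not enlarged. *)
Lemma near_sqrt K e f f' : 0 <= e <= 1 -> K * e <= 1 / 2 ->
  near (fun _ => 1) K e f f' (fun _ => 1) (fun _ => 0) ->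
  near (fun _ => 1) K e (fun x => sqrt (f x)) (fun x => f' x / (2 * sqrt (f x))) (fun _ => 1) (fun _ => 0).
Proof.
  intros He HK [Df Cf Dg Cg B B' E E'].
  assert (Cf0 := cont_derivable _ _ Df).
  assert (Pf : forall x, 1 / 2 <= f x).
  { intros x. specialize (E x). rewrite Rmult_1_r in E.
    assert (H := Rabs_le_between (f x - 1) (K * e)). apply H in E. lra. }
  assert (Ps : forall x, 1 / 2 <= sqrt (f x)).
  { intros x. specialize (Pf x). rewrite <- (sqrt_square (1 / 2)) by lra. apply sqrt_le_1; lra. }
  split; auto.
  - intros x. apply is_derive_sqrt; [apply Df|]. specialize (Pf x). lra.
  - cont_tac. intros x. specialize (Ps x). lra.
  - intros x. eapply Rle_trans; [|apply (E x)].
    assert (Hs : (sqrt (f x) - 1) * (sqrt (f x) + 1) = f x - 1).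
    { rewrite <- (sqrt_sqrt (f x)) at 3 by (specialize (Pf x); lra). ring. }
    rewrite <- Hs, Rabs_mult. rewrite <- (Rmult_1_r (Rabs (sqrt (f x) - 1))) at 1.
    apply Rmult_le_compat_l; [apply Rabs_pos|].
    specialize (Ps x). rewrite Rabs_pos_eq; lra.
  - intros x. eapply Rle_trans; [|apply (E' x)]. rewrite !Rminus_0_r. unfold Rdiv. rewrite Rabs_mult.
    rewrite <- (Rmult_1_r (Rabs (f' x))) at 2. apply Rmult_le_compat_l; [apply Rabs_pos|].
    specialize (Ps x). rewrite Rabs_pos_eq by (left; apply Rinv_0_lt_compat; lra).
    rewrite <- Rinv_1. apply Rinv_le_contravar; lra.
Qed.

(** As [f >= 1 / 2], the values are multiplied by [1 / f <= 2] and the derivatives by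
    [1 / f^2 <= 4]. *)
Lemma near_inv K e f f' : 0 <= e <= 1 -> 1 <= K -> K * e <= 1 / 2 ->
  near (fun _ => 1) K e f f' (fun _ => 1) (fun _ => 0) ->
  near (fun _ => 1) (4 * K) e (fun x => / f x) (fun x => - f' x / f x ^ 2) (fun _ => 1) (fun _ => 0).
Proof.
  intros He HK1 HK [Df Cf Dg Cg B B' E E'].
  assert (Cf0 := cont_derivable _ _ Df).
  assert (Pf : forall x, 1 / 2 <= f x).
  { intros x. specialize (E x). rewrite Rmult_1_r in E.
    assert (H := Rabs_le_between (f x - 1) (K * e)). apply H in E. lra. }
  assert (Pi : forall x, 0 < / f x <= 2).
  { intros x. specialize (Pf x). split; [apply Rinv_0_lt_compat; lra|].
    replace 2 with (/ (1 / 2)) by field. apply Rinv_le_contravar; lra. }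
  split; auto.
  - intros x. apply is_derive_inv; [apply Df|]. specialize (Pf x). lra.
  - cont_tac. intros x. specialize (Pf x). nra.
  - intros x. rewrite Rabs_R1. lra.
  - intros x. rewrite Rabs_R0. lra.
  - intros x. specialize (E x). specialize (Pf x). specialize (Pi x).
    replace (/ f x - 1) with (- ((f x - 1) * / f x)) by (field; lra).
    rewrite Rabs_Ropp, Rabs_mult, (Rabs_pos_eq (/ f x)) by lra.
    assert (P := Rabs_pos (f x - 1)). nra.
  - intros x. specialize (E' x). specialize (Pf x). specialize (Pi x). rewrite Rminus_0_r in *.
    replace (- f' x / f x ^ 2) with (- (f' x * (/ f x * / f x))) by (field; lra).
    rewrite Rabs_Ropp, Rabs_mult, (Rabs_pos_eq (/ f x * / f x)) by nra.
    assert (P := Rabs_pos (f' x)). assert (/ f x * / f x <= 4) by nra. nra.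
Qed.

Lemma dec_le_cauchy x : dec x <= / (1 + x ^ 2).
Proof.
  assert (H := decay4_decay2 1 x ltac:(lra)). unfold Rdiv in H. rewrite !Rmult_1_l in H. exact H.
Qed.

Lemma dec_le1 x : dec x <= 1.
Proof.
  eapply Rle_trans; [apply dec_le_cauchy|].
  rewrite <- Rinv_1. apply Rinv_le_contravar; nra.
Qed.

(** Since the shifted squares of [phi0] sum to 1 exactly, only the difference of squares is
    periodized, and its factor [e] survives. The summand 1 of the constant bounds the limit
    function. *)
Lemma near_per K e phi phi' phi0 phi0' : 0 <= K -> 0 <= e <= 1 ->
  near dec K e phi phi' phi0 phi0' -> (forall x, per (fun x => phi0 x ^ 2) x = 1) ->
  exists F', near (fun _ => 1) (1 + Cper * (6 * K * K)) e
    (per (fun x => Rabs (phi x) ^ 2)) F' (fun _ => 1) (fun _ => 0).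
Proof.
  intros HK He N H1.
  assert (N2 := near_mult _ _ _ _ _ _ _ _ _ _ _ _ _ He N N).
  set (C := 6 * K * K) in *. assert (HC : 0 <= C) by (unfold C; nra).
  destruct N2 as [Df Cf Dg Cg B B' E E'].
  set (f := fun x => phi x * phi x) in *. set (f' := fun x => phi' x * phi x + phi x * phi' x) in *.
  set (g := fun x => phi0 x * phi0 x) in *. set (g' := fun x => phi0' x * phi0 x + phi0 x * phi0' x) in *.
  assert (W : forall x a, 0 <= a -> a * (dec x * dec x) <= a / (1 + x ^ 2)).
  { intros x a Ha. apply Rmult_le_compat_l; [exact Ha|].
    assert (H2 := dec_le_cauchy x). assert (H3 := dec_le1 x). assert (H4 := dec_pos x). nra. }
  assert (HCe : 0 <= C * e) by (apply Rmult_le_pos; lra).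
  set (d := fun x => f x - g x). set (d' := fun x => f' x - g' x).
  assert (Bd : forall x, Rabs (d x) <= C * e / (1 + x ^ 2)) by (intros x; eapply Rle_trans; [apply E|now apply W]).
  assert (Bd' : forall x, Rabs (d' x) <= C * e / (1 + x ^ 2)) by (intros x; eapply Rle_trans; [apply E'|now apply W]).
  assert (Dd : forall x, is_derive d x (d' x)) by (intros x; apply (is_derive_minus f g); auto).
  assert (Cd : cont d') by (apply (cont_minus f' g'); auto).
  destruct (per_C1 d d' (C * e) HCe Dd Cd Bd Bd') as [Dp Cp].
  assert (Ep : forall x, per (fun x => Rabs (phi x) ^ 2) x = 1 + per d x).
  { intros x. rewrite <- (H1 x).
    rewrite <- (per_plus (fun x => phi0 x ^ 2) d C x HC).
    - unfold per. f_equal; apply Series_ext; intros k; rewrite pow2_abs; unfold d, f, g; ring.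
    - intros y. replace (phi0 y ^ 2) with (g y) by (unfold g; ring).
      eapply Rle_trans; [apply B|now apply W].
    - intros y. eapply Rle_trans; [apply Bd|]. apply Rmult_le_compat_r.
      + left. apply Rinv_0_lt_compat, cauchy_weight_pos.
      + nra. }
  assert (HS : 0 <= Cper * C).
  { assert (H2 := per_bound (fun _ => 0) C 0 HC). eapply Rle_trans; [apply Rabs_pos|apply H2].
    intros y. rewrite Rabs_R0. apply Rdiv_le_0_compat; [exact HC|apply cauchy_weight_pos]. }
  exists (per d'). split.
  - intros x. apply (is_derive_ext (fun y => 1 + per d y)); [intros; symmetry; apply Ep|].
    replace (per d' x) with (0 + per d' x) by ring.
    apply (is_derive_plus (fun _ => 1) (per d)); [apply derive_const|apply Dp].
  - exact Cp.
  - intros x. apply derive_const.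
  - apply cont_const.
  - intros x. rewrite Rabs_R1. lra.
  - intros x. rewrite Rabs_R0. lra.
  - intros x. rewrite Ep. replace (1 + per d x - 1) with (per d x) by ring.
    eapply Rle_trans; [apply (per_bound d (C * e) x HCe Bd)|]. nra.
  - intros x. rewrite Rminus_0_r.
    eapply Rle_trans; [apply (per_bound d' (C * e) x HCe Bd')|]. nra.
Qed.

(** * Stability of the radii *)

(** [A * e <= N0 / 2] keeps [N] above [N0 / 2]; the difference is [(V - V0) / N] plus [V0 / N0]
    times [(N0 - N) / N]. *)
Lemma ratio_bound V V0 N N0 A e : 0 <= e -> Rabs (V - V0) <= A * e -> Rabs (N - N0) <= A * e ->
  0 < N0 -> A * e <= N0 / 2 ->
  Rabs (V / N - V0 / N0) <= (2 * A / N0 * (1 + Rabs V0 / N0)) * e.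
Proof.
  intros He HV HN H0 HA.
  assert (HN1 : N0 / 2 <= N).
  { apply Rabs_le_between in HN. lra. }
  replace (V / N - V0 / N0) with ((V - V0) * / N + (V0 * / N0) * ((N0 - N) * / N)) by (field; lra).
  eapply Rle_trans; [apply Rabs_triang|]. rewrite !Rabs_mult.
  rewrite (Rabs_minus_sym N0 N), (Rabs_pos_eq (/ N0)) by (left; apply Rinv_0_lt_compat; lra).
  assert (HiN : 0 < / N) by (apply Rinv_0_lt_compat; lra).
  rewrite (Rabs_pos_eq (/ N)) by lra.
  assert (HiN2 : / N <= 2 * / N0).
  { replace (2 * / N0) with (/ (N0 / 2)) by (field; lra). apply Rinv_le_contravar; lra. }
  assert (Q1 : Rabs (V - V0) * / N <= A * e * (2 * / N0)).
  { apply Rmult_le_compat; auto using Rabs_pos. lra. }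
  assert (Q2 : Rabs (N - N0) * / N <= A * e * (2 * / N0)).
  { apply Rmult_le_compat; auto using Rabs_pos. lra. }
  assert (HV0 : 0 <= Rabs V0 * / N0).
  { apply Rmult_le_pos; [apply Rabs_pos|left; now apply Rinv_0_lt_compat]. }
  apply Rle_trans with (A * e * (2 * / N0) + Rabs V0 * / N0 * (A * e * (2 * / N0))).
  - apply Rplus_le_compat; [exact Q1|]. now apply Rmult_le_compat_l.
  - right. unfold Rdiv. ring.
Qed.

Lemma dec_to_cauchy2 x a : 0 <= a ->
  a * (dec x * dec x) <= a / (1 + x ^ 2) /\ x ^ 2 * (a * (dec x * dec x)) <= a / (1 + x ^ 2).
Proof.
  intros Ha.
  assert (H2 := dec_le_cauchy x). assert (H3 := dec_le1 x). assert (H4 := dec_pos x).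
  assert (Hx := pow2_ge_0 x).
  assert (H5 : x ^ 2 * dec x <= 1).
  { apply Rle_trans with (x ^ 2 * / (1 + x ^ 2)); [now apply Rmult_le_compat_l|].
    apply Rmult_le_reg_r with (1 + x ^ 2); [lra|]. rewrite Rmult_assoc, Rinv_l; lra. }
  split.
  - apply Rmult_le_compat_l; [exact Ha|]. nra.
  - replace (x ^ 2 * (a * (dec x * dec x))) with (a * ((x ^ 2 * dec x) * dec x)) by ring.
    apply Rmult_le_compat_l; [exact Ha|]. nra.
Qed.

Lemma sq_diff_dec H H0 K e x : 0 <= K -> 0 <= e <= 1 ->
  Rabs (H0 x) <= K * dec x -> Rabs (H x - H0 x) <= K * e * dec x ->
  Rabs (H x ^ 2 - H0 x ^ 2) <= 3 * K ^ 2 * e * (dec x * dec x) /\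
  H x ^ 2 <= 4 * K ^ 2 * (dec x * dec x).
Proof.
  intros HK He B E. assert (D := dec_pos x).
  assert (HKd : 0 <= K * dec x) by nra.
  assert (E1 : K * e * dec x <= K * dec x) by nra.
  assert (BH : Rabs (H x) <= 2 * (K * dec x)).
  { eapply Rle_trans; [exact (Rabs_near _ _ _ _ B E)|lra]. }
  split.
  - replace (H x ^ 2 - H0 x ^ 2) with ((H x - H0 x) * (H x + H0 x)) by ring. rewrite Rabs_mult.
    apply Rle_trans with ((K * e * dec x) * (3 * (K * dec x))); [|right; ring].
    apply Rmult_le_compat; auto using Rabs_pos. eapply Rle_trans; [apply Rabs_triang|]. lra.
  - rewrite <- pow2_abs. replace (4 * K ^ 2 * (dec x * dec x)) with ((2 * (K * dec x)) ^ 2) by ring.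
    apply pow_incr. split; [apply Rabs_pos|exact BH].
Qed.

(** Weight 1 gives the norm and weight [x^2] the second moment; two factors [dec] decay fast enough
    for either. *)
Lemma energy_diff (w H H0 : R -> R) K e : 0 <= K -> 0 <= e <= 1 -> cont w -> cont H -> cont H0 ->
  (forall x, w x = 1) \/ (forall x, w x = x ^ 2) ->
  (forall x, Rabs (H0 x) <= K * dec x) -> (forall x, Rabs (H x - H0 x) <= K * e * dec x) ->
  absint (fun x => w x * H x ^ 2) (4 * K ^ 2 * PI) /\
  Rabs (RIntR (fun x => w x * H x ^ 2) - RIntR (fun x => w x * H0 x ^ 2)) <= 3 * K ^ 2 * e * PI.
Proof.
  intros HK He Cw CH CH0 Hw B E.
  assert (W : forall x a, 0 <= a -> Rabs (w x) * (a * (dec x * dec x)) <= a / (1 + x ^ 2)).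
  { intros x a Ha. destruct (dec_to_cauchy2 x a Ha) as [W1 W2].
    destruct Hw as [->| ->]; [rewrite Rabs_R1; lra|].
    rewrite (Rabs_pos_eq (x ^ 2)) by apply pow2_ge_0. exact W2. }
  assert (A : forall F, cont F -> (forall x, Rabs (F x - H0 x) <= K * e * dec x) ->
    absint (fun x => w x * F x ^ 2) (4 * K ^ 2 * PI)).
  { intros F CF EF. apply absint_decay; [cont_tac|]. intros x. rewrite Rabs_mult.
    eapply Rle_trans; [|apply (W x); nra]. apply Rmult_le_compat_l; [apply Rabs_pos|].
    rewrite (Rabs_pos_eq (F x ^ 2)) by apply pow2_ge_0.
    apply (sq_diff_dec F H0 K e x); auto. }
  assert (A0 : absint (fun x => w x * H0 x ^ 2) (4 * K ^ 2 * PI)).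
  { apply A; [exact CH0|]. intros x. rewrite Rminus_diag, Rabs_R0. assert (D := dec_pos x).
    apply Rmult_le_pos; [apply Rmult_le_pos|]; lra. }
  split; [now apply A|].
  assert (I := is_intR_minus _ _ _ _ (absint_ex _ _ (A H CH E)) (absint_ex _ _ A0)).
  refine (is_intR_abs_le _ _ _ _ I). apply absint_decay; [cont_tac|].
  intros x. rewrite <- Rmult_minus_distr_l, Rabs_mult.
  eapply Rle_trans; [|apply (W x); nra]. apply Rmult_le_compat_l; [apply Rabs_pos|].
  apply (sq_diff_dec H H0 K e x); auto.
Qed.

Lemma trig_transform (c : R -> R) H K : c = cos \/ c = sin -> 0 <= K -> cont H ->
  (forall x, Rabs (H x) <= K * dec x) ->
  cont (trig_int c H) /\
  absint (fun s => trig_int c H s ^ 2) (10 * PI * (K ^ 2 * PI)) /\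
  (forall s, is_intR (fun w => H w * c (s * w)) (trig_int c H s)).
Proof.
  intros Hc HK CH B.
  assert (Bs := bessel H K HK CH B). destruct (trig_facts c Hc) as [Cc [Bc _]].
  assert (CT := cont_trig_int c H K Hc HK CH B). split; [exact CT|split].
  - apply (absint_dom _ _ _ (cont_pow _ 2 CT) Bs). intros s. rewrite Rabs_pos_eq by apply pow2_ge_0.
    assert (Q := pow2_ge_0 (trig_int cos H s)). assert (Q' := pow2_ge_0 (trig_int sin H s)).
    destruct Hc as [-> | ->]; lra.
  - intros s. apply (absint_ex _ (K * PI)), (trig_absint H K c s HK CH Cc Bc).
    intros x. eapply Rle_trans; [apply B|now apply decay4_decay2].
Qed.

(* [|a^2 - b^2| <= (a-b)^2 / (2e) + e (a+b)^2 / 2], integrated with Bessel's inequality on both terms. *)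
Lemma trig_energy_diff (c : R -> R) H H0 K e : c = cos \/ c = sin -> 0 <= K -> 0 < e <= 1 -> cont H -> cont H0 ->
  (forall x, Rabs (H0 x) <= K * dec x) -> (forall x, Rabs (H x - H0 x) <= K * e * dec x) ->
  Rabs (RIntR (fun s => trig_int c H s ^ 2)
      - RIntR (fun s => trig_int c H0 s ^ 2)) <= 50 * PI ^ 2 * K ^ 2 * e.
Proof.
  intros Hc HK He CH CH0 B0 E.
  assert (D := dec_pos).
  assert (Ke : forall x, K * e * dec x <= K * dec x).
  { intros x. apply Rmult_le_compat_r; [left; apply D|]. nra. }
  assert (Bp : forall x, Rabs (H x + H0 x) <= (3 * K) * dec x).
  { intros x. replace (H x + H0 x) with ((H x - H0 x) + 2 * H0 x) by ring.
    eapply Rle_trans; [apply Rabs_triang|]. rewrite Rabs_mult, (Rabs_pos_eq 2) by lra.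
    specialize (E x). specialize (B0 x). specialize (Ke x). lra. }
  assert (B : forall x, Rabs (H x) <= (2 * K) * dec x).
  { intros x. specialize (Ke x). eapply Rle_trans; [exact (Rabs_near _ _ _ _ (B0 x) (E x))|lra]. }
  destruct (trig_transform c H (2 * K) Hc ltac:(lra) CH B) as [C1 [A1 I1]].
  destruct (trig_transform c H0 K Hc HK CH0 B0) as [C0 [A0 I0]].
  destruct (trig_transform c (fun x => H x + H0 x) (3 * K) Hc ltac:(lra) ltac:(apply cont_plus; assumption) Bp) as [Cp [Ap Ip]].
  destruct (trig_transform c (fun x => H x - H0 x) (K * e) Hc ltac:(nra) ltac:(apply cont_minus; assumption) E) as [Cm [Am Im]].
  set (T := trig_int c H) in *.
  set (T0 := trig_int c H0) in *.
  assert (Ep : forall s, trig_int c (fun w => H w + H0 w) s = T s + T0 s).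
  { intros s. apply (RIntR_ext _ (fun w => H w * c (s * w) + H0 w * c (s * w))); [intros; ring|].
    apply is_intR_plus; [apply I1|apply I0]. }
  assert (Em : forall s, trig_int c (fun w => H w - H0 w) s = T s - T0 s).
  { intros s. apply (RIntR_ext _ (fun w => H w * c (s * w) - H0 w * c (s * w))); [intros; ring|].
    apply is_intR_minus; [apply I1|apply I0]. }
  assert (I := is_intR_minus _ _ _ _ (absint_ex _ _ A1) (absint_ex _ _ A0)).
  refine (is_intR_abs_le _ _ _ _ I).
  assert (As := absint_plus _ _ _ _ (absint_scal (/ (2 * e)) _ _ Am) (absint_scal (e / 2) _ _ Ap)).
  (* In units of [PI^2 K^2 e], the difference, with Bessel constant [K * e], contributes 5 and the
     sum, with constant [3 * K], contributes 45. *)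
  replace (50 * PI ^ 2 * K ^ 2 * e) with
    (Rabs (/ (2 * e)) * (10 * PI * ((K * e) ^ 2 * PI)) + Rabs (e / 2) * (10 * PI * ((3 * K) ^ 2 * PI))).
  - apply (absint_dom _ _ _ (cont_minus _ _ (cont_pow _ 2 C1) (cont_pow _ 2 C0)) As).
    intros s. rewrite Ep, Em. set (a := T s). set (b := T0 s).
    assert (Q1 : a ^ 2 - b ^ 2 = (a - b) * (a + b)) by ring.
    assert (Q2 : 0 <= / (2 * e) * ((a - b) - e * (a + b)) ^ 2).
    { apply Rmult_le_pos; [left; apply Rinv_0_lt_compat; lra|apply pow2_ge_0]. }
    assert (Q3 : 0 <= / (2 * e) * ((a - b) + e * (a + b)) ^ 2).
    { apply Rmult_le_pos; [left; apply Rinv_0_lt_compat; lra|apply pow2_ge_0]. }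
    assert (Q4 : / (2 * e) * ((a - b) - e * (a + b)) ^ 2 = / (2 * e) * (a - b) ^ 2 + e / 2 * (a + b) ^ 2 - (a - b) * (a + b)) by (field; lra).
    assert (Q5 : / (2 * e) * ((a - b) + e * (a + b)) ^ 2 = / (2 * e) * (a - b) ^ 2 + e / 2 * (a + b) ^ 2 + (a - b) * (a + b)) by (field; lra).
    rewrite Q1. apply Rabs_le. lra.
  - rewrite !Rabs_pos_eq; [field; lra|lra|left; apply Rinv_0_lt_compat; lra].
Qed.

Lemma is_lim_dec (f : R -> R) K : (forall x, Rabs (f x) <= K * dec x) ->
  is_lim f p_infty 0 /\ is_lim f m_infty 0.
Proof.
  intros B.
  assert (Main : forall eps : posreal, exists M, forall x, M < Rabs x -> Rabs (f x - 0) < eps).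
  { intros eps. exists (Rabs K / eps + 1). intros x Hx. rewrite Rminus_0_r.
    assert (He := cond_pos eps). assert (HK := Rabs_pos K).
    eapply Rle_lt_trans; [apply B|].
    apply Rle_lt_trans with (Rabs K * / (1 + x ^ 2)).
    - apply Rle_trans with (Rabs K * dec x).
      + apply Rmult_le_compat_r; [left; apply dec_pos|apply Rle_abs].
      + apply Rmult_le_compat_l; [lra|apply dec_le_cauchy].
    - assert (Hw := cauchy_weight_pos x).
      apply Rmult_lt_reg_r with (1 + x ^ 2); [lra|]. rewrite Rmult_assoc, Rinv_l, Rmult_1_r by lra.
      rewrite <- (pow2_abs x) in *.
      assert (E : eps * (Rabs K / eps) = Rabs K) by (field; lra).
      assert (Rabs K / eps < 1 + Rabs x ^ 2) by nra. nra. }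
  split; apply is_lim_spec; intros eps; destruct (Main eps) as [M HM].
  - exists (Rabs M). intros x Hx. apply HM. assert (H1 := Rle_abs M). assert (H2 := Rle_abs x). lra.
  - exists (- Rabs M). intros x Hx. apply HM. assert (H1 := Rle_abs M). assert (H2 := Rle_abs (- x)).
    rewrite Rabs_Ropp in H2. lra.
Qed.

(** Integration by parts, with boundary terms that vanish by decay. It trades the factor [s] for a
    derivative, so that the second moment in time becomes an energy of the transform of [G']. *)
Lemma transform_by_parts (G G' : R -> R) K : 0 <= K -> (forall x, is_derive G x (G' x)) -> cont G' ->
  (forall x, Rabs (G x) <= K * dec x) -> (forall x, Rabs (G' x) <= K * dec x) ->
  forall s, s * trig_int cos G s = - trig_int sin G' s.
Proof.
  intros HK D C B B' s.
  assert (CG := cont_derivable _ _ D).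
  destruct (trig_transform cos G K (or_introl eq_refl) HK CG B) as [_ [_ I1]].
  destruct (trig_transform sin G' K (or_intror eq_refl) HK C B') as [_ [_ I2]].
  assert (I := is_intR_plus _ _ _ _ (is_intR_scal s _ _ (I1 s)) (I2 s)).
  assert (Z : is_intR (fun w => s * (G w * cos (s * w)) + G' w * sin (s * w)) 0).
  { assert (Bs : forall w, Rabs (G w * sin (s * w)) <= K * dec w).
    { intros w. rewrite Rabs_mult, <- (Rmult_1_r (K * dec w)).
      apply Rmult_le_compat; auto using Rabs_pos, Rabs_sin_le. }
    destruct (is_lim_dec (fun w => G w * sin (s * w)) K Bs) as [L1 L2].
    apply (is_intR_primitive (fun w => G w * sin (s * w))); auto.
    - intros w. replace (s * (G w * cos (s * w)) + G' w * sin (s * w))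
        with (G' w * sin (s * w) + G w * (s * cos (s * w))) by ring.
      apply (is_derive_mult G (fun w => sin (s * w))); [apply D| |intros; apply Rmult_comm].
      auto_derive; [exact Logic.I|ring].
    - cont_tac. }
  assert (E1 := is_intR_RIntR _ _ I). assert (E2 := is_intR_RIntR _ _ Z). lra.
Qed.

Lemma Cmod_sq (z : C) : Cmod z ^ 2 = Re z ^ 2 + Im z ^ 2.
Proof. unfold Cmod, Re, Im. apply pow2_sqrt. assert (H := pow2_ge_0 (fst z)). assert (H' := pow2_ge_0 (snd z)). lra. Qed.

(** Common form of both wavelets, with [G] real and even: the phase is invisible to the modulus in
    frequency and translates by [1 / 2] in time. *)
Definition phased (G : R -> R) (w : R) : C := Cmult (cexpi (- w / 2)) (RtoC (G w)).

Lemma phased_Cmod G w : Cmod (phased G w) ^ 2 = G w ^ 2.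
Proof.
  rewrite Cmod_sq. unfold phased, cexpi, Cmult, RtoC, Re, Im; simpl.
  assert (H := sin2_cos2 (- w / 2)). unfold Rsqr in H.
  replace (G w * (G w * 1)) with (G w ^ 2 * (sin (- w / 2) * sin (- w / 2) + cos (- w / 2) * cos (- w / 2)))
    by (rewrite H; ring). ring.
Qed.

(** [G ^ 2] is even, so the centre is 0. Integrability comes from [energy_diff] applied to [G] and
    itself with [e = 0]. *)
Lemma radius2_freq (Psi : R -> C) G K : 0 <= K -> (forall w, Psi w = phased G w) -> cont G ->
  (forall x, G (- x) = G x) -> (forall x, Rabs (G x) <= K * dec x) ->
  radius2 Psi = RIntR (fun x => x ^ 2 * G x ^ 2) / RIntR (fun x => 1 * G x ^ 2).
Proof.
  intros HK HP CG Ev B.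
  assert (E0 : forall x, Rabs (G x - G x) <= K * 0 * dec x).
  { intros x. rewrite Rminus_diag, Rabs_R0. lra. }
  assert (C1 : cont (fun _ => 1)) by cont_tac. assert (C2 : cont (fun x => x ^ 2)) by cont_tac.
  destruct (energy_diff (fun _ => 1) G G K 0 HK ltac:(lra) C1 CG CG (or_introl (fun x => eq_refl)) B E0) as [A1 _].
  destruct (energy_diff (fun x => x ^ 2) G G K 0 HK ltac:(lra) C2 CG CG (or_intror (fun x => eq_refl)) B E0) as [A2 _].
  assert (HC : forall w, Cmod (Psi w) ^ 2 = G w ^ 2) by (intros w; rewrite HP; apply phased_Cmod).
  assert (L2 : L2sq Psi = RIntR (fun x => 1 * G x ^ 2)).
  { apply (RIntR_ext _ (fun x => 1 * G x ^ 2)); [intros x; rewrite HC; ring|now apply absint_ex in A1]. }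
  assert (A3 : absint (fun x => x * G x ^ 2) (4 * K ^ 2 * PI + 4 * K ^ 2 * PI)).
  { refine (absint_dom _ _ _ _ (absint_plus _ _ _ _ A1 A2) _); [cont_tac|]. intros x.
    rewrite Rabs_mult, (Rabs_pos_eq (G x ^ 2)), <- Rmult_plus_distr_r by apply pow2_ge_0.
    apply Rmult_le_compat_r; [apply pow2_ge_0|].
    rewrite <- (pow2_abs x). nra. }
  assert (Z : center Psi = 0).
  { unfold center. rewrite (RIntR_ext _ (fun x => x * G x ^ 2) 0).
    - unfold Rdiv; ring.
    - intros x. now rewrite HC.
    - assert (I := absint_ex _ _ A3).
      assert (Od : forall x, - x * G (- x) ^ 2 = - (x * G x ^ 2)) by (intros x; rewrite Ev; ring).
      assert (Z := is_intR_odd (fun x => x * G x ^ 2) _ (proj1 A3) Od I).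
      now rewrite Z in I. }
  unfold radius2. rewrite Z, L2. f_equal.
  apply (RIntR_ext _ (fun x => x ^ 2 * G x ^ 2)); [intros x; rewrite HC; ring|now apply absint_ex in A2].
Qed.

(** Once the phase is absorbed into the shift by [1 / 2], the imaginary part is the integral of an
    odd function. *)
Lemma inv_fourier_phased (Psi : R -> C) G K : 0 <= K -> (forall w, Psi w = phased G w) -> cont G ->
  (forall x, G (- x) = G x) -> (forall x, Rabs (G x) <= K * dec x) ->
  forall t, Cmod (inv_fourier Psi t) ^ 2 = (/ (2 * PI)) ^ 2 * trig_int cos G (t - / 2) ^ 2.
Proof.
  intros HK HP CG Ev B t.
  destruct (trig_transform cos G K (or_introl eq_refl) HK CG B) as [_ [_ I1]].
  destruct (trig_transform sin G K (or_intror eq_refl) HK CG B) as [_ [_ I2]].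
  specialize (I1 (t - / 2)). specialize (I2 (t - / 2)).
  assert (Hz : trig_int sin G (t - / 2) = 0).
  { refine (is_intR_odd _ _ _ _ I2); [cont_tac|]. intros x. rewrite Ev.
    replace ((t - / 2) * - x) with (- ((t - / 2) * x)) by ring. rewrite sin_neg. ring. }
  rewrite Hz in I2.
  assert (E : forall w, Cmult (Psi w) (cexpi (t * w)) = (G w * cos ((t - / 2) * w), G w * sin ((t - / 2) * w))).
  { intros w. rewrite HP. unfold phased, cexpi, Cmult, RtoC; simpl.
    replace ((t - / 2) * w) with (t * w + - w / 2) by field. rewrite cos_plus, sin_plus.
    f_equal; ring. }
  rewrite Cmod_sq. unfold inv_fourier, CIntR.
  assert (Er : forall w, Re (Cmult (Psi w) (cexpi (t * w))) = G w * cos ((t - / 2) * w)) by (intros w; now rewrite E).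
  assert (Ei : forall w, Im (Cmult (Psi w) (cexpi (t * w))) = G w * sin ((t - / 2) * w)) by (intros w; now rewrite E).
  rewrite (RIntR_ext _ _ _ Er I1), (RIntR_ext _ _ _ Ei I2).
  unfold Cmult, RtoC, Re, Im; simpl. ring.
Qed.

(** The modulus is symmetric about [1 / 2], which is therefore the centre. Integrability of [s T^2]
    follows from [|s| <= 1 + s^2] and [s^2 T^2 = S^2]; the normalization [k] cancels in the
    quotients. *)
Lemma radius2_time (Psi : R -> C) G G' K : 0 <= K -> (forall w, Psi w = phased G w) ->
  (forall x, is_derive G x (G' x)) -> cont G' -> (forall x, G (- x) = G x) ->
  (forall x, Rabs (G x) <= K * dec x) -> (forall x, Rabs (G' x) <= K * dec x) ->
  RIntR (fun s => trig_int cos G s ^ 2) <> 0 ->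
  radius2 (inv_fourier Psi) = RIntR (fun s => trig_int sin G' s ^ 2)
                              / RIntR (fun s => trig_int cos G s ^ 2).
Proof.
  intros HK HP D CG' Ev B B' Hnz. assert (CG := cont_derivable _ _ D). assert (HPI := PI_RGT_0).
  destruct (trig_transform cos G K (or_introl eq_refl) HK CG B) as [CT [AT _]].
  destruct (trig_transform sin G' K (or_intror eq_refl) HK CG' B') as [CS [AS _]].
  assert (HC := inv_fourier_phased Psi G K HK HP CG Ev B).
  assert (BP := transform_by_parts G G' K HK D CG' B B').
  set (T := trig_int cos G) in *.
  set (S := trig_int sin G') in *.
  set (k := (/ (2 * PI)) ^ 2) in *.
  assert (Hk : k <> 0) by (unfold k; apply pow_nonzero, Rinv_neq_0_compat; lra).
  assert (I0 := absint_ex _ _ AT).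
  assert (I2 := absint_ex _ _ AS).
  set (N := RIntR (fun s => T s ^ 2)) in *. set (W := RIntR (fun s => S s ^ 2)) in *.
  assert (E2 : forall s, S s ^ 2 = s ^ 2 * T s ^ 2).
  { intros s. replace (s ^ 2 * T s ^ 2) with ((s * T s) ^ 2) by ring. rewrite BP. ring. }
  assert (A1 : absint (fun s => s * T s ^ 2) (10 * PI * (K ^ 2 * PI) + 10 * PI * (K ^ 2 * PI))).
  { refine (absint_dom _ _ _ _ (absint_plus _ _ _ _ AT AS) _); [cont_tac|]. intros s.
    rewrite E2, Rabs_mult, (Rabs_pos_eq (T s ^ 2)) by apply pow2_ge_0.
    replace (T s ^ 2 + s ^ 2 * T s ^ 2) with ((1 + s ^ 2) * T s ^ 2) by ring.
    apply Rmult_le_compat_r; [apply pow2_ge_0|].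
    rewrite <- (pow2_abs s). nra. }
  assert (EvT : forall s, T (- s) = T s).
  { intros s. apply (RIntR_ext _ (fun w => G w * cos (s * w))).
    - intros w. rewrite <- cos_neg. f_equal. f_equal. ring.
    - apply (trig_transform cos G K (or_introl eq_refl) HK CG B). }
  assert (I1 := absint_ex _ _ A1).
  assert (Od : forall s, - s * T (- s) ^ 2 = - (s * T s ^ 2)) by (intros s; rewrite EvT; ring).
  assert (Z := is_intR_odd (fun s => s * T s ^ 2) _ (proj1 A1) Od I1). rewrite Z in I1.
  assert (Sh : forall f l, cont f -> is_intR f l -> is_intR (fun t => k * f (t - / 2)) (k * l)).
  { intros f l Cf If. apply (is_intR_scal k (fun t => f (t - / 2))). now apply is_intR_shift. }
  assert (L2 : L2sq (inv_fourier Psi) = k * N).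
  { apply (RIntR_ext _ (fun t => k * T (t - / 2) ^ 2)); [exact HC|].
    apply (Sh (fun s => T s ^ 2)); [cont_tac|exact I0]. }
  assert (Ct : center (inv_fourier Psi) = / 2).
  { unfold center. rewrite L2, (RIntR_ext _ (fun t => k * ((t - / 2) * T (t - / 2) ^ 2) + k * (/ 2 * T (t - / 2) ^ 2)) (k * 0 + k * (/ 2 * N))).
    - field. split; assumption.
    - intros t. rewrite HC. ring.
    - apply is_intR_plus.
      + apply (Sh (fun s => s * T s ^ 2)); [cont_tac|exact I1].
      + apply (Sh (fun s => / 2 * T s ^ 2)); [cont_tac|]. apply (is_intR_scal (/ 2) (fun s => T s ^ 2)). exact I0. }
  unfold radius2. rewrite Ct, L2.
  rewrite (RIntR_ext _ (fun t => k * S (t - / 2) ^ 2) (k * W)).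
  - field. split; assumption.
  - intros t. rewrite HC, E2. ring.
  - apply (Sh (fun s => S s ^ 2)); [cont_tac|exact I2].
Qed.

(** [A] and [eta] come from the limit [G0] alone. [x0] certifies that its norms are nonzero, and
    [eta] keeps the perturbed norms above half of them. *)
Lemma radii_near (G0 G0' : R -> R) K x0 : 1 <= K ->
  (forall x, is_derive G0 x (G0' x)) -> cont G0' ->
  (forall x, Rabs (G0 x) <= K * dec x) -> (forall x, Rabs (G0' x) <= K * dec x) ->
  (forall x, G0 (- x) = G0 x) -> (forall x, 0 <= G0 x) ->
  0 < G0 x0 ->
  exists A eta, 0 <= A /\ 0 < eta /\ forall e G G', 0 < e <= eta -> near dec K e G G' G0 G0' ->
    (forall x, G (- x) = G x) -> forall Psi Psi0,
    (forall w, Psi w = phased G w) -> (forall w, Psi0 w = phased G0 w) ->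
    Rabs (radius2 Psi - radius2 Psi0) <= A * e /\
    Rabs (radius2 (inv_fourier Psi) - radius2 (inv_fourier Psi0)) <= A * e.
Proof.
  intros HK D0 C0 B0 B0' Ev0 P0 Px0. assert (HPI := PI_RGT_0).
  set (N0 := RIntR (fun x => 1 * G0 x ^ 2)). set (V0 := RIntR (fun x => x ^ 2 * G0 x ^ 2)).
  set (T0 := trig_int cos G0).
  set (S0 := trig_int sin G0').
  set (n0 := RIntR (fun s => T0 s ^ 2)). set (v0 := RIntR (fun s => S0 s ^ 2)).
  set (A1 := 3 * K ^ 2 * PI). set (A2 := 50 * PI ^ 2 * K ^ 2).
  assert (HA1 : 0 < A1) by (unfold A1; apply Rmult_lt_0_compat; [assert (0 < K ^ 2) by (apply pow_lt; lra)|]; lra).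
  assert (HA2 : 0 < A2)
    by (unfold A2; apply Rmult_lt_0_compat; [assert (0 < PI ^ 2) by (apply pow_lt; lra); lra|apply pow_lt; lra]).
  (* Absolute values, because the positivity of [N0] and [n0] is established afterwards. *)
  set (eta := Rmin 1 (Rmin (Rabs N0 / (2 * A1)) (Rabs n0 / (2 * A2)))).
  assert (HA : forall a v n, 0 < a -> 0 < n -> 0 <= 2 * a / n * (1 + Rabs v / n)).
  { intros a v n Ha Hn. assert (H := Rabs_pos v).
    assert (0 <= 2 * a / n) by (apply Rdiv_le_0_compat; lra).
    assert (0 <= Rabs v / n) by (apply Rdiv_le_0_compat; lra).
    apply Rmult_le_pos; lra. }
  assert (CG0 := cont_derivable _ _ D0).
  assert (E0 : forall x, Rabs (G0 x - G0 x) <= K * 0 * dec x).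
  { intros x. rewrite Rminus_diag, Rabs_R0. lra. }
  assert (C1 : cont (fun _ => 1)) by cont_tac. assert (C2 : cont (fun x => x ^ 2)) by cont_tac.
  assert (HN0 : 0 < N0).
  { destruct (energy_diff (fun _ => 1) G0 G0 K 0 ltac:(lra) ltac:(lra) C1 CG0 CG0 (or_introl (fun x => eq_refl)) B0 E0) as [Ax _].
    apply (is_intR_pos (fun x => 1 * G0 x ^ 2) _ x0); [cont_tac| | |exact (absint_ex _ _ Ax)].
    - intros x. rewrite Rmult_1_l. apply pow2_ge_0.
    - rewrite Rmult_1_l. now apply pow_lt. }
  (* The transform at [s = 0] is the integral of [G0], positive because [G0 >= 0] and
     [G0 x0 > 0]. *)
  assert (Hn0 : 0 < n0).
  { destruct (trig_transform cos G0 K (or_introl eq_refl) ltac:(lra) CG0 B0) as [CT [AT IT]].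
    apply (is_intR_pos (fun s => T0 s ^ 2) _ 0); [exact (proj1 AT)| intros; apply pow2_ge_0 | |exact (absint_ex _ _ AT)].
    apply pow_lt. apply (is_intR_pos G0 _ x0); auto.
    apply (is_intR_ext (fun w => G0 w * cos (0 * w))); [|apply IT].
    intros w. rewrite Rmult_0_l, cos_0. ring. }
  set (Af := 2 * A1 / N0 * (1 + Rabs V0 / N0)). set (At := 2 * A2 / n0 * (1 + Rabs v0 / n0)).
  assert (HAf : 0 <= Af) by now apply HA. assert (HAt : 0 <= At) by now apply HA.
  exists (Af + At), eta. split; [lra|]. split.
  { unfold eta. rewrite !Rabs_pos_eq by lra. apply Rmin_pos; [lra|].
    apply Rmin_pos; apply Rdiv_lt_0_compat; lra. }
  intros e G G' [He He2] [D C _ _ _ _ E E'] Ev Psi Psi0 HP HP0.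
  assert (e <= 1) by (eapply Rle_trans; [exact He2|apply Rmin_l]).
  assert (Small : forall a n, 0 < a -> 0 < n -> e <= Rabs n / (2 * a) -> a * e <= n / 2).
  { intros a n Ha Hn Hle. rewrite Rabs_pos_eq in Hle by lra.
    apply Rle_trans with (a * (n / (2 * a))); [apply Rmult_le_compat_l; lra|right; field; lra]. }
  assert (S1 : A1 * e <= N0 / 2).
  { apply Small; auto. eapply Rle_trans; [exact He2|]. eapply Rle_trans; [apply Rmin_r|apply Rmin_l]. }
  assert (S2 : A2 * e <= n0 / 2).
  { apply Small; auto. eapply Rle_trans; [exact He2|]. eapply Rle_trans; [apply Rmin_r|apply Rmin_r]. }
  assert (CG := cont_derivable _ _ D).
  assert (Bnd : forall u u0 : R -> R, (forall x, Rabs (u0 x) <= K * dec x) -> (forall x, Rabs (u x - u0 x) <= K * e * dec x) ->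
    forall x, Rabs (u x) <= (2 * K) * dec x).
  { intros u u0 Bu Eu x. eapply Rle_trans; [exact (Rabs_near _ _ _ _ (Bu x) (Eu x))|].
    assert (Dp := dec_pos x). assert (K * e * dec x <= K * dec x) by (apply Rmult_le_compat_r; nra). lra. }
  assert (BG := Bnd G G0 B0 E). assert (BG' := Bnd G' G0' B0' E').
  destruct (energy_diff (fun _ => 1) G G0 K e ltac:(lra) ltac:(lra) C1 CG CG0 (or_introl (fun x => eq_refl)) B0 E) as [_ F1].
  destruct (energy_diff (fun x => x ^ 2) G G0 K e ltac:(lra) ltac:(lra) C2 CG CG0 (or_intror (fun x => eq_refl)) B0 E) as [_ F2].
  assert (F3 := trig_energy_diff cos G G0 K e (or_introl eq_refl) ltac:(lra) ltac:(lra) CG CG0 B0 E).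
  assert (F4 := trig_energy_diff sin G' G0' K e (or_intror eq_refl) ltac:(lra) ltac:(lra) C C0 B0' E').
  replace (3 * K ^ 2 * e * PI) with (A1 * e) in F1, F2 by (unfold A1; ring).
  change (Rabs (RIntR (fun s => trig_int cos G s ^ 2) - n0) <= A2 * e) in F3.
  split.
  - rewrite (radius2_freq Psi G (2 * K)), (radius2_freq Psi0 G0 K) by (auto; lra).
    apply Rle_trans with (Af * e); [|nra].
    apply ratio_bound; auto; lra.
  - rewrite (radius2_time Psi G G' (2 * K)), (radius2_time Psi0 G0 G0' K); auto; try lra.
    +
      apply Rle_trans with (At * e); [|nra]. apply ratio_bound; auto; lra.
    + change (n0 <> 0). lra.
    + apply Rabs_le_between in F3. lra.
Qed.

(** * The Meyer scaling function and mask *)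

(** Fermat's rule: the flat pieces of the scaling function and of the mask are where they take their
    extreme values, so their derivatives vanish there, endpoints included. *)
Lemma derive_at_max (f : R -> R) x l : is_derive f x l -> (forall y, f y <= f x) -> l = 0.
Proof.
  intros H M. apply is_derive_Reals in H.
  assert (E := deriv_maximum f (x - 1) (x + 1) x (exist _ l H)). simpl in E.
  apply E; try lra. intros; apply M.
Qed.

Lemma derive_at_min (f : R -> R) x l : is_derive f x l -> (forall y, f x <= f y) -> l = 0.
Proof.
  intros H M. apply is_derive_Reals in H.
  assert (E := deriv_minimum f (x - 1) (x + 1) x (exist _ l H)). simpl in E.
  apply E; try lra. intros; apply M.
Qed.

Record profile (theta : R -> R) : Prop := mk_profile {
  pr_odd : forall x, theta (- x) = - theta x;
  pr_d : forall x, is_derive theta x (Derive theta x);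
  pr_c : cont (Derive theta);
  pr_hi : forall x, PI / 3 <= x -> theta x = PI / 4;
  pr_lo : forall x, x <= - (PI / 3) -> theta x = - (PI / 4);
  pr_b : forall x, - (PI / 4) <= theta x <= PI / 4 }.

Lemma profile_intro theta : (forall x, theta (- x) = - theta x) ->
  (forall x y, x <= y -> theta x <= theta y) -> (forall x, ex_derive theta x) ->
  (forall x, ex_derive (Derive theta) x) -> (forall x, PI / 3 < x -> theta x = PI / 4) -> profile theta.
Proof.
  intros Hodd Hmono Hd1 Hd2 Hflat.
  (* At the endpoint monotonicity gives one inequality and continuity the other. *)
  assert (H3 : theta (PI / 3) = PI / 4).
  { apply Rle_antisym.
    - rewrite <- (Hflat (PI / 3 + 1)) by lra. apply Hmono. lra.
    - apply Rnot_lt_le. intros Hlt.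
      assert (Hc : continuous theta (PI / 3)) by (apply (@ex_derive_continuous R_AbsRing R_NormedModule); apply Hd1).
      destruct (Hc (fun y => y < PI / 4)) as [d Hd]; [now apply (open_lt (PI / 4))|].
      assert (Hd0 := cond_pos d).
      assert (Hb : ball (PI / 3) d (PI / 3 + d / 2)).
      { unfold ball; simpl; unfold AbsRing_ball, abs, minus, plus, opp; simpl. apply Rabs_def1; lra. }
      apply Hd in Hb. rewrite Hflat in Hb; lra. }
  assert (Hhi : forall x, PI / 3 <= x -> theta x = PI / 4).
  { intros x [Hx|Hx]; [now apply Hflat|now rewrite <- Hx]. }
  assert (Hlo : forall x, x <= - (PI / 3) -> theta x = - (PI / 4)).
  { intros x Hx. replace x with (- - x) by ring. rewrite Hodd, Hhi by lra. reflexivity. }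
  split; auto.
  - intros x. now apply Derive_correct.
  - intros x. apply (@ex_derive_continuous R_AbsRing R_NormedModule). apply Hd2.
  - intros x. split.
    + rewrite <- (Hlo (Rmin x (- (PI / 3)))) by apply Rmin_r. apply Hmono, Rmin_l.
    + rewrite <- (Hhi (Rmax x (PI / 3))) by apply Rmax_r. apply Hmono, Rmax_l.
Qed.

Definition hM (theta : R -> R) (w0 y : R) : R :=
  cos (PI / 4 + theta (PI / (3 * (PI - 2 * w0)) * (y - PI))).
Definition hM' (theta : R -> R) (w0 y : R) : R :=
  - sin (PI / 4 + theta (PI / (3 * (PI - 2 * w0)) * (y - PI)))
  * (PI / (3 * (PI - 2 * w0)) * Derive theta (PI / (3 * (PI - 2 * w0)) * (y - PI))).

(* [phiM_hat] equals the even extension [hM |w|]; written as a product it is visibly C^1, because [hM = 1] on [y <= 2 w0]. *)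
Definition phi0 theta w0 (w : R) : R := hM theta w0 w * hM theta w0 (- w).
Definition phi0' theta w0 (w : R) : R :=
  hM' theta w0 w * hM theta w0 (- w) + hM theta w0 w * (- hM' theta w0 (- w)).

Lemma hM_derive theta w0 : profile theta -> forall y, is_derive (hM theta w0) y (hM' theta w0 y).
Proof.
  intros P y. unfold hM, hM'. set (c := PI / (3 * (PI - 2 * w0))).
  replace (- sin (PI / 4 + theta (c * (y - PI))) * (c * Derive theta (c * (y - PI)))) with
    ((c * Derive theta (c * (y - PI))) * - sin (PI / 4 + theta (c * (y - PI)))) by ring.
  apply (is_derive_comp cos (fun y => PI / 4 + theta (c * (y - PI)))); [apply is_derive_cos|].
  replace (c * Derive theta (c * (y - PI))) with (0 + c * Derive theta (c * (y - PI))) by ring.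
  apply (is_derive_plus (fun _ => PI / 4) (fun y => theta (c * (y - PI)))).
  - apply derive_const.
  - apply (is_derive_comp theta (fun y => c * (y - PI))); [apply (pr_d _ P)|].
    auto_derive; [exact I|ring].
Qed.

Lemma hM_cont theta w0 : profile theta -> cont (hM' theta w0).
Proof.
  intros P. assert (C1 := pr_c _ P). assert (C0 := cont_derivable _ _ (pr_d _ P)).
  unfold hM'. cont_tac.
Qed.

Lemma phi0_C1 theta w0 : profile theta ->
  (forall w, is_derive (phi0 theta w0) w (phi0' theta w0 w)) /\ cont (phi0' theta w0).
Proof.
  intros P. assert (D := hM_derive theta w0 P). assert (C := hM_cont theta w0 P).
  assert (C0 := cont_derivable _ _ D). split.
  - intros w. apply (is_derive_mult (hM theta w0) (fun w => hM theta w0 (- w))).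
    + apply D.
    + replace (- hM' theta w0 (- w)) with (-1 * hM' theta w0 (- w)) by ring.
      apply (is_derive_comp (hM theta w0) (fun w => - w)); [apply D|]. auto_derive; [exact I|ring].
    + intros; apply Rmult_comm.
  - unfold phi0'. cont_tac.
Qed.

(** The affine argument of [theta] maps the transition band from [2 * w0] to [2 * PI - 2 * w0] onto
    [[-PI / 3, PI / 3]]. As [theta] is odd, the angles at [y] and [2 * PI - y] are complementary,
    hence the sum of squares. *)
Lemma hM_values theta w0 : profile theta -> PI / 3 <= w0 < PI / 2 ->
  (forall y, y <= 2 * w0 -> hM theta w0 y = 1) /\
  (forall y, 2 * PI - 2 * w0 <= y -> hM theta w0 y = 0) /\
  (forall y, 0 <= hM theta w0 y <= 1) /\
  (forall y, hM theta w0 y ^ 2 + hM theta w0 (2 * PI - y) ^ 2 = 1).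
Proof.
  intros P Hw. unfold hM.
  assert (Ec : PI / (3 * (PI - 2 * w0)) * (PI - 2 * w0) = PI / 3) by (field; lra).
  set (c := PI / (3 * (PI - 2 * w0))) in *.
  split; [|split; [|split]].
  - intros y Hy. rewrite (pr_lo _ P) by nra. replace (PI / 4 + - (PI / 4)) with 0 by ring. apply cos_0.
  - intros y Hy. rewrite (pr_hi _ P) by nra. replace (PI / 4 + PI / 4) with (PI / 2) by field. apply cos_PI2.
  - intros y. assert (B := pr_b _ P (c * (y - PI))). split.
    + apply cos_ge_0; lra.
    + apply COS_bound.
  - intros y. replace (c * (2 * PI - y - PI)) with (- (c * (y - PI))) by ring. rewrite (pr_odd _ P).
    replace (PI / 4 + - theta (c * (y - PI))) with (PI / 2 - (PI / 4 + theta (c * (y - PI)))) by field.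
    rewrite cos_shift. assert (E := sin2_cos2 (PI / 4 + theta (c * (y - PI)))). unfold Rsqr in E. lra.
Qed.

Lemma phi0_even theta w0 w : phi0 theta w0 (- w) = phi0 theta w0 w.
Proof. unfold phi0. rewrite Ropp_involutive. ring. Qed.

Lemma phi0_abs theta w0 w : profile theta -> PI / 3 <= w0 < PI / 2 ->
  phi0 theta w0 w = hM theta w0 (Rabs w).
Proof.
  intros P Hw. destruct (hM_values theta w0 P Hw) as [H1 _].
  unfold phi0, Rabs. destruct Rcase_abs.
  - rewrite (H1 w) by lra. ring.
  - rewrite (H1 (- w)) by lra. ring.
Qed.

Lemma phiM_hat_phi0 theta w0 w : profile theta -> PI / 3 <= w0 < PI / 2 ->
  phiM_hat theta w0 w = phi0 theta w0 w.
Proof.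
  intros P Hw. destruct (hM_values theta w0 P Hw) as [H1 [H2 _]].
  rewrite phi0_abs by assumption. unfold phiM_hat.
  destruct Rle_dec; [symmetry; apply H1; lra|]. destruct Rle_dec; [reflexivity|].
  symmetry. apply H2. lra.
Qed.

(** Since [w0 >= PI / 3], the plateau up to [2 * w0] and the support up to [2 * PI - 2 * w0] obey
    bounds free of [w0]. The derivatives vanish because 1 and 0 are extreme values. *)
Lemma phi0_values theta w0 : profile theta -> PI / 3 <= w0 < PI / 2 ->
  (forall w, Rabs w <= 2 * PI / 3 -> phi0 theta w0 w = 1 /\ phi0' theta w0 w = 0) /\
  (forall w, 4 * PI / 3 <= Rabs w -> phi0 theta w0 w = 0 /\ phi0' theta w0 w = 0) /\
  (forall w, 0 <= phi0 theta w0 w <= 1).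
Proof.
  intros P Hw. destruct (hM_values theta w0 P Hw) as [H1 [H2 [H3 _]]].
  destruct (phi0_C1 theta w0 P) as [D _].
  assert (Bd : forall w, 0 <= phi0 theta w0 w <= 1) by (intros w; rewrite phi0_abs by assumption; apply H3).
  split; [|split; [|exact Bd]].
  - intros w Hx. assert (E : phi0 theta w0 w = 1) by (rewrite phi0_abs by assumption; apply H1; lra).
    split; [exact E|]. apply (derive_at_max _ w _ (D w)). intros y. rewrite E. apply Bd.
  - intros w Hx. assert (E : phi0 theta w0 w = 0) by (rewrite phi0_abs by assumption; apply H2; lra).
    split; [exact E|]. apply (derive_at_min _ w _ (D w)). intros y. rewrite E. apply Bd.
Qed.

Lemma turns_unique x z : - PI <= x - 2 * PI * IZR z < PI -> turns x = z.
Proof.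
  intros H. symmetry. apply Int_part_spec.
  assert (E : x + PI = 2 * PI * ((x + PI) / (2 * PI))) by (field; lra).
  set (q := (x + PI) / (2 * PI)) in *. nra.
Qed.

Lemma turns_period x : turns (x + 2 * PI) = (turns x + 1)%Z.
Proof.
  apply turns_unique. rewrite plus_IZR. assert (H := turns_spec x). lra.
Qed.

Definition wrap (x : R) : R := x - 2 * PI * IZR (turns x).

Lemma wrap_period x : wrap (x + 2 * PI) = wrap x.
Proof. unfold wrap. rewrite turns_period, plus_IZR. ring. Qed.

Lemma periodic_wrap (f : R -> R) x : (forall x, f (x + 2 * PI) = f x) -> f (wrap x) = f x.
Proof.
  intros H. rewrite <- (periodic_IZR f H (turns x) (wrap x)). f_equal. unfold wrap. ring.
Qed.

(** As [4 PI / 3 > PI], the interval of agreement overlaps its translates, and every representative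
    in [[-PI, PI)] is interior to it. *)
Lemma periodic_C1 (f g g' : R -> R) : (forall x, f (x + 2 * PI) = f x) ->
  (forall x, Rabs x < 4 * PI / 3 -> f x = g x) -> (forall x, is_derive g x (g' x)) -> cont g' ->
  (forall x, is_derive f x (g' (wrap x))) /\ cont (fun x => g' (wrap x)).
Proof.
  intros Hp Hfg Hd Hc.
  assert (Loc : forall y, Rabs y < 4 * PI / 3 -> locally y (fun z => Rabs z < 4 * PI / 3)).
  { intros y Hy. apply (continuous_Rabs y (fun u => u < 4 * PI / 3)). now apply (open_lt (4 * PI / 3)). }
  assert (Wr : forall x, Rabs (wrap x) < 4 * PI / 3).
  { intros x. assert (H := turns_spec x). fold (wrap x) in H. apply Rabs_def1; lra. }
  assert (Near : forall y, Rabs y < 4 * PI / 3 -> is_derive f y (g' y)).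
  { intros y Hy. apply (is_derive_ext_loc g); [|apply Hd].
    apply (filter_imp (fun z => Rabs z < 4 * PI / 3)); [intros z Hz; symmetry; now apply Hfg|now apply Loc]. }
  assert (Shift : forall z t, f (t - 2 * PI * IZR z) = f t).
  { intros z t. rewrite <- (periodic_IZR f Hp z (t - 2 * PI * IZR z)). f_equal. ring. }
  assert (D : forall x, is_derive f x (g' (wrap x))).
  { intros x. apply (is_derive_ext (fun t => f (t - 2 * PI * IZR (turns x)))); [intros; apply Shift|].
    replace (g' (wrap x)) with (1 * g' (wrap x)) by ring.
    apply (is_derive_comp f (fun t => t - 2 * PI * IZR (turns x))); [apply Near, Wr|].
    auto_derive; [exact I|ring]. }
  split; [exact D|].
  (* On the overlap [g' (wrap y)] and [g' y] are both the derivative of [f], which removes the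
     apparent jump of [wrap] at the seam. *)
  assert (Same : forall y, Rabs y < 4 * PI / 3 -> g' (wrap y) = g' y).
  { intros y Hy. rewrite <- (is_derive_unique _ _ _ (D y)). apply is_derive_unique. now apply Near. }
  assert (CN : forall y, Rabs y < 4 * PI / 3 -> continuous (fun x => g' (wrap x)) y).
  { intros y Hy. apply (continuous_ext_loc _ g'); [|apply Hc].
    apply (filter_imp (fun z => Rabs z < 4 * PI / 3)); [intros z Hz; symmetry; now apply Same|now apply Loc]. }
  intros x.
  assert (PW : forall t, g' (wrap (t + 2 * PI)) = g' (wrap t)) by (intros; now rewrite wrap_period).
  apply (continuous_ext (fun t => g' (wrap (t - 2 * PI * IZR (turns x))))).
  - intros t. rewrite <- (periodic_IZR (fun t => g' (wrap t)) PW (turns x) (t - 2 * PI * IZR (turns x))).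
    f_equal. f_equal. ring.
  - apply (continuous_comp (fun t => t - 2 * PI * IZR (turns x)) (fun t => g' (wrap t))).
    + apply (cont_minus (fun t => t) (fun _ => 2 * PI * IZR (turns x))); cont_tac.
    + apply CN. apply Wr.
Qed.

Lemma mM_period theta w0 x : mM theta w0 (x + 2 * PI) = mM theta w0 x.
Proof.
  unfold mM. fold (turns (x + 2 * PI)) (turns x). fold (wrap (x + 2 * PI)) (wrap x).
  now rewrite wrap_period.
Qed.

(** Wrapping changes [x] only if [|x| >= PI], and then both arguments of [phi0] have modulus at
    least [4 PI / 3], where it vanishes. *)
Lemma mM_local theta w0 x : profile theta -> PI / 3 <= w0 < PI / 2 -> Rabs x < 4 * PI / 3 ->
  mM theta w0 x = phi0 theta w0 (2 * x).
Proof.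
  intros P Hw Hx.
  destruct (phi0_values theta w0 P Hw) as [_ [Z _]].
  unfold mM. fold (turns x). rewrite phiM_hat_phi0 by assumption.
  apply Rabs_def2 in Hx.
  assert (Cs : forall z, IZR z = 1 \/ IZR z = -1 -> - PI <= x - 2 * PI * IZR z < PI -> PI <= Rabs x ->
    phi0 theta w0 (2 * (x - 2 * PI * IZR (turns x))) = phi0 theta w0 (2 * x)).
  { intros z Hz Hr Hx1. rewrite (turns_unique x z Hr).
    destruct (Z (2 * (x - 2 * PI * IZR z))) as [-> _].
    - rewrite Rabs_mult, (Rabs_pos_eq 2) by lra. revert Hx1. unfold Rabs. repeat destruct Rcase_abs; destruct Hz as [Hz|Hz]; rewrite Hz in *; lra.
    - destruct (Z (2 * x)) as [-> _]; [|reflexivity]. rewrite Rabs_mult, (Rabs_pos_eq 2); lra. }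
  destruct (Rle_dec PI x) as [H1|H1]; [|destruct (Rlt_dec x (- PI)) as [H2|H2]].
  - apply (Cs 1%Z); [now left|lra|rewrite Rabs_pos_eq; lra].
  - apply (Cs (-1)%Z); [now right|lra|rewrite Rabs_left; lra].
  - rewrite (turns_unique x 0%Z) by lra. f_equal. ring.
Qed.

Definition mM' theta w0 (x : R) : R := 2 * phi0' theta w0 (2 * wrap x).

Lemma mM_C1 theta w0 : profile theta -> PI / 3 <= w0 < PI / 2 ->
  (forall x, is_derive (mM theta w0) x (mM' theta w0 x)) /\ cont (mM' theta w0).
Proof.
  intros P Hw. destruct (phi0_C1 theta w0 P) as [D C].
  apply (periodic_C1 (mM theta w0) (fun x => phi0 theta w0 (2 * x)) (fun x => 2 * phi0' theta w0 (2 * x))).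
  - apply mM_period.
  - intros; now apply mM_local.
  - intros x. apply (is_derive_comp (phi0 theta w0) (fun x => 2 * x)); [apply D|]. auto_derive; [exact I|ring].
  - cont_tac.
Qed.

Lemma mM_bound theta w0 x : profile theta -> PI / 3 <= w0 < PI / 2 -> 0 <= mM theta w0 x <= 1.
Proof.
  intros P Hw. destruct (phi0_values theta w0 P Hw) as [_ [_ B]].
  unfold mM. rewrite phiM_hat_phi0 by assumption. apply B.
Qed.

Lemma mM_even theta w0 x : profile theta -> PI / 3 <= w0 < PI / 2 -> mM theta w0 (- x) = mM theta w0 x.
Proof.
  intros P Hw.
  assert (Wr : Rabs (wrap x) < 4 * PI / 3).
  { assert (H := turns_spec x). fold (wrap x) in H. apply Rabs_def1; lra. }
  assert (E : mM theta w0 (- x) = mM theta w0 (- wrap x)).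
  { rewrite <- (periodic_IZR (mM theta w0) (mM_period theta w0) (- turns x) (- wrap x)).
    f_equal. unfold wrap. rewrite opp_IZR. ring. }
  rewrite E, <- (periodic_wrap (mM theta w0) x (mM_period theta w0)).
  rewrite !mM_local by (try assumption; rewrite ?Rabs_Ropp; assumption).
  replace (2 * - wrap x) with (- (2 * wrap x)) by ring. apply phi0_even.
Qed.

Lemma hsin2_period x : hsin2 (x + 2 * PI) = hsin2 x.
Proof. unfold hsin2. now rewrite cos_plus, cos_2PI, sin_2PI, Rmult_0_r, Rmult_1_r, Rminus_0_r. Qed.

Lemma cos_gt_mhalf x : Rabs x < 2 * PI / 3 -> - (1 / 2) < cos x.
Proof.
  intros H. assert (E : cos x = cos (Rabs x)).
  { unfold Rabs; destruct Rcase_abs; [now rewrite cos_neg|reflexivity]. }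
  rewrite E. assert (H0 := Rabs_pos x).
  replace (- (1 / 2)) with (cos (2 * (PI / 3))) by (rewrite cos_2a_cos, cos_PI3; field).
  apply cos_decreasing_1; lra.
Qed.

(** For the representative in [[-PI, PI)] the zone means modulus at least [2 PI / 3], and doubling
    leaves the support of [phi0]. The value 0 is a minimum, so the derivative vanishes too. *)
Lemma mM_zone theta w0 x : profile theta -> PI / 3 <= w0 < PI / 2 -> 3 / 4 <= hsin2 x ->
  mM theta w0 x = 0 /\ mM' theta w0 x = 0.
Proof.
  intros P Hw Hx.
  assert (E : mM theta w0 x = 0).
  { assert (Hy := turns_spec x). fold (wrap x) in Hy.
    rewrite <- (periodic_wrap hsin2 x hsin2_period) in Hx.
    rewrite <- (periodic_wrap _ x (mM_period theta w0)).
    rewrite mM_local by (try assumption; apply Rabs_def1; lra).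
    apply phi0_values; [assumption|assumption|].
    rewrite Rabs_mult, (Rabs_pos_eq 2) by lra.
    destruct (Rlt_le_dec (Rabs (wrap x)) (2 * PI / 3)) as [H|H]; [|lra].
    apply cos_gt_mhalf in H. unfold hsin2 in Hx. lra. }
  split; [exact E|]. destruct (mM_C1 theta w0 P Hw) as [D _].
  apply (derive_at_min _ x _ (D x)). intros y. rewrite E. now apply mM_bound.
Qed.

Lemma cont_bounded f a b : a <= b -> cont f -> exists B, forall x, a <= x <= b -> Rabs (f x) <= B.
Proof.
  intros Hab C. destruct (continuity_ab_maj (fun x => Rabs (f x)) a b Hab) as [m [Hm _]].
  - intros x _. apply continuity_pt_filterlim. apply (cont_abs f C).
  - exists (Rabs (f m)). exact Hm.
Qed.

Lemma mM'_bounded theta w0 : profile theta -> exists B, forall x, Rabs (mM' theta w0 x) <= B.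
Proof.
  intros P. destruct (phi0_C1 theta w0 P) as [_ C]. assert (HPI := PI_RGT_0).
  destruct (cont_bounded (fun x => 2 * phi0' theta w0 (2 * x)) (- PI) PI ltac:(lra) ltac:(cont_tac)) as [B HB].
  exists B. intros x. apply (HB (wrap x)). assert (H := turns_spec x). fold (wrap x) in H. lra.
Qed.

Lemma Series_head (a : nat -> R) : (forall k, (1 <= k)%nat -> a k = 0) -> Series a = a 0%nat.
Proof.
  intros H. assert (E : is_series a (a 0%nat)).
  { change (is_lim_seq (sum_n a) (a 0%nat)). apply (is_lim_seq_ext (fun _ => a 0%nat)); [|apply is_lim_seq_const].
    intros n. induction n as [|n IH]; [now rewrite sum_O|].
    rewrite sum_Sn, <- IH, (H (S n)) by lia. symmetry. apply Rplus_0_r. }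
  exact (is_series_unique _ _ E).
Qed.

(** For [y] in [[-PI, PI)] only the terms at [y] and at one neighbour, [y + 2 PI] or [y - 2 PI],
    survive; their moduli add up to [2 PI], which is the case covered by the last clause of
    [hM_values]. *)
Lemma phi0_orthonormal theta w0 : profile theta -> PI / 3 <= w0 < PI / 2 ->
  forall x, per (fun x => phi0 theta w0 x ^ 2) x = 1.
Proof.
  intros P Hw x. assert (HPI4 := PI_4).
  destruct (phi0_values theta w0 P Hw) as [_ [Z B]].
  destruct (hM_values theta w0 P Hw) as [_ [_ [_ Sq]]].
  set (f := fun x => phi0 theta w0 x ^ 2).
  assert (Zf : forall y, 4 * PI / 3 <= Rabs y -> f y = 0).
  { intros y Hy. unfold f. destruct (Z y Hy) as [-> _]. ring. }
  (* 40 exceeds [1 + (16 / 3)^2], where [16 / 3] bounds [4 PI / 3] through [PI <= 4]. *)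
  assert (Bf : forall y, Rabs (f y) <= 40 / (1 + y ^ 2)).
  { intros y. assert (Hy := cauchy_weight_pos y). destruct (Rle_dec (4 * PI / 3) (Rabs y)) as [H|H].
    - rewrite Zf, Rabs_R0 by exact H. apply Rdiv_le_0_compat; lra.
    - apply Rle_trans with 1.
      + unfold f. rewrite <- RPow_abs, <- (pow1 2). specialize (B y). rewrite Rabs_pos_eq by lra. apply pow_incr. lra.
      + apply Rmult_le_reg_r with (1 + y ^ 2); [lra|]. unfold Rdiv. rewrite Rmult_assoc, Rinv_l by lra.
        assert (H1 : Rabs y ^ 2 <= (16 / 3) ^ 2) by (apply pow_incr; assert (H2 := Rabs_pos y); lra).
        rewrite pow2_abs in H1. lra. }
  destruct (periodic_reduce (per f) (fun x => per_periodic f 40 x ltac:(lra) Bf) x) as [y [Hy ->]].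
  destruct (ex_series_shift f 40 y ltac:(lra) Bf) as [E1 _].
  assert (HK : forall k, (1 <= k)%nat -> 1 <= INR k) by (intros k Hk; now apply (le_INR 1)).
  unfold per. rewrite (Series_incr_1 _ E1).
  rewrite (Series_head (fun k => f (y + 2 * PI * INR (S k)))).
  2: { intros k Hk. apply Zf. rewrite S_INR. specialize (HK k Hk).
       eapply Rle_trans; [|apply Rle_abs]. nra. }
  rewrite (Series_head (fun k => f (y - 2 * PI * INR (S k)))).
  2: { intros k Hk. apply Zf. rewrite S_INR. specialize (HK k Hk). rewrite <- Rabs_Ropp.
       eapply Rle_trans; [|apply Rle_abs]. nra. }
  replace (y + 2 * PI * INR 0) with y by (simpl; ring).
  replace (y + 2 * PI * INR 1) with (y + 2 * PI) by (simpl; ring).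
  replace (y - 2 * PI * INR 1) with (y - 2 * PI) by (simpl; ring).
  destruct (Rle_dec 0 y) as [H|H].
  - rewrite (Zf (y + 2 * PI)) by (rewrite Rabs_pos_eq; lra). unfold f.
    rewrite !phi0_abs, (Rabs_pos_eq y), (Rabs_left1 (y - 2 * PI)) by (assumption || lra).
    replace (- (y - 2 * PI)) with (2 * PI - y) by ring. rewrite <- (Sq y). ring.
  - rewrite (Zf (y - 2 * PI)) by (rewrite Rabs_left1; lra). unfold f.
    rewrite !phi0_abs, (Rabs_left1 y), (Rabs_pos_eq (y + 2 * PI)) by (assumption || lra).
    rewrite <- (Sq (- y)). replace (2 * PI - - y) with (y + 2 * PI) by ring. ring.
Qed.

(** * The summation method *)

(** [real] sends an infinite least upper bound to 0; the bound [B] excludes that case. *)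
Lemma supnorm_bound (g : R -> R) B : (forall x, - PI <= x <= PI -> Rabs (g x) <= B) ->
  forall x, - PI <= x <= PI -> Rabs (g x) <= supnorm g.
Proof.
  intros HB x Hx. unfold supnorm. set (E := fun y => exists x, - PI <= x <= PI /\ y = Rabs (g x)).
  destruct (Lub_Rbar_correct E) as [H1 H2].
  assert (L1 : Rbar_le (Rabs (g x)) (Lub_Rbar E)) by (apply H1; exists x; auto).
  assert (L2 : Rbar_le (Lub_Rbar E) B).
  { apply H2. intros y [z [Hz ->]]. now apply HB. }
  destruct (Lub_Rbar E); simpl in *; [exact L1|contradiction|contradiction].
Qed.

Lemma RI_odd f a : cont f -> (forall x, f (- x) = - f x) -> RInt f (- a) a = 0.
Proof.
  intros C H. assert (E := RI_opp_arg f (- a) a C). rewrite Ropp_involutive in E.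
  rewrite (RI_ext _ (fun x => -1 * f x)) in E by (intros; rewrite H; ring).
  rewrite RI_scal in E by exact C. lra.
Qed.

Ltac eq_R := cbv beta; match goal with |- @eq _ ?a ?b => change (@eq R a b) end.

Lemma trig_sum_derive (a b : nat -> R) n w :
  is_derive (fun w => sum_n_m (fun k => a k * cos (INR k * w) + b k * sin (INR k * w)) 1 n) w
    (sum_n_m (fun k => INR k * b k * cos (INR k * w) - INR k * a k * sin (INR k * w)) 1 n).
Proof.
  induction n as [|n IH].
  - rewrite sum_n_m_zero by lia.
    apply (is_derive_ext (fun _ => 0)); [intros; now rewrite sum_n_m_zero by lia|].
    apply derive_const.
  - rewrite sum_n_Sm by lia.
    apply (is_derive_ext (fun w => plus (sum_n_m (fun k => a k * cos (INR k * w) + b k * sin (INR k * w)) 1 n)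
      (a (S n) * cos (INR (S n) * w) + b (S n) * sin (INR (S n) * w)))).
    { intros t. now rewrite sum_n_Sm by lia. }
    apply (is_derive_plus (K := R_AbsRing) (V := R_NormedModule)); [exact IH|].
    generalize (INR (S n)) (a (S n)) (b (S n)). intros r a1 b1. auto_derive; [exact I|ring].
Qed.

(** Integration by parts: the boundary terms cancel by [f (- PI) = f PI] with cosines and vanish by
    [sin (k PI) = 0] with sines. *)
Lemma fourier_derive (f f' : R -> R) k : (forall x, is_derive f x (f' x)) -> cont f' -> f (- PI) = f PI ->
  fa f' k = INR k * fb f k /\ fb f' k = - (INR k * fa f k).
Proof.
  intros D C Hp. assert (C0 := cont_derivable _ _ D).
  assert (S0 : sin (INR k * PI) = 0) by (apply sin_eq_0_1; exists (Z.of_nat k); now rewrite <- INR_IZR_INZ).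
  unfold fa, fb. split.
  - assert (E : @eq R (RInt (fun t => f' t * cos (INR k * t) - INR k * (f t * sin (INR k * t))) (- PI) PI) 0).
    { rewrite (RI_FTC (fun t => f t * cos (INR k * t))).
      - rewrite Hp. replace (INR k * - PI) with (- (INR k * PI)) by ring. rewrite cos_neg. ring.
      - intros x. replace (f' x * cos (INR k * x) - INR k * (f x * sin (INR k * x)))
          with (f' x * cos (INR k * x) + f x * (- (INR k * sin (INR k * x)))) by ring.
        apply (is_derive_mult f (fun t => cos (INR k * t))); [apply D| |intros; apply Rmult_comm].
        auto_derive; [exact I|ring].
      - cont_tac. }
    rewrite RI_minus, RI_scal in E by cont_tac.
    replace (RInt (fun t => f' t * cos (INR k * t)) (- PI) PI) with (INR k * RInt (fun t => f t * sin (INR k * t)) (- PI) PI) by lra.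
    ring.
  - assert (E : @eq R (RInt (fun t => f' t * sin (INR k * t) + INR k * (f t * cos (INR k * t))) (- PI) PI) 0).
    { rewrite (RI_FTC (fun t => f t * sin (INR k * t))).
      - rewrite Hp. replace (INR k * - PI) with (- (INR k * PI)) by ring. rewrite sin_neg, S0. ring.
      - intros x. replace (f' x * sin (INR k * x) + INR k * (f x * cos (INR k * x)))
          with (f' x * sin (INR k * x) + f x * (INR k * cos (INR k * x))) by ring.
        apply (is_derive_mult f (fun t => sin (INR k * t))); [apply D| |intros; apply Rmult_comm].
        auto_derive; [exact I|ring].
      - cont_tac. }
    rewrite RI_plus, RI_scal in E by cont_tac.
    replace (RInt (fun t => f' t * sin (INR k * t)) (- PI) PI) with (- (INR k * RInt (fun t => f t * cos (INR k * t)) (- PI) PI)) by lra.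
    ring.
Qed.

(* A multiplier method commutes with differentiation; the constant term disappears because [f] is periodic. *)
Lemma usum_derive lam n (f f' : R -> R) : (forall x, is_derive f x (f' x)) -> cont f' -> f (- PI) = f PI ->
  forall w, is_derive (usum lam n f) w (usum lam n f' w).
Proof.
  intros D C Hp w.
  assert (F := fun k => fourier_derive f f' k D C Hp).
  unfold usum. replace (fa f' 0) with 0 by (destruct (F 0%nat) as [-> _]; simpl; ring).
  apply (is_derive_plus (fun _ => fa f 0 / 2)).
  - unfold Rdiv. rewrite Rmult_0_l. apply derive_const.
  - apply (is_derive_ext (fun w => sum_n_m (fun k => (lam n k * fa f k) * cos (INR k * w) + (lam n k * fb f k) * sin (INR k * w)) 1 n)).
    { intros t. apply sum_n_m_ext. intros k. eq_R. ring. }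
    replace (sum_n_m _ 1 n) with (sum_n_m (fun k => INR k * (lam n k * fb f k) * cos (INR k * w) - INR k * (lam n k * fa f k) * sin (INR k * w)) 1 n).
    + apply trig_sum_derive.
    + apply sum_n_m_ext. intros k. destruct (F k) as [-> ->]. eq_R. ring.
Qed.

Lemma usum_period lam n f w : usum lam n f (w + 2 * PI) = usum lam n f w.
Proof.
  unfold usum. f_equal. apply sum_n_m_ext. intros k. f_equal. f_equal; f_equal.
  - replace (INR k * (w + 2 * PI)) with (INR k * w + 2 * INR k * PI) by ring. apply cos_period.
  - replace (INR k * (w + 2 * PI)) with (INR k * w + 2 * INR k * PI) by ring. apply sin_period.
Qed.

Lemma usum_even lam n f w : cont f -> (forall x, f (- x) = f x) -> usum lam n f (- w) = usum lam n f w.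
Proof.
  intros C H. unfold usum. f_equal. apply sum_n_m_ext. intros k.
  assert (E : fb f k = 0).
  { unfold fb. rewrite RI_odd; [ring|cont_tac|]. intros x. rewrite H.
    replace (INR k * - x) with (- (INR k * x)) by ring. rewrite sin_neg. ring. }
  rewrite E. replace (INR k * - w) with (- (INR k * w)) by ring. rewrite cos_neg. eq_R. ring.
Qed.

Lemma usum_cont lam n f : cont (usum lam n f).
Proof.
  apply cont_plus; [apply cont_const|].
  eapply cont_derivable. intros w.
  apply (is_derive_ext (fun w => sum_n_m (fun k => (lam n k * fa f k) * cos (INR k * w) + (lam n k * fb f k) * sin (INR k * w)) 1 n)).
  { intros t. apply sum_n_m_ext. intros k. eq_R. ring. }
  apply trig_sum_derive.
Qed.

Definition cpow (l : nat) (w : R) : R := cos (w / 2) ^ (2 * l).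
(** At [l = 0] the exponent truncates to 0, but [INR l] is 0 as well, so the formula is right for
    every [l]. *)
Definition cpow' (l : nat) (w : R) : R := - (INR l * sin (w / 2) * cos (w / 2) ^ (2 * l - 1)).

Lemma cos_half_sq w : cos (w / 2) ^ 2 = 1 - hsin2 w.
Proof. unfold hsin2. replace w with (2 * (w / 2)) at 2 by field. rewrite cos_2a_cos. field. Qed.

Lemma cpow_hsin2 l w : cpow l w = (1 - hsin2 w) ^ l.
Proof. unfold cpow. now rewrite pow_mult, cos_half_sq. Qed.

Lemma cpow_derive l w : is_derive (cpow l) w (cpow' l w).
Proof.
  replace (cpow' l w) with (INR (2 * l) * (- sin (w / 2) / 2) * cos (w / 2) ^ pred (2 * l)).
  - apply (is_derive_pow (fun w => cos (w / 2))). auto_derive; [exact I|]. unfold Rdiv. ring.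
  - unfold cpow'. rewrite mult_INR. change (INR 2) with 2. rewrite <- Nat.sub_1_r. field.
Qed.

Lemma cpow_cont l : cont (cpow l) /\ cont (cpow' l).
Proof.
  split; [exact (cont_derivable _ _ (cpow_derive l))|]. unfold cpow', Rdiv. cont_tac.
Qed.

Lemma pow_unit a n : 0 <= a <= 1 -> 0 <= a ^ n <= 1.
Proof.
  intros Ha. split; [apply pow_le; lra|]. assert (H := pow_incr a 1 n Ha). now rewrite pow1 in H.
Qed.

Lemma cpow_bound l w : 0 <= cpow l w <= 1.
Proof.
  rewrite cpow_hsin2. assert (H := hsin2_bound w). apply pow_unit. lra.
Qed.

(** [(1 - hsin2 w)^3] is the sixth power of the cosine. Differentiation leaves the exponent
    [2 * l - 1], which is at least 6 once [l >= 4]; the factor [INR l] is the one in [mu]. *)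
Lemma cpow_decay l w : (4 <= l)%nat -> cpow l w <= (1 - hsin2 w) ^ 3 /\ Rabs (cpow' l w) <= INR l * (1 - hsin2 w) ^ 3.
Proof.
  intros Hl. assert (H := hsin2_bound w).
  split.
  - rewrite cpow_hsin2. replace l with (3 + (l - 3))%nat by lia. rewrite pow_add.
    destruct (pow_unit (1 - hsin2 w) 3%nat ltac:(lra)), (pow_unit (1 - hsin2 w) (l - 3)%nat ltac:(lra)). nra.
  - unfold cpow'. rewrite Rabs_Ropp, !Rabs_mult, (Rabs_pos_eq (INR l)) by apply pos_INR.
    rewrite Rmult_assoc. apply Rmult_le_compat_l; [apply pos_INR|].
    assert (HS := Rabs_sin_le (w / 2)). assert (HC := Rabs_cos_le (w / 2)).
    assert (HC0 := Rabs_pos (cos (w / 2))).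
    replace (2 * l - 1)%nat with (2 * 3 + (2 * l - 7))%nat by lia.
    rewrite <- RPow_abs, pow_add, (pow_mult _ 2 3), pow2_abs, cos_half_sq.
    destruct (pow_unit (1 - hsin2 w) 3%nat ltac:(lra)). destruct (pow_unit (Rabs (cos (w / 2))) (2 * l - 7)%nat ltac:(lra)).
    set (x := (1 - hsin2 w) ^ 3) in *. set (y := Rabs (cos (w / 2)) ^ (2 * l - 7)) in *. set (s := Rabs (sin (w / 2))) in *.
    assert (0 <= x * y <= x) by nra. nra.
Qed.

Lemma hsin2_cont : cont hsin2.
Proof. unfold hsin2. unfold Rdiv. cont_tac. Qed.

(** The denominator vanishes only inside the zone, where [mM] is 0, so the identity survives
    division by 0. *)
Lemma mMl_mM theta w0 l w : profile theta -> PI / 3 <= w0 < PI / 2 ->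
  mM theta w0 w = cpow l w * mMl theta w0 l w.
Proof.
  intros P Hw. unfold mMl. fold (cpow l w).
  destruct (Req_dec (cpow l w) 0) as [E|E].
  - assert (Z : mM theta w0 w = 0); [|rewrite Z, E; unfold Rdiv; ring].
    apply mM_zone; auto. rewrite cpow_hsin2 in E.
    destruct (Req_dec (1 - hsin2 w) 0) as [H|H]; [lra|]. exfalso. now apply (pow_nonzero _ l H).
  - field. exact E.
Qed.

(** Two overlapping open sets cover the line: the quotient rule applies where [hsin2 < 1], and the
    function is identically 0 where [hsin2 > 3 / 4]. *)
Lemma mMl_C1 theta w0 l : profile theta -> PI / 3 <= w0 < PI / 2 ->
  (forall x, is_derive (mMl theta w0 l) x (Derive (mMl theta w0 l) x)) /\ cont (Derive (mMl theta w0 l)).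
Proof.
  intros P Hw. destruct (mM_C1 theta w0 P Hw) as [D C]. destruct (cpow_cont l) as [Cc Cc'].
  assert (C0 := cont_derivable _ _ D).
  set (q := fun x => (mM' theta w0 x * cpow l x - mM theta w0 x * cpow' l x) / cpow l x ^ 2).
  assert (Low : forall x, hsin2 x < 1 -> is_derive (mMl theta w0 l) x (q x)).
  { intros x Hx. apply (is_derive_div (mM theta w0) (cpow l)); [apply D|apply cpow_derive|].
    rewrite cpow_hsin2. apply pow_nonzero. lra. }
  assert (LowL : forall x, hsin2 x < 1 -> locally x (fun y => hsin2 y < 1)).
  { intros x Hx. apply (hsin2_cont x (fun u => u < 1)). now apply (open_lt 1). }
  assert (HighL : forall x, 3 / 4 < hsin2 x -> locally x (fun y => 3 / 4 < hsin2 y)).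
  { intros x Hx. apply (hsin2_cont x (fun u => 3 / 4 < u)). now apply (open_gt (3 / 4)). }
  assert (Zero : forall y, 3 / 4 < hsin2 y -> mMl theta w0 l y = 0).
  { intros y Hy. unfold mMl. destruct (mM_zone theta w0 y P Hw ltac:(lra)) as [-> _]. unfold Rdiv. ring. }
  assert (High : forall x, 3 / 4 < hsin2 x -> is_derive (mMl theta w0 l) x 0).
  { intros x Hx. apply (is_derive_ext_loc (fun _ => 0)).
    - apply (filter_imp (fun y => 3 / 4 < hsin2 y)); [intros y Hy; symmetry; now apply Zero|now apply HighL].
    - apply derive_const. }
  split.
  - intros x. apply Derive_correct. destruct (Rlt_le_dec (hsin2 x) 1) as [H|H].
    + eexists. now apply Low.
    + eexists. apply High. lra.
  - intros x. destruct (Rlt_le_dec (hsin2 x) 1) as [H|H].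
    + apply (continuous_ext_loc _ q).
      * apply (filter_imp (fun y => hsin2 y < 1)); [|now apply LowL].
        intros y Hy. symmetry. apply is_derive_unique. now apply Low.
      * apply (continuous_mult (fun x => mM' theta w0 x * cpow l x - mM theta w0 x * cpow' l x) (fun x => / cpow l x ^ 2)).
        -- apply (cont_minus (fun x => mM' theta w0 x * cpow l x) (fun x => mM theta w0 x * cpow' l x)); cont_tac.
        -- apply continuous_Rinv_comp; [apply (cont_pow (cpow l) 2 Cc)|].
           apply pow_nonzero. rewrite cpow_hsin2. apply pow_nonzero. lra.
    + apply (continuous_ext_loc _ (fun _ => 0)); [|apply continuous_const].
      apply (filter_imp (fun y => 3 / 4 < hsin2 y)); [|apply HighL; lra].
      intros y Hy. symmetry. apply is_derive_unique. now apply High.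
Qed.

Lemma cpow_period l x : cpow l (x + 2 * PI) = cpow l x.
Proof. rewrite !cpow_hsin2. now rewrite hsin2_period. Qed.
Lemma cpow_even l x : cpow l (- x) = cpow l x.
Proof. unfold cpow. replace (- x / 2) with (- (x / 2)) by field. now rewrite cos_neg. Qed.

Lemma mMl_period theta w0 l x : mMl theta w0 l (x + 2 * PI) = mMl theta w0 l x.
Proof. unfold mMl. fold (cpow l (x + 2 * PI)) (cpow l x). now rewrite cpow_period, mM_period. Qed.

Lemma mMl_even theta w0 l x : profile theta -> PI / 3 <= w0 < PI / 2 ->
  mMl theta w0 l (- x) = mMl theta w0 l x.
Proof. intros P Hw. unfold mMl. fold (cpow l (- x)) (cpow l x). now rewrite cpow_even, mM_even. Qed.

Lemma Derive_period (f : R -> R) : (forall x, ex_derive f x) -> (forall x, f (x + 2 * PI) = f x) ->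
  forall x, Derive f (x + 2 * PI) = Derive f x.
Proof.
  intros D H x. symmetry. apply is_derive_unique.
  apply (is_derive_ext (fun t => f (t + 2 * PI))); [exact H|].
  replace (Derive f (x + 2 * PI)) with (1 * Derive f (x + 2 * PI)) by ring.
  apply (is_derive_comp f (fun t => t + 2 * PI)); [apply Derive_correct, D|].
  auto_derive; [exact I|ring].
Qed.

Lemma supnorm_periodic (g : R -> R) : cont g -> (forall x, g (x + 2 * PI) = g x) ->
  forall x, Rabs (g x) <= supnorm g.
Proof.
  intros C H x. assert (HPI := PI_RGT_0).
  destruct (cont_bounded g (- PI) PI ltac:(lra) C) as [B HB].
  destruct (periodic_reduce g H x) as [y [Hy ->]]. apply (supnorm_bound g B HB). lra.
Qed.

Lemma approx_bounds theta w0 lam n l : profile theta -> PI / 3 <= w0 < PI / 2 ->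
  (forall x, Rabs (u_l theta w0 lam n l x - mMl theta w0 l x) <= alpha theta w0 lam n l) /\
  (forall x, Rabs (u1_l theta w0 lam n l x - Derive (mMl theta w0 l) x) <= gamma theta w0 lam n l) /\
  (forall x, is_derive (u_l theta w0 lam n l) x (u1_l theta w0 lam n l x)).
Proof.
  intros P Hw. destruct (mMl_C1 theta w0 l P Hw) as [D C].
  assert (C0 := cont_derivable _ _ D).
  assert (Per : mMl theta w0 l (- PI) = mMl theta w0 l PI).
  { rewrite <- mMl_period. f_equal. ring. }
  split; [|split].
  - apply (supnorm_periodic (fun w => u_l theta w0 lam n l w - mMl theta w0 l w)).
    + apply cont_minus; [apply usum_cont|exact C0].
    + intros x. unfold u_l. now rewrite usum_period, mMl_period.
  - apply (supnorm_periodic (fun w => u1_l theta w0 lam n l w - Derive (mMl theta w0 l) w)).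
    + apply cont_minus; [apply usum_cont|exact C].
    + intros x. unfold u1_l. rewrite usum_period, Derive_period; [reflexivity| |apply mMl_period].
      intros y. eexists. apply D.
  - intros x. now apply usum_derive.
Qed.

(** [C] depends on [theta] and [w0] alone, through a bound [B] for the derivative of the Meyer mask.
    The divided mask is 1 at 0, so [alpha <= 1 / 2] keeps the normalizing value [u_l 0] above
    [1 / 2]. *)
Lemma mask_near theta w0 : profile theta -> PI / 3 <= w0 < PI / 2 ->
  exists C, 1 <= C /\ forall lam n l, (4 <= l)%nat -> alpha theta w0 lam n l <= 1 / 2 ->
  exists m', (forall x, is_derive (m_l theta w0 lam n l) x (m' x)) /\ cont m' /\ m_l theta w0 lam n l 0 = 1 /\
    (forall x, m_l theta w0 lam n l (- x) = m_l theta w0 lam n l x) /\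
    (forall x, m_l theta w0 lam n l (x + 2 * PI) = m_l theta w0 lam n l x) /\
    (forall x, Rabs (m_l theta w0 lam n l x - mM theta w0 x) <= C * mu theta w0 lam n l) /\
    (forall x, Rabs (m' x - mM' theta w0 x) <= C * mu theta w0 lam n l) /\
    (forall x, 3 / 4 <= hsin2 x -> Rabs (m_l theta w0 lam n l x) <= C * mu theta w0 lam n l * (1 - hsin2 x) ^ 3
                               /\ Rabs (m' x) <= C * mu theta w0 lam n l * (1 - hsin2 x) ^ 3).
Proof.
  intros P Hw. destruct (mM'_bounded theta w0 P) as [B HB].
  assert (HB0 : 0 <= B) by (eapply Rle_trans; [apply Rabs_pos|apply (HB 0)]).
  exists (2 * B + 4). split; [lra|]. intros lam n l Hl Ha.
  destruct (approx_bounds theta w0 lam n l P Hw) as [A1 [A2 DU]].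
  destruct (mMl_C1 theta w0 l P Hw) as [Df Cf]. destruct (mM_C1 theta w0 P Hw) as [DM CM].
  destruct (cpow_cont l) as [Cc Cc'].
  set (f := mMl theta w0 l) in *. set (f' := Derive f) in *.
  set (u := u_l theta w0 lam n l) in *. set (u1 := u1_l theta w0 lam n l) in *.
  set (al := alpha theta w0 lam n l) in *. set (ga := gamma theta w0 lam n l) in *.
  set (M := mM theta w0) in *. set (M' := mM' theta w0) in *.
  assert (Hal : 0 <= al) by (eapply Rle_trans; [apply Rabs_pos|apply (A1 0)]).
  assert (Hga : 0 <= ga) by (eapply Rle_trans; [apply Rabs_pos|apply (A2 0)]).
  assert (HlR : 1 <= INR l) by (apply (le_INR 1); lia).
  set (mu0 := mu theta w0 lam n l). assert (Hmu : mu0 = INR l * al + ga) by reflexivity.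
  assert (Hamu : al <= mu0) by (rewrite Hmu; nra).
  assert (EM : forall x, M x = cpow l x * f x) by (intros; now apply mMl_mM).
  assert (EM' : forall x, M' x = cpow' l x * f x + cpow l x * f' x).
  { intros x. rewrite <- (is_derive_unique _ _ _ (DM x)). apply is_derive_unique.
    apply (is_derive_ext (fun y => cpow l y * f y)); [intros; symmetry; apply EM|].
    apply (is_derive_mult (cpow l) f); [apply cpow_derive|apply Df|intros; apply Rmult_comm]. }
  set (u0 := u 0).
  assert (C10 : cpow l 0 = 1) by (rewrite cpow_hsin2; unfold hsin2; rewrite cos_0; replace (1 - (1 - 1) / 2) with 1 by field; apply pow1).
  assert (F0 : f 0 = 1).
  { assert (E := EM 0). rewrite C10, Rmult_1_l in E. rewrite <- E. unfold M.
    rewrite mM_local by (try assumption; rewrite Rabs_R0; lra).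
    apply phi0_values; auto. rewrite Rmult_0_r, Rabs_R0. lra. }
  assert (Hu0 : Rabs (u0 - 1) <= al) by (rewrite <- F0; apply A1).
  assert (Hu0' : 1 / 2 <= u0) by (apply Rabs_le_between in Hu0; lra).
  assert (Hiu : 0 < / u0 <= 2).
  { split; [apply Rinv_0_lt_compat; lra|]. replace 2 with (/ (1 / 2)) by field. apply Rinv_le_contravar; lra. }
  set (m := m_l theta w0 lam n l).
  assert (Em : forall x, m x = cpow l x * u x / u0) by reflexivity.
  set (m' := fun x => (cpow' l x * u x + cpow l x * u1 x) / u0).
  assert (Cu : cont u) by apply usum_cont. assert (Cu1 : cont u1) by apply usum_cont.
  assert (Rel : forall x, m x * u0 - M x = cpow l x * (u x - f x)) by (intros x; rewrite Em, EM; field; lra).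
  assert (Rel' : forall x, m' x * u0 - M' x = cpow' l x * (u x - f x) + cpow l x * (u1 x - f' x))
    by (intros x; unfold m'; rewrite EM'; field; lra).
  assert (S3 : forall x, 0 <= (1 - hsin2 x) ^ 3 <= 1).
  { intros x. assert (H := hsin2_bound x). apply pow_unit. lra. }
  assert (Q : forall x, Rabs (m x * u0 - M x) <= mu0 * (1 - hsin2 x) ^ 3).
  { intros x. rewrite Rel, Rabs_mult. destruct (cpow_decay l x Hl) as [H _]. assert (Hb := cpow_bound l x).
    rewrite (Rabs_pos_eq (cpow l x)), Rmult_comm by lra. apply Rmult_le_compat; auto using Rabs_pos; try lra.
    eapply Rle_trans; [apply A1|exact Hamu]. }
  assert (Q' : forall x, Rabs (m' x * u0 - M' x) <= mu0 * (1 - hsin2 x) ^ 3).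
  { intros x. rewrite Rel'. eapply Rle_trans; [apply Rabs_triang|]. rewrite !Rabs_mult.
    destruct (cpow_decay l x Hl) as [H1 H2]. assert (Hb := cpow_bound l x).
    rewrite (Rabs_pos_eq (cpow l x)) by lra.
    assert (R1 : Rabs (cpow' l x) * Rabs (u x - f x) <= (INR l * (1 - hsin2 x) ^ 3) * al)
      by (apply Rmult_le_compat; auto using Rabs_pos).
    assert (R2 : cpow l x * Rabs (u1 x - f' x) <= (1 - hsin2 x) ^ 3 * ga)
      by (apply Rmult_le_compat; auto using Rabs_pos; lra).
    rewrite Hmu. lra. }
  (* Removal of the normalization: the error is at most [(mu0 + (B + 1) mu0) / u0], and
     [1 / u0 <= 2] gives [2 * B + 4]. The bound [B + 1] covers both the mask and its derivative. *)
  assert (Gen : forall v V, Rabs V <= B + 1 -> Rabs (v * u0 - V) <= mu0 -> Rabs (v - V) <= (2 * B + 4) * mu0).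
  { intros v V HV Hv. replace (v - V) with (((v * u0 - V) - V * (u0 - 1)) * / u0) by (field; lra).
    rewrite Rabs_mult, (Rabs_pos_eq (/ u0)) by lra.
    assert (T : Rabs (v * u0 - V - V * (u0 - 1)) <= mu0 + (B + 1) * mu0).
    { eapply Rle_trans; [apply Rabs_triang|]. rewrite Rabs_Ropp, Rabs_mult.
      apply Rplus_le_compat; [exact Hv|]. apply Rmult_le_compat; auto using Rabs_pos; lra. }
    apply Rle_trans with ((mu0 + (B + 1) * mu0) * 2); [|lra].
    apply Rmult_le_compat; auto using Rabs_pos; lra. }
  assert (Gen0 : forall v s, 0 <= s -> Rabs (v * u0 - 0) <= mu0 * s -> Rabs v <= (2 * B + 4) * mu0 * s).
  { intros v s Hs Hv. rewrite Rminus_0_r, Rabs_mult, (Rabs_pos_eq u0) in Hv by lra.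
    assert (Hv0 := Rabs_pos v). assert (H0 : 0 <= mu0 * s) by (apply Rmult_le_pos; lra). nra. }
  assert (Wk : forall x y, y <= mu0 * (1 - hsin2 x) ^ 3 -> y <= mu0).
  { intros x y Hy. specialize (S3 x). nra. }
  exists m'. split; [|split; [|split; [|split; [|split; [|split; [|split]]]]]].
  - intros x. apply (is_derive_ext (fun y => / u0 * (cpow l y * u y))); [intros t; rewrite Em; unfold Rdiv; eq_R; ring|].
    replace (m' x) with (/ u0 * (cpow' l x * u x + cpow l x * u1 x)) by (unfold m', Rdiv; ring).
    apply (is_derive_scal (fun y => cpow l y * u y) x (/ u0)).
    apply (is_derive_mult (cpow l) u); [apply cpow_derive|apply DU|intros; apply Rmult_comm].
  - unfold m', Rdiv. cont_tac.
  - rewrite Em, C10. fold u0. field. lra.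
  - intros x. rewrite !Em, cpow_even. unfold u, u_l. rewrite usum_even; [reflexivity| |].
    + exact (cont_derivable _ _ Df).
    + intros; now apply mMl_even.
  - intros x. rewrite !Em, cpow_period. unfold u, u_l. now rewrite usum_period.
  - intros x. apply Gen; [|now apply (Wk x)]. unfold M. assert (Hb := mM_bound theta w0 x P Hw).
    rewrite Rabs_pos_eq; lra.
  - intros x. apply Gen; [|now apply (Wk x)]. specialize (HB x). lra.
  - intros x Hx. destruct (mM_zone theta w0 x P Hw Hx) as [Z1 Z2].
    assert (q := Q x). assert (q' := Q' x). unfold M in q. unfold M' in q'. rewrite Z1 in q. rewrite Z2 in q'.
    split; apply Gen0; auto; apply S3.
Qed.

(** * The orthogonal wavelets *)

(** Exchanges the derivative formulas accumulated by products for [Derive], so that they need not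
    appear in later statements. *)
Lemma near_ext rho K e f f' g g' f2 g2 : (forall x, f x = f2 x) -> (forall x, g x = g2 x) ->
  near rho K e f f' g g' -> near rho K e f2 (Derive f2) g2 (Derive g2).
Proof.
  intros Ef Eg [Df Cf Dg Cg B B' E E'].
  assert (D2 : forall x, is_derive f2 x (f' x)) by (intros x; now apply (is_derive_ext f)).
  assert (D3 : forall x, is_derive g2 x (g' x)) by (intros x; now apply (is_derive_ext g)).
  assert (U2 : forall x, Derive f2 x = f' x) by (intros; now apply is_derive_unique).
  assert (U3 : forall x, Derive g2 x = g' x) by (intros; now apply is_derive_unique).
  split; intros x; rewrite ?U2, ?U3, <- ?Ef, <- ?Eg; auto.
  - apply (continuous_ext f'); [intros; now rewrite U2|apply Cf].
  - apply (continuous_ext g'); [intros; now rewrite U3|apply Cg].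
Qed.

Lemma near_mono rho K K' e f f' g g' : (forall x, 0 <= rho x) -> 0 <= e -> K <= K' ->
  near rho K e f f' g g' -> near rho K' e f f' g g'.
Proof.
  intros Hr He HK [Df Cf Dg Cg B B' E E'].
  assert (A : forall x, K * rho x <= K' * rho x) by (intros; now apply Rmult_le_compat_r).
  assert (A' : forall x, K * e * rho x <= K' * e * rho x).
  { intros. apply Rmult_le_compat_r; [apply Hr|]. now apply Rmult_le_compat_r. }
  split; auto; intros x; eapply Rle_trans; eauto.
Qed.

Lemma one_le_mult a b : 1 <= a -> 1 <= b -> 1 <= a * b.
Proof. nra. Qed.

(** The real factor left when the phase is removed, in the shape of [psi_perp_hat], so that the two
    are identified by computation. *)
Definition symbol (m phi : R -> R) (w : R) : R :=
  let Phi := per (fun x => Rabs (phi x) ^ 2) in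
  (m (w / 2 + PI) * sqrt (Phi (w / 2 + PI)) / sqrt (Phi (2 * (w / 2 + PI))))
  * (phi (w / 2) / sqrt (Phi (w / 2))).

Definition symbol0 (M phi0 : R -> R) (w : R) : R := M (w / 2 + PI) * phi0 (w / 2).

(** [eta] makes [K3 * e <= 1 / 2], as the square root and the inverse require. [K7] is the constant
    produced by the nested products, and 16 compares [dec (x / 2)] with [dec x]. *)
Lemma symbol_near (Km Kp : R) : 1 <= Km -> 1 <= Kp ->
  exists K eta, 1 <= K /\ 0 < eta /\ forall e m m' M M' phi phi' phi0 phi0', 0 <= e <= eta ->
    near (fun _ => 1) Km e m m' M M' -> near dec Kp e phi phi' phi0 phi0' ->
    (forall x, per (fun x => phi0 x ^ 2) x = 1) ->
    near dec K e (symbol m phi) (Derive (symbol m phi)) (symbol0 M phi0) (Derive (symbol0 M phi0)).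
Proof.
  intros HKm HKp.
  set (K3 := 1 + Rabs (Cper * (6 * Kp * Kp))).
  assert (HK3 : 1 <= K3) by (unfold K3; assert (H := Rabs_pos (Cper * (6 * Kp * Kp))); lra).
  set (K7 := 6 * (6 * (6 * Km * K3) * (4 * K3)) * (6 * Kp * (4 * K3))).
  assert (HK7 : 1 <= K7).
  { repeat apply one_le_mult; lra. }
  exists (K7 * 16), (Rmin 1 (1 / (2 * K3))). split; [lra|]. split.
  { apply Rmin_pos; [lra|]. apply Rdiv_lt_0_compat; lra. }
  intros e m m' M M' phi phi' phi0 phi0' [He He2] Nm Np Horth.
  assert (He1 : 0 <= e <= 1) by (split; [exact He|eapply Rle_trans; [exact He2|apply Rmin_l]]).
  assert (HK3e : K3 * e <= 1 / 2).
  { assert (H : e <= 1 / (2 * K3)) by (eapply Rle_trans; [exact He2|apply Rmin_r]).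
    apply Rle_trans with (K3 * (1 / (2 * K3))); [apply Rmult_le_compat_l; lra|right; field; lra]. }
  destruct (near_per Kp e phi phi' phi0 phi0' ltac:(lra) He1 Np Horth) as [F' NP].
  apply (near_mono _ _ K3) in NP; [|intros; lra|lra|unfold K3; assert (H := Rle_abs (Cper * (6 * Kp * Kp))); lra].
  assert (NS := near_sqrt K3 e _ _ He1 HK3e NP).
  assert (NI := near_inv K3 e _ _ He1 HK3 HK3e NS).
  assert (H2 : Rabs (/ 2) <= 1) by (rewrite Rabs_pos_eq; lra).
  assert (H1 : Rabs 1 <= 1) by (rewrite Rabs_R1; lra).
  assert (N1 := near_affine _ _ _ _ _ _ _ (/ 2) PI Nm H2).
  assert (N2 := near_affine _ _ _ _ _ _ _ (/ 2) PI NS H2).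
  (* The argument [2 * (w / 2 + PI)] is [w + 2 * PI], of slope 1, so it is admissible for
     [near_affine]. *)
  assert (N3 := near_affine _ _ _ _ _ _ _ 1 (2 * PI) NI H1).
  assert (N4 := near_affine _ _ _ _ _ _ _ (/ 2) 0 Np H2).
  assert (N5 := near_affine _ _ _ _ _ _ _ (/ 2) 0 NI H2).
  assert (N := near_mult _ _ _ _ _ _ _ _ _ _ _ _ _ He1
    (near_mult _ _ _ _ _ _ _ _ _ _ _ _ _ He1 (near_mult _ _ _ _ _ _ _ _ _ _ _ _ _ He1 N1 N2) N3)
    (near_mult _ _ _ _ _ _ _ _ _ _ _ _ _ He1 N4 N5)).
  fold K7 in N.
  apply (near_weight _ dec 16) in N; [|clear|exact He|lra].
  - refine (near_ext _ _ _ _ _ _ _ _ _ _ _ N).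
    + intros w. unfold symbol. unfold Rdiv.
      replace (/ 2 * w) with (w * / 2) by ring. replace (1 * w + 2 * PI) with (2 * (w * / 2 + PI)) by field.
      rewrite Rplus_0_r. ring.
    + intros w. unfold symbol0. unfold Rdiv. replace (/ 2 * w) with (w * / 2) by ring.
      rewrite Rplus_0_r. ring.
  - intros x. rewrite !Rmult_1_l, Rmult_1_r, Rplus_0_r. split; [left; apply dec_pos|].
    unfold dec. assert (Ha := cauchy_weight_pos x). assert (Hb := cauchy_weight_pos (/ 2 * x)).
    assert (Hx := pow2_ge_0 x).
    apply Rmult_le_reg_r with ((1 + (/ 2 * x) ^ 2) ^ 2 * (1 + x ^ 2) ^ 2).
    + apply Rmult_lt_0_compat; now apply pow_lt.
    + replace (/ (1 + (/ 2 * x) ^ 2) ^ 2 * ((1 + (/ 2 * x) ^ 2) ^ 2 * (1 + x ^ 2) ^ 2)) with ((1 + x ^ 2) ^ 2) by (field; lra).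
      replace (16 * / (1 + x ^ 2) ^ 2 * ((1 + (/ 2 * x) ^ 2) ^ 2 * (1 + x ^ 2) ^ 2)) with ((4 * (1 + (/ 2 * x) ^ 2)) ^ 2) by (field; lra).
      apply pow_incr. replace ((/ 2 * x) ^ 2) with (/ 4 * x ^ 2) by field. lra.
Qed.

(** Reflection exchanges the two one-sided series once the unshifted term is split off. *)
Lemma per_even (f : R -> R) K w : 0 <= K -> (forall x, Rabs (f x) <= K / (1 + x ^ 2)) ->
  (forall x, f (- x) = f x) -> per f (- w) = per f w.
Proof.
  intros HK B Ev. unfold per.
  destruct (ex_series_shift f K w HK B) as [E1 _].
  destruct (ex_series_shift f K (- w) HK B) as [E2 _].
  rewrite (Series_incr_1 _ E1), (Series_incr_1 _ E2).
  rewrite (Series_ext (fun k => f (- w + 2 * PI * INR (S k))) (fun k => f (w - 2 * PI * INR (S k)))).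
  2: { intros k. rewrite <- Ev. f_equal. ring. }
  rewrite (Series_ext (fun k => f (- w - 2 * PI * INR (S k))) (fun k => f (w + 2 * PI * INR (S k)))).
  2: { intros k. rewrite <- Ev. f_equal. ring. }
  replace (- w + 2 * PI * INR 0) with (- w) by (simpl; ring).
  replace (w + 2 * PI * INR 0) with w by (simpl; ring). rewrite Ev. ring.
Qed.

Lemma infprod_even m x : (forall x, m (- x) = m x) -> infprod m (- x) = infprod m x.
Proof.
  intros Ev. unfold infprod. f_equal. apply Lim_seq_ext. intros N.
  induction N as [|N IH]; cbn [partprod]; [reflexivity|]. rewrite IH. f_equal.
  rewrite <- Ev. f_equal. unfold Rdiv. ring.
Qed.

Lemma symbol_even (m phi : R -> R) K : 0 <= K -> (forall x, Rabs (phi x) <= K * dec x) ->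
  (forall x, m (- x) = m x) -> (forall x, m (x + 2 * PI) = m x) -> (forall x, phi (- x) = phi x) ->
  forall w, symbol m phi (- w) = symbol m phi w.
Proof.
  intros HK B Em Pm Ep w. unfold symbol.
  set (f := fun x => Rabs (phi x) ^ 2).
  assert (Bf : forall x, Rabs (f x) <= K ^ 2 / (1 + x ^ 2)).
  { intros x. unfold f. assert (D := dec_pos x). assert (D1 := dec_le1 x). assert (D2 := dec_le_cauchy x).
    rewrite pow2_abs, <- RPow_abs. apply Rle_trans with ((K * dec x) ^ 2).
    - apply pow_incr. split; [apply Rabs_pos|apply B].
    - rewrite Rpow_mult_distr. apply Rmult_le_compat_l; [apply pow2_ge_0|]. nra. }
  assert (HK2 : 0 <= K ^ 2) by apply pow2_ge_0.
  assert (Pev : forall x, per f (- x) = per f x).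
  { intros x. apply (per_even f (K ^ 2) x HK2 Bf). intros y. unfold f. now rewrite Ep. }
  assert (Pper : forall x, per f (x + 2 * PI) = per f x) by (intros; now apply (per_periodic f (K ^ 2))).
  (* [- w / 2 + PI] and [w / 2 + PI] are opposite modulo [2 * PI]. *)
  assert (R1 : forall g : R -> R, (forall x, g (- x) = g x) -> (forall x, g (x + 2 * PI) = g x) ->
    g (- w / 2 + PI) = g (w / 2 + PI)).
  { intros g Eg Pg. rewrite <- Eg, <- Pg. f_equal. field. }
  rewrite (R1 m Em Pm), (R1 (per f) Pev Pper).
  replace (- w / 2) with (- (w / 2)) by field. rewrite Pev, Ep.
  (* The arguments are [2 * PI - w] and [2 * PI + w]; evenness and a few added periods bring both to
     one point. *)
  replace (per f (2 * (- (w / 2) + PI))) with (per f (2 * (w / 2 + PI))); [reflexivity|].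
  rewrite <- Pev, <- (Pper (2 * (- (w / 2) + PI))), <- (Pper (- (2 * (w / 2 + PI)))).
  rewrite <- (Pper (_ + 2 * PI)), <- (Pper (- (2 * (w / 2 + PI)) + 2 * PI + 2 * PI)). f_equal. field.
Qed.

Lemma phased_intro a b z : Cmult z (Cmult (Cconj (RtoC a)) (RtoC b)) = Cmult z (RtoC (a * b)).
Proof. f_equal. unfold Cmult, Cconj, RtoC; simpl. f_equal; ring. Qed.

Theorem theorem7 (theta : R -> R) (w0 : R) (lam : nat -> nat -> R)
  (n : nat -> nat) (l0 : nat)
  (Htheta_odd : forall x, theta (- x) = - theta x)
  (Htheta_mono : forall x y, x <= y -> theta x <= theta y)
  (Htheta_d1 : forall x, ex_derive theta x)
  (Htheta_d2 : forall x, ex_derive (Derive theta) x)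
  (Htheta_c2 : forall x, continuous (Derive_n theta 2) x)
  (Htheta_flat : forall x, PI / 3 < x -> theta x = PI / 4)
  (Hw0 : PI / 3 <= w0 < PI / 2)
  (Halpha : is_lim_seq (fun l => INR l * alpha theta w0 lam n l) 0)
  (Hgamma : is_lim_seq (fun l => gamma theta w0 lam n l) 0)
  (Hpi : forall l, u_l theta w0 lam n l PI <> 0)
  (Hc : 0 < cconst theta w0 lam n l0) :
  (exists K : R, exists N : nat, forall l : nat, (N <= l)%nat ->
     Rabs (radius2 (psi_perp_hat theta w0 lam n l) - radius2 (psiM_hat theta w0))
     <= K * Rmax (mu theta w0 lam n l)
                 (INR l * Rpower (C0 w0)
                    (- INR l + 2 * log2 ((1 + eps theta w0 lam n l) / cconst theta w0 lam n l0))))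
  /\
  (exists K : R, exists N : nat, forall l : nat, (N <= l)%nat ->
     Rabs (radius2 (inv_fourier (psi_perp_hat theta w0 lam n l))
           - radius2 (inv_fourier (psiM_hat theta w0)))
     <= K * Rmax (mu theta w0 lam n l)
                 (Rpower (4 * exp (2 * w0))
                    (- INR l + 2 * log2 ((1 + eps theta w0 lam n l) / cconst theta w0 lam n l0)))).
Proof.
  assert (P := profile_intro theta Htheta_odd Htheta_mono Htheta_d1 Htheta_d2 Htheta_flat).
  assert (HPI := PI_RGT_0).
  enough (Main : exists K N, 0 <= K /\ forall l, (N <= l)%nat ->
    Rabs (radius2 (psi_perp_hat theta w0 lam n l) - radius2 (psiM_hat theta w0)) <= K * mu theta w0 lam n l /\
    Rabs (radius2 (inv_fourier (psi_perp_hat theta w0 lam n l)) - radius2 (inv_fourier (psiM_hat theta w0)))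
      <= K * mu theta w0 lam n l).
  { destruct Main as [K [N [HK Main]]].
    split; exists K, N; intros l Hl; destruct (Main l Hl) as [M1 M2];
      (eapply Rle_trans; [eassumption|apply Rmult_le_compat_l; [exact HK|apply Rmax_l]]). }
  destruct (mM'_bounded theta w0 P) as [B HB].
  destruct (mM_C1 theta w0 P Hw0) as [DM CM]. destruct (phi0_C1 theta w0 P) as [Dp Cp].
  destruct (phi0_values theta w0 P Hw0) as [V1 [V2 V3]].
  destruct (scaling_near B) as [Kp [HKp Sc]].
  assert (HM : forall x, Rabs (mM theta w0 x) <= 1).
  { intros x. assert (H := mM_bound theta w0 x P Hw0). rewrite Rabs_pos_eq; lra. }
  assert (V4 : forall x, Rabs x <= 4 * PI / 3 ->
    phi0 theta w0 x = mM theta w0 (x / 2) /\ phi0' theta w0 x = / 2 * mM' theta w0 (x / 2)).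
  { intros x Hx.
    assert (Hx2 : Rabs (x / 2) < 4 * PI / 3) by (unfold Rdiv; rewrite Rabs_mult, (Rabs_pos_eq (/ 2)); lra).
    split.
    - rewrite mM_local by assumption. f_equal. field.
    - assert (L : is_derive (mM theta w0) (x / 2) (2 * phi0' theta w0 x)).
      { apply (is_derive_ext_loc (fun y => phi0 theta w0 (2 * y))).
        - apply (filter_imp (fun y => Rabs y < 4 * PI / 3)); [intros y Hy; symmetry; now apply mM_local|].
          apply (continuous_Rabs (x / 2) (fun u => u < 4 * PI / 3)). now apply (open_lt (4 * PI / 3)).
        - replace x with (2 * (x / 2)) at 2 by field.
          apply (is_derive_comp (phi0 theta w0) (fun y => 2 * y)); [apply Dp|]. auto_derive; [exact I|ring]. }
      apply is_derive_unique in L. rewrite (is_derive_unique _ _ _ (DM (x / 2))) in L. lra. }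
  specialize (Sc _ _ _ _ DM CM HM HB Dp Cp V1 V4 V2).
  assert (Orth := phi0_orthonormal theta w0 P Hw0).
  destruct (mask_near theta w0 P Hw0) as [C [HC Mask]].
  set (Km := Rabs B + 1). assert (HKm : 1 <= Km) by (unfold Km; assert (H := Rabs_pos B); lra).
  destruct (symbol_near Km (Kp + 1) HKm ltac:(lra)) as [K [eta1 [HK [Heta1 Sym]]]].
  set (G0 := symbol0 (mM theta w0) (phi0 theta w0)).
  assert (NearM : forall m m' e, 0 <= e -> (forall x, is_derive m x (m' x)) -> cont m' ->
    (forall x, Rabs (m x - mM theta w0 x) <= e) -> (forall x, Rabs (m' x - mM' theta w0 x) <= e) ->
    near (fun _ => 1) Km e m m' (mM theta w0) (mM' theta w0)).
  { intros m m' e He D C' H1 H2. assert (Hb := Rle_abs B). split; auto; intros x; rewrite Rmult_1_r.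
    - eapply Rle_trans; [apply HM|lra].
    - eapply Rle_trans; [apply HB|unfold Km; lra].
    - eapply Rle_trans; [apply H1|nra].
    - eapply Rle_trans; [apply H2|nra]. }
  assert (M0 : mM theta w0 0 = 1).
  { rewrite mM_local by (try assumption; rewrite Rabs_R0; lra). apply V1. rewrite Rmult_0_r, Rabs_R0. lra. }
  (* The bounds on [G0] are read off the perturbation estimate with no perturbation. *)
  assert (NG0 : near dec K 0 (symbol (mM theta w0) (infprod (mM theta w0)))
    (Derive (symbol (mM theta w0) (infprod (mM theta w0)))) G0 (Derive G0)).
  { assert (Zr : forall v : R, Rabs (v - v) <= 0) by (intros; rewrite Rminus_diag, Rabs_R0; lra).
    destruct (Sc (mM theta w0) (mM' theta w0) 0 DM CM M0 ltac:(lra) (fun x => Zr _) (fun x => Zr _)) as [p' Np].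
    - intros x Hx. destruct (mM_zone theta w0 x P Hw0 Hx) as [-> ->]. rewrite Rabs_R0. lra.
    - apply (Sym 0 _ (mM' theta w0) _ (mM' theta w0) _ p' _ (phi0' theta w0)); [lra| | |exact Orth].
      + apply NearM; auto; lra.
      + apply (near_mono _ Kp); [intros; left; apply dec_pos|lra|lra|exact Np]. }
  destruct NG0 as [_ _ D0 C0' B0 B0' _ _].
  (* At [w = 2 * PI] the mask factor is its value 1 at a multiple of the period, and [phi0 PI] is
     positive because the sum of squares at the midpoint [PI] reads [2 * phi0 PI ^ 2 = 1]. *)
  destruct (radii_near G0 (Derive G0) K (2 * PI) HK D0 C0' B0 B0') as [A [eta2 [HA [Heta2 Rad]]]].
  { intros x. unfold G0, symbol0.
    replace (- x / 2) with (- (x / 2)) by field. rewrite phi0_even. f_equal.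
    rewrite <- (mM_even theta w0 (- (x / 2) + PI)) by assumption.
    rewrite <- mM_period. f_equal. ring. }
  { intros x. apply Rmult_le_pos; [now apply mM_bound|apply V3]. }
  { unfold G0, symbol0. replace (2 * PI / 2) with PI by field.
    replace (PI + PI) with (0 + 2 * PI) by ring. rewrite mM_period, M0, Rmult_1_l, phi0_abs by assumption.
    rewrite Rabs_pos_eq by lra. destruct (hM_values theta w0 P Hw0) as [_ [_ [Hb Sq]]].
    assert (S := Sq PI). replace (2 * PI - PI) with PI in S by ring. specialize (Hb PI). nra. }
  (* Threshold for [mu] below which [e = C * mu] meets the demands of the mask and product
     estimates, of the symbol and of the radii. *)
  set (d := Rmin (1 / 16) (Rmin eta1 eta2) / C).
  assert (Hmin : 0 < Rmin (1 / 16) (Rmin eta1 eta2)) by (repeat apply Rmin_pos; lra).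
  assert (Hd : 0 < d) by (apply Rdiv_lt_0_compat; lra).
  assert (Lim : is_lim_seq (mu theta w0 lam n) 0).
  { replace (Finite 0) with (Finite (0 + 0)) by (f_equal; ring). apply is_lim_seq_plus'; assumption. }
  apply is_lim_seq_spec in Lim. destruct (Lim (mkposreal d Hd)) as [N HN]. simpl in HN.
  (* The added 4 guarantees [l >= 4], as the decay of the cosine power requires. *)
  exists (A * C), (N + 4)%nat. split; [apply Rmult_le_pos; lra|].
  intros l Hl. specialize (HN l ltac:(lia)). apply Rabs_def2 in HN.
  set (e := C * mu theta w0 lam n l).
  destruct (approx_bounds theta w0 lam n l P Hw0) as [Ab [Gb _]].
  assert (Hga : 0 <= gamma theta w0 lam n l) by (eapply Rle_trans; [apply Rabs_pos|apply (Gb 0)]).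
  (* [u_l] is nonzero at [PI] while the divided mask vanishes there, so [alpha > 0]. Hence [e > 0],
     and the weighted inequality for the time energies may divide by [e]. *)
  assert (Hal : 0 < alpha theta w0 lam n l).
  { eapply Rlt_le_trans; [|apply (Ab PI)].
    assert (Z : mMl theta w0 l PI = 0).
    { unfold mMl. destruct (mM_zone theta w0 PI P Hw0) as [-> _]; [|unfold Rdiv; ring].
      unfold hsin2. rewrite cos_PI. lra. }
    rewrite Z, Rminus_0_r. apply Rabs_pos_lt, Hpi. }
  assert (HlR : 1 <= INR l) by (apply (le_INR 1); lia).
  assert (Hmu : alpha theta w0 lam n l <= mu theta w0 lam n l) by (unfold mu; nra).
  assert (He : 0 < e) by (unfold e; apply Rmult_lt_0_compat; lra).
  assert (Hed : e <= Rmin (1 / 16) (Rmin eta1 eta2)).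
  { apply Rle_trans with (C * d); [apply Rmult_le_compat_l; lra|right; unfold d; field; lra]. }
  assert (He16 : e <= 1 / 16) by (eapply Rle_trans; [exact Hed|apply Rmin_l]).
  assert (He1 : e <= eta1) by (eapply Rle_trans; [exact Hed|eapply Rle_trans; [apply Rmin_r|apply Rmin_l]]).
  assert (He2 : e <= eta2) by (eapply Rle_trans; [exact Hed|eapply Rle_trans; [apply Rmin_r|apply Rmin_r]]).
  assert (Hmue : mu theta w0 lam n l <= e) by (unfold e; nra).
  destruct (Mask lam n l ltac:(lia) ltac:(lra)) as [m' [Dm [Cm [m0 [Em [Pm [Q1 [Q2 Q3]]]]]]]].
  set (m := m_l theta w0 lam n l) in *.
  destruct (Sc m m' e Dm Cm m0 ltac:(lra) Q1 Q2 Q3) as [p' Np].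
  apply (near_mono _ _ (Kp + 1)) in Np; [|intros; left; apply dec_pos|lra|lra].
  assert (NG := Sym e m m' _ _ _ p' _ _ ltac:(lra) (NearM m m' e ltac:(lra) Dm Cm Q1 Q2) Np Orth).
  rewrite Rmult_assoc.
  apply (Rad e (symbol m (infprod m)) (Derive (symbol m (infprod m)))); auto.
  - apply (symbol_even m (infprod m) (2 * (Kp + 1))); auto; [lra| |intros; now apply infprod_even].
    intros x. destruct Np as [_ _ _ _ b _ ee _].
    eapply Rle_trans; [exact (Rabs_near _ _ _ _ (b x) (ee x))|]. assert (D := dec_pos x).
    assert ((Kp + 1) * e * dec x <= (Kp + 1) * dec x) by (apply Rmult_le_compat_r; nra). lra.
  - intros w. unfold psi_perp_hat. rewrite phased_intro. reflexivity.
  - intros w. unfold psiM_hat. rewrite phased_intro, phiM_hat_phi0 by assumption. reflexivity.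
Qed.
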